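(* There exist absolute constants $c,C_0,C_1>0$ such that the following holds. Let $\mathbf{a}_1,\ldots,\mathbf{a}_m\in\mathbb{C}^d$ be independent complex Gaussian random vectors, $\mathbf{a}_j\sim\mathcal{N}(0,\frac12\mathbf{I}_d)+\mathcal{N}(0,\frac12\mathbf{I}_d)\,i$, and let $\mathcal{A}(X)=(\mathbf{a}_1^*X\mathbf{a}_1,\ldots,\mathbf{a}_m^*X\mathbf{a}_m)$. Let $\mathbf{x}_0\in\mathbb{C}^d$ with $\|\mathbf{x}_0\|_0\le k$, $\mathbf{w}\in\mathbb{R}^m$, $\mathbf{b}=\mathcal{A}(\mathbf{x}_0\mathbf{x}_0^* )+\mathbf{w}$, and assume $m\ge C_0\,k\log(ed/k)$. Then with probability at least $1-\exp(-cm)$ the following holds: if $\mu>0$, $\frac12\|\mathbf{b}\|_2^2>\mu\|\mathbf{x}_0\|_1^2+\frac12\|\mathbf{w}\|_2^2$, and $$\lambda>\frac{\mu d+\|\mathcal{A}\|\big(\sqrt{2\mu}\,\|\mathbf{x}_0\|_1+\|\mathbf{w}\|_2\big)}{\sqrt2-1},$$ then any global minimizer $X^\#$ of $$\min_{X\in\mathbb{C}^{d\times d},\ X\succeq 0}\ \lambda\big(\mathrm{Tr}(X)-\|X\|_F\big)+\mu\|X\|_1+\frac12\|\mathcal{A}(X)-\mathbf{b}\|_2^2$$ has $\mathrm{rank}(X^\#)=1$, and, writing $X^\#=\mathbf{x}^\#(\mathbf{x}^\#)^*$, $$\|\mathbf{x}^\#(\mathbf{x}^\#)^*-\mathbf{x}_0\mathbf{x}_0^*\|_F\le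 C_1\left[\frac{\|\mathbf{w}\|_2}{\sqrt{\mu k}}\left(\|\mathbf{x}_0\|_1+\frac{\|\mathbf{w}\|_2}{\sqrt\mu}\right)+\frac{\|\mathbf{w}\|_2^2}{2\mu k}+\mu k\left(\frac{\|\mathbf{w}\|_2}{\mu k}+\frac1{\sqrt m}\right)^2\right].$$
   Context: For $X\in\mathbb{C}^{d\times d}$: $\|X\|_1=\sum_{i,j}|X_{i,j}|$ is the entrywise $\ell_1$ norm, $\|X\|_F$ is the Frobenius norm, and $X\succeq0$ means Hermitian positive semidefinite. $\|\mathbf{x}\|_0$ is the number of nonzero entries of $\mathbf{x}$; $\|\mathbf{x}\|_1,\|\mathbf{x}\|_2$ are the $\ell_1$, $\ell_2$ norms. $\|\mathcal{A}\|=\sup\{\|\mathcal{A}(X)\|_2: X\in\mathbb{C}^{d\times d},\ \|X\|_F=1\}$. The notation $\mathcal{N}(0,\frac12\mathbf{I}_d)+\mathcal{N}(0,\frac12\mathbf{I}_d)\,i$ means that the real and imaginary parts are independent real Gaussian vectors, each with mean $0$ and covariance $\frac12\mathbf{I}_d$. Here $1\le k\le d$. *)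

(* Defs.v *)
From HB Require Import structures.
From mathcomp Require Export all_boot all_order all_algebra.
From mathcomp Require Export all_classical all_reals all_analysis.
From mathcomp Require Export complex.

Set Implicit Arguments.
Unset Strict Implicit.
Unset Printing Implicit Defensive.

Export Order.TTheory GRing.Theory Num.Theory.
Export numFieldNormedType.Exports.

#[export] Set Implicit Arguments.

#[global] Open Scope classical_set_scope.
#[global] Open Scope sesquilinear_scope.
#[global] Open Scope complex_scope.
#[global] Open Scope ring_scope.

Section Norms.
Variable R : realType.

(* The norms are valued in R rather than in R[i]: normc is the real modulus.
   On column vectors they are the usual vector norms. *)
Definition norm1 (p q : nat) (M : 'M[R[i]]_(p, q)) : R :=
  \sum_i \sum_j ComplexField.Normc.normc (M i j).

(* Frobenius norm of a matrix, Euclidean norm of a vector *)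
Definition norm2 (p q : nat) (M : 'M[R[i]]_(p, q)) : R :=
  Num.sqrt (\sum_i \sum_j ComplexField.Normc.normc (M i j) ^+ 2).

Definition norm0 (d : nat) (x : 'cV[R[i]]_d) : nat :=
  #|[set i | x i 0 != 0]%SET|.

End Norms.

Section Matrices.
Variable R : realType.

(* 0 <= z in R[i] means that z is real and nonnegative *)
Definition psd (d : nat) (X : 'M[R[i]]_d) : Prop :=
  X \is hermsymmx /\ forall v : 'cV[R[i]]_d, 0 <= (v ^t* *m X *m v) 0 0.

Definition qmeas (d m : nat) (a : 'I_m -> 'cV[R[i]]_d) (X : 'M[R[i]]_d) :
    'cV[R[i]]_m :=
  \col_j ((a j) ^t* *m X *m a j) 0 0.

Definition opnorm (d m : nat) (A : 'M[R[i]]_d -> 'cV[R[i]]_m) : R :=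
  sup [set norm2 (A X) | X in [set X : 'M[R[i]]_d | norm2 X = 1]].

(* The trace is real for the Hermitian X over which we minimize. *)
Definition objective (d m : nat) (A : 'M[R[i]]_d -> 'cV[R[i]]_m)
    (b : 'cV[R[i]]_m) (lambda mu : R) (X : 'M[R[i]]_d) : R :=
  lambda * (complex.Re (\tr X) - norm2 X) + mu * norm1 X
  + 2^-1 * norm2 (A X - b) ^+ 2.

Definition global_minimizer (U : Type) (D : set U) (f : U -> R) (x : U) : Prop :=
  D x /\ forall y, D y -> f x <= f y.

End Matrices.

Section Gaussian.
Context (disp : measure_display) (T : measurableType disp) (R : realType).
Variable P : probability T R.

Definition mutually_independent (disp' : measure_display)
    (E : measurableType disp') (I : finType) (X : I -> T -> E) : Prop :=
  (forall i, measurable_fun setT (X i)) /\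
  forall (J : {set I}) (B : I -> set E), (forall i, measurable (B i)) ->
    P (\bigcap_(i in [set` J]) (X i @^-1` B i))
    = (\prod_(i in J) P (X i @^-1` B i))%E.

(* N(0, s^2 I_d): independent coordinates, each of law N(0, s^2);
   the second parameter of normal_prob is the standard deviation. *)
Definition isotropic_gaussian (d : nat) (s : R) (g : T -> d.-tuple R) : Prop :=
  mutually_independent (fun (i : 'I_d) t => tnth (g t) i) /\
  forall (i : 'I_d) (B : set R), measurable B ->
    P ((fun t => tnth (g t) i) @^-1` B) = normal_prob 0 s B.

Definition re_vec (d : nat) (v : 'cV[R[i]]_d) : d.-tuple R :=
  [tuple complex.Re (v i 0) | i < d].

Definition im_vec (d : nat) (v : 'cV[R[i]]_d) : d.-tuple R :=
  [tuple complex.Im (v i 0) | i < d].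

(* C^d is given the Borel structure of R^d * R^d. *)
Definition re_im (d : nat) (v : 'cV[R[i]]_d) : d.-tuple R * d.-tuple R :=
  (re_vec v, im_vec v).

(* N(0, I_d / 2) + N(0, I_d / 2) i *)
Definition complex_gaussian (d : nat) (a : T -> 'cV[R[i]]_d) : Prop :=
  [/\ mutually_independent
        (fun (part : bool) t => if part then re_vec (a t) else im_vec (a t)),
      isotropic_gaussian (Num.sqrt 2^-1) (fun t => re_vec (a t)) &
      isotropic_gaussian (Num.sqrt 2^-1) (fun t => im_vec (a t))].

Definition independent_complex_gaussians (d m : nat)
    (a : 'I_m -> T -> 'cV[R[i]]_d) : Prop :=
  mutually_independent (fun j t => re_im (a j t)) /\
  forall j, complex_gaussian (a j).

End Gaussian.

(* Main.v *)
From HB Require Import structures.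
Require Import Defs.
From mathcomp Require Import measurable_realfun ring lra.

(** A minimizer has rank one: if X had two positive eigenvalues, moving both of
    them towards zero, in the direction of the projection of X / |X|_F - 1, would
    decrease Tr - |.|_F at rate at least sqrt 2 - 1 per unit Frobenius norm,
    which beats the variation of the other terms for the prescribed lambda.

    So X = x x^*, and the phase of x can be chosen with <x, x0> >= 0. Put
    h = x - x0. Optimality bounds |x|_1 by |x0|_1 up to noise, hence
    |h|_1 <= 2 sqrt k |h|_2 up to noise, and
    a_j^* (x x^* - x0 x0^* ) a_j = Re (conj (a_j^* h) (a_j^* (2 x0 + h))).
    The theorem then follows from a lower bound
    c m |h| (|x0| + |h|) <= sum_j |a_j^* (x x^* - x0 x0^* ) a_j|,
    uniform over the h with |h|_1 <= C sqrt k |h|_2 and <h, x0> real,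
    at least - |x0|^2.

    For fixed vectors p, r this lower bound is a Chernoff bound for
    exp (- |Re (conj (a^* p) (a^* r))|), whose mean is controlled by the second and
    fourth moments. Uniformity comes from a union bound over a net made of rescaled
    integer vectors of bounded l1 norm, of which there are exp (O (k log (e d / k))).
    The same integer vectors control the discretization error: they
    contain maximizers of linear forms over the sets
    { e | |e|_oo <= 1, |e|_1 <= N } in which rounding errors lie. *)

Set Implicit Arguments.
Unset Strict Implicit.
Unset Printing Implicit Defensive.

(** The obstacle is that the form degenerates. It vanishes identically when its second argument is a
    real multiple of [rlJ] of the first, because [x x^*] does not see the phase of [x]; and it
    vanishes at [h = - 2 x0], that is at [x = - x0]. The two conditions on [<h, x0>] exclude exactly
    these directions: they keep the Gram quantity [|p|^2 |r|^2 - <J p, r>^2] away from zero, and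
    with it the second moment of the form. The form is bilinear, so rounding its arguments with
    relative error [1 / n0] costs [O(m / n0)]. Hence [n0] can be an absolute constant and the net
    stays small. Since [x0] is fixed before the event, its direction is a single extra vector, and
    only the direction of [h] and the ratio of [|h|] to [|x0|] are discretized. Rank one holds for
    every outcome. Probability enters only through the error estimate, by an event that is built
    from [x0] alone and serves all noises and all values of [mu] and [lambda]. On the Gaussian side
    only moment generating functions are computed; all moments are extracted from them. *)

(** * Integrals against weighted image measures *)

Section Density.
Context d (T : measurableType d) (R : realType) (mu : {measure set T -> \bar R}).
Context d' (E : measurableType d') (nu : {measure set E -> \bar R}).
Import HBNNSimple.

(** Monotone convergence extends the hypothesis from indicators to simple functions and then to [f].
    Having both a map [X] and a weight [G] covers three situations at once: laws of random variables
    ([G = 1]), densities ([X = id]) and independence of [X] and [G]. *)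
Lemma ge0_integral_density (X : T -> E) (G : T -> R) (f : E -> R) :
  measurable_fun setT X -> measurable_fun setT G -> (forall t, 0 <= G t) ->
  measurable_fun setT f -> (forall x, 0 <= f x) ->
  (forall B, measurable B -> nu B = \int[mu]_t (\1_B (X t) * G t)%:E)%E ->
  (\int[nu]_x (f x)%:E = \int[mu]_t (f (X t) * G t)%:E)%E.
Proof.
move=> mX mG G0 mf f0 nuE.
have mf' : measurable_fun [set: E] (fun x => (f x)%:E) by exact/measurable_EFinP.
pose h := nnsfun_approx measurableT mf'.
have f0' x : (0 <= (f x)%:E)%E by rewrite lee_fin.
have hcvg x : (EFin \o h^~ x) @ \oo --> (f x)%:E.
  exact: (@cvg_nnsfun_approx _ _ _ _ measurableT _ mf' (fun x _ => f0' x)).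
have hnd x : nondecreasing_seq (h^~ x).
  by move=> m n mn; exact/lefP/nd_nnsfun_approx.
have mh n : measurable_fun setT (h n \o X) by exact: measurableT_comp.
have simple n : (\int[nu]_x (h n x)%:E = \int[mu]_t (h n (X t) * G t)%:E)%E.
  have mI y : measurable_fun setT (fun t => \1_(h n @^-1` [set y]) (X t) : R).
    exact: measurableT_comp.
  symmetry; transitivity (\int[mu]_t (\sum_(y \in range (h n))
      (y%:E * (\1_(h n @^-1` [set y]) (X t) * G t)%:E)))%E.
    apply: eq_integral => t _; rewrite fimfunE mulrC fsbig_finite//= big_distrr/=.
    rewrite fsbig_finite//= sumEFin; congr _%:E; apply: eq_bigr => y _.
    by ring.
  have r0 y t : (0 <= y%:E * (\1_(h n @^-1` [set y]) (X t) * G t)%:E)%E.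
    rewrite -EFinM lee_fin mulrA mulr_ge0//.
    by have := nnfun_muleindic_ge0 (h n) y (X t); rewrite -EFinM lee_fin.
  rewrite ge0_integral_fsum//; last first.
    by move=> y; apply/measurable_EFinP; do 2 apply: measurable_funM => //.
  under [RHS]eq_integral do rewrite fimfunE -fsumEFin//.
  rewrite [RHS]ge0_integral_fsum//; last 2 first.
    by move=> y; apply/measurable_EFinP; apply: measurable_funM.
    by move=> y t _; rewrite EFinM nnfun_muleindic_ge0.
  apply: eq_fsbigr => y; rewrite inE => -[x _ hy].
  have y0 : 0 <= y by rewrite -hy.
  rewrite ge0_integralZl//; last 2 first.
    by apply/measurable_EFinP/measurable_funM.
    by move=> t _; rewrite lee_fin mulr_ge0.
  rewrite -nuE//; under [RHS]eq_integral do rewrite EFinM.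
  by rewrite ge0_integralZl// ?integral_indic ?setIT//; exact/measurable_EFinP.
have lim_nu : (\int[nu]_x (h n x)%:E)%E @[n --> \oo] --> (\int[nu]_x (f x)%:E)%E.
  have -> : (\int[nu]_x (f x)%:E = \int[nu]_x limn (fun n => (h n x)%:E))%E.
    by apply: eq_integral => t _; apply/esym/cvg_lim => //; exact: hcvg.
  apply: cvg_monotone_convergence => //.
  - by move=> n; exact/measurable_EFinP.
  - by move=> n t _; rewrite lee_fin.
  - by move=> t _ m n mn; rewrite lee_fin; exact: hnd.
have lim_mu : (\int[mu]_t (h n (X t) * G t)%:E)%E @[n --> \oo] -->
    (\int[mu]_t (f (X t) * G t)%:E)%E.
  have -> : (\int[mu]_t (f (X t) * G t)%:E =
      \int[mu]_t limn (fun n => (h n (X t) * G t)%:E))%E.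
    apply: eq_integral => t _; apply/esym/cvg_lim => //.
    have := hcvg (X t) => /fine_cvgP[_ hc].
    by apply: cvg_EFin; [exact: nearW|apply: cvgMl].
  apply: cvg_monotone_convergence => //.
  - by move=> n; apply/measurable_EFinP/measurable_funM => //; exact: mh.
  - by move=> n t _; rewrite lee_fin mulr_ge0.
  - by move=> t _ m n mn; rewrite lee_fin ler_wpM2r//; exact: hnd.
move/cvg_lim : lim_nu => <-//; move/cvg_lim : lim_mu => <-//.
by under eq_fun do rewrite simple.
Qed.

End Density.

(** * Expectation of a product of independent variables *)

Section ProductExpectation.
Context d (T : measurableType d) (R : realType) (P : probability T R).

(** With [c] the mean of [G], the last hypothesis says that the image under [X] of [P] weighted by
    [G] is [c] times the law of [X]; the two sides are the integral of [f] against this measure,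
    computed in two ways. *)
Lemma ge0_integralM_indep (d' : measure_display) (E : measurableType d') (X : T -> E)
    (G : T -> R) (f : E -> R) :
  measurable_fun setT X -> measurable_fun setT G -> (forall t, 0 <= G t) ->
  measurable_fun setT f -> (forall x, 0 <= f x) ->
  (\int[P]_t (G t)%:E < +oo)%E ->
  (forall B, measurable B ->
    \int[P]_t (\1_B (X t) * G t)%:E = P (X @^-1` B) * \int[P]_t (G t)%:E)%E ->
  (\int[P]_t (f (X t) * G t)%:E =
   (\int[P]_t (f (X t))%:E) * \int[P]_t (G t)%:E)%E.
Proof.
move=> mX mG G0 mf f0 Gfin indep.
have IG0 : (0 <= \int[P]_t (G t)%:E)%E.
  by apply: integral_ge0 => t _; rewrite lee_fin.
pose c := fine (\int[P]_t (G t)%:E).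
have cE : (\int[P]_t (G t)%:E = c%:E)%E by rewrite fineK// ge0_fin_numE.
have c0 : 0 <= c by rewrite fine_ge0.
pose mX' : {mfun T >-> E} := HB.pack X (isMeasurableFun.Build _ _ _ _ X mX).
rewrite -(@ge0_integral_density _ _ _ P _ _
    (mscale (NngNum c0) (pushforward P mX')) X G f)//.
  rewrite ge0_integral_mscale//=; last 2 first.
    exact/measurable_EFinP.
    by move=> x _; rewrite lee_fin.
  rewrite ge0_integral_pushforward//=; last 2 first.
    exact/measurable_EFinP.
    by move=> x _; rewrite lee_fin.
  by rewrite cE muleC preimage_setT.
by move=> B mB; rewrite indep// cE /mscale/= muleC.
Qed.

(** Independence is given for events only, so the factors are turned from indicators into functions
    one index at a time. *)
Lemma integral_prod_indep (d' : measure_display) (E : measurableType d') (I : finType)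
    (X : I -> T -> E) (f : I -> E -> R) :
  mutually_independent P X ->
  (forall i, measurable_fun setT (f i)) -> (forall i x, 0 <= f i x) ->
  (forall i, \int[P]_t (f i (X i t))%:E < +oo)%E ->
  (\int[P]_t (\prod_i f i (X i t))%:E = \prod_i \int[P]_t (f i (X i t))%:E)%E.
Proof.
move=> [mX indepX] mf f0 ffin.
have mfX i : measurable_fun setT (fun t => f i (X i t)) by exact: measurableT_comp.
(* The induction carries a mixed product: indices in [s] already bear functions, those in [J] still
   bear indicators. *)
suff H s : uniq s -> forall (J : {set I}) (B : I -> set E),
    (forall i, i \in s -> i \notin J) -> (forall i, measurable (B i)) ->
    (\int[P]_t ((\prod_(i <- s) f i (X i t)) * \prod_(i in J) \1_(B i) (X i t))%:E =
     (\prod_(i <- s) \int[P]_t (f i (X i t))%:E) *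
     \prod_(i in J) P (X i @^-1` B i))%E.
  have := H (index_enum I) (index_enum_uniq I) finset.set0 (fun=> setT).
  rewrite big_set0 mule1 => <-//; last by move=> i _; rewrite inE.
  by apply: eq_integral => t _; rewrite big_set0 mulr1.
elim: s => [_ J B _ mB|i s IH /= /andP[si us] J B sJ mB].
  rewrite big_nil mul1e -indepX//.
  transitivity (\int[P]_t (\1_(\bigcap_(i in [set` J]) (X i @^-1` B i)) t)%:E)%E.
    apply: eq_integral => t _; rewrite big_nil mul1r; congr _%:E.
    rewrite [RHS]indicE.
    have [h|h] := pselect ((\bigcap_(i in [set` J]) (X i @^-1` B i)) t).
      rewrite mem_set// big1// => i iJ; rewrite indicE mem_set//; exact: (h i).
    rewrite memNset//.
    have /existsNP[i /not_implyP[iJ nB]] := h.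
    by rewrite (bigD1 i)//= indicE memNset// mul0r.
  rewrite integral_indic ?setIT//.
  apply: fin_bigcap_measurable => //.
  by move=> i _; rewrite -[X in measurable X]setTI; exact: mX.
pose G t := (\prod_(i <- s) f i (X i t)) * \prod_(i in J) \1_(B i) (X i t).
have sJ' j : j \in s -> j \notin J by move=> js; rewrite sJ// in_cons js orbT.
have iJ : i \notin J by rewrite sJ// mem_head.
have GE : (\int[P]_t (G t)%:E = (\prod_(i <- s) \int[P]_t (f i (X i t))%:E) *
     \prod_(i in J) P (X i @^-1` B i))%E by exact: IH.
transitivity (\int[P]_t (f i (X i t) * G t)%:E)%E.
  by apply: eq_integral => t _; rewrite big_cons mulrA.
rewrite ge0_integralM_indep//.
- by rewrite GE big_cons muleA.
- apply: measurable_funM.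
    by apply: measurable_prod => j _.
  under eq_fun do rewrite -big_filter; apply: measurable_prod => j _.
  by apply: measurableT_comp.
- move=> t; rewrite mulr_ge0// prodr_ge0//.
- have fn i' : (\int[P]_t (f i' (X i' t))%:E \is a fin_num)%E.
    by rewrite ge0_fin_numE//; apply: integral_ge0 => t _; rewrite lee_fin.
  rewrite GE ltey_eq fin_numM//; first exact: prode_fin_num.
  by apply: prode_fin_num => j _; rewrite fin_num_measure// -[X in measurable X]setTI; exact: mX.
- move=> B' mB'; rewrite GE.
  (* Adding [i] to [J] with the set [B'] turns the induction hypothesis into independence of [X i]
     and [G]. *)
  pose B2 j := if j == i then B' else B j.
  have mB2 j : measurable (B2 j) by rewrite /B2; case: ifP.
  have B2i : B2 i = B' by rewrite /B2 eqxx.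
  have B2J j : j \in J -> B2 j = B j.
    by move=> jJ; rewrite /B2; case: eqP => // ji; move: iJ; rewrite -ji jJ.
  have siJ j : j \in s -> j \notin (i |: J)%SET.
    move=> js; rewrite !inE negb_or sJ'// andbT.
    by apply: contraNneq si => <-.
  have Eind t : \prod_(j in (i |: J)%SET) \1_(B2 j) (X j t) =
      \1_B' (X i t) * \prod_(j in J) \1_(B j) (X j t) :> R.
    by rewrite big_setU1//= B2i; congr *%R; apply: eq_bigr => j jJ; rewrite B2J.
  have EP : (\prod_(j in (i |: J)%SET) P (X j @^-1` B2 j) =
      P (X i @^-1` B') * \prod_(j in J) P (X j @^-1` B j))%E.
    by rewrite big_setU1//= B2i; congr *%E; apply: eq_bigr => j jJ; rewrite B2J.
  have := IH us _ _ siJ mB2.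
  rewrite EP muleCA => <-; apply: eq_integral => t _.
  by rewrite /G Eind mulrCA.
Qed.

End ProductExpectation.

(** * Complex vectors as real vectors with a rotation *)

Section RealCoordinates.
Context (R : realType).

Definition dotp (I : finType) (u v : I -> R) : R := \sum_i u i * v i.

Definition rl (d : nat) (x : 'cV[R[i]]_d) (k : 'I_d * bool) : R :=
  if k.2 then complex.Im (x k.1 0) else complex.Re (x k.1 0).

(* multiplication by the imaginary unit *)
Definition rlJ (d : nat) (u : 'I_d * bool -> R) (k : 'I_d * bool) : R :=
  if k.2 then u (k.1, false) else - u (k.1, true).

Section Dotp.
Variable I : finType.
Implicit Types u v w : I -> R.

Lemma dotpC u v : dotp u v = dotp v u.
Proof. by apply: eq_bigr => i _; rewrite mulrC. Qed.

Lemma dotpDl u v w : dotp (u \+ v) w = dotp u w + dotp v w.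
Proof. by rewrite -big_split; apply: eq_bigr => i _; rewrite mulrDl. Qed.

Lemma dotpBl u v w : dotp (u \- v) w = dotp u w - dotp v w.
Proof. by rewrite -sumrB; apply: eq_bigr => i _; rewrite mulrBl. Qed.

Lemma dotpZl k u w : dotp (k \*o u) w = k * dotp u w.
Proof. by rewrite /dotp mulr_sumr; apply: eq_bigr => i _; rewrite mulrA. Qed.

Lemma dotpDr u v w : dotp w (u \+ v) = dotp w u + dotp w v.
Proof. by rewrite !(dotpC w) dotpDl. Qed.

Lemma dotpBr u v w : dotp w (u \- v) = dotp w u - dotp w v.
Proof. by rewrite !(dotpC w) dotpBl. Qed.

Lemma dotpZr k u w : dotp w (k \*o u) = k * dotp w u.
Proof. by rewrite !(dotpC w) dotpZl. Qed.

Definition dotpE := (dotpBl, dotpDl, dotpZl, dotpBr, dotpDr, dotpZr).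

Lemma dotp_ge0 u : 0 <= dotp u u.
Proof. by apply: sumr_ge0 => i _; rewrite -expr2 sqr_ge0. Qed.

Lemma dotp_CS u v : dotp u v ^+ 2 <= dotp u u * dotp v v.
Proof.
have h := dotp_ge0 (dotp v v \*o u \- dotp u v \*o v).
move: h; rewrite !dotpE (dotpC v u).
have [v0 _|v0 h] := eqVneq (dotp v v) 0.
  have vz i : v i = 0.
    move/eqP : v0; rewrite psumr_eq0; last by move=> j _; rewrite -expr2 sqr_ge0.
    by move=> /allP/(_ i (mem_index_enum _)); rewrite /= -expr2 sqrf_eq0 => /eqP.
  have -> : dotp u v = 0 by rewrite /dotp big1// => i _; rewrite vz mulr0.
  by rewrite expr0n/= v0 mulr0.
have v1 : 0 < dotp v v by rewrite lt_neqAle eq_sym v0 dotp_ge0.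
rewrite -(ler_pM2l v1); move: h; lra.
Qed.

End Dotp.

Lemma sum_coord (I : finType) (F : I * bool -> R) :
  \sum_k F k = (\sum_i F (i, false)) + \sum_i F (i, true).
Proof.
rewrite -big_split/=; transitivity (\sum_i \sum_b F (i, b)).
  by rewrite pair_bigA; apply: eq_bigr => -[].
by apply: eq_bigr => i _; rewrite big_bool addrC.
Qed.

Section Rotation.
Variable d : nat.
Implicit Types u v : 'I_d * bool -> R.

Lemma dotpJJ u v : dotp (rlJ u) (rlJ v) = dotp u v.
Proof.
rewrite /dotp !sum_coord/= /rlJ/= addrC; congr (_ + _).
by apply: eq_bigr => i _; rewrite mulrNN.
Qed.

Lemma dotpJl u v : dotp (rlJ u) v = - dotp u (rlJ v).
Proof.
rewrite /dotp !sum_coord/= /rlJ/= opprD addrC -!sumrN; congr (_ + _).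
  by apply: eq_bigr => i _; rewrite mulrN opprK.
by apply: eq_bigr => i _; rewrite mulNr.
Qed.

Lemma dotpJ u : dotp (rlJ u) u = 0.
Proof. by have := dotpJl u u; rewrite (dotpC u) => h; lra. Qed.

Lemma rlJD u v : rlJ (u \+ v) = rlJ u \+ rlJ v.
Proof. by apply/funext => -[i []]; rewrite /rlJ//= opprD. Qed.

Lemma rlJB u v : rlJ (u \- v) = rlJ u \- rlJ v.
Proof. by apply/funext => -[i []]; rewrite /rlJ//= opprB opprK addrC. Qed.

Lemma rlJZ k u : rlJ (k \*o u) = k \*o rlJ u.
Proof. by apply/funext => -[i []]; rewrite /rlJ//= mulrN. Qed.

Lemma rlJK u : rlJ (rlJ u) = -1 \*o u.
Proof. by apply/funext => -[i []]; rewrite /rlJ//= mulN1r. Qed.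

Definition rlJE := (rlJD, rlJB, rlJZ, rlJK).

End Rotation.

End RealCoordinates.

(** * Moment generating functions of Gaussian vectors *)

Section GaussianMgf.
Context d (T : measurableType d) (R : realType) (P : probability T R).

Lemma ge0_integral_law_normal (X : T -> R) (s : R) (f : R -> R) :
  measurable_fun setT X ->
  (forall B, measurable B -> P (X @^-1` B) = normal_prob 0 s B) ->
  measurable_fun setT f -> (forall x, 0 <= f x) ->
  (\int[P]_t (f (X t))%:E =
   \int[lebesgue_measure]_x (f x * normal_pdf 0 s x)%:E)%E.
Proof.
move=> mX lawX mf f0.
transitivity (\int[normal_prob 0 s]_x (f x)%:E)%E.
  rewrite (@ge0_integral_density _ _ _ P _ _ (normal_prob 0 s) X (fun=> 1) f)//.
    by apply: eq_integral => t _; rewrite mulr1.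
  move=> B mB; transitivity (P (X @^-1` B)); first by rewrite lawX.
  under eq_integral do rewrite mulr1.
  rewrite (_ : (fun t => _) = fun t => (\1_(X @^-1` B) t)%:E)//.
  by rewrite integral_indic ?setIT//; rewrite -[X in measurable X]setTI; exact: mX.
apply: (@ge0_integral_density _ _ _ lebesgue_measure _ _ _ id) => //.
- exact: measurable_normal_pdf.
- by move=> x; exact: normal_pdf_ge0.
- move=> B mB; rewrite /= /normal_prob integral_mkcond; apply: eq_integral => x _.
  rewrite /patch indicE; case: ifP => _; first by rewrite mul1r.
  by rewrite mul0r.
Qed.

(** Completing the square: the tilted density is a constant times the normal density of mean
    [th * s ^+ 2]. *)
Lemma integral_expR_normal_pdf (s th : R) : s != 0 ->
  (\int[lebesgue_measure]_x (expR (th * x) * normal_pdf 0 s x)%:E =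
   (expR (th ^+ 2 * s ^+ 2 / 2))%:E)%E.
Proof.
move=> s0; transitivity (\int[lebesgue_measure]_x
   ((expR (th ^+ 2 * s ^+ 2 / 2))%:E * (normal_pdf (th * s ^+ 2) s x)%:E))%E.
  apply: eq_integral => x _; rewrite -EFinM !normal_pdfE//; congr _%:E.
  rewrite /normal_fun mulrCA [RHS]mulrCA -!expRD; congr (_ * expR _).
  by field.
rewrite ge0_integralZl//; last 2 first.
  by apply/measurable_EFinP; exact: measurable_normal_pdf.
  by move=> x _; rewrite lee_fin normal_pdf_ge0.
by rewrite integral_normal_pdf mule1.
Qed.

Lemma normal_mgf (X : T -> R) (s th : R) : s != 0 ->
  measurable_fun setT X ->
  (forall B, measurable B -> P (X @^-1` B) = normal_prob 0 s B) ->
  (\int[P]_t (expR (th * X t))%:E = (expR (th ^+ 2 * s ^+ 2 / 2))%:E)%E.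
Proof.
move=> s0 mX lawX.
rewrite (@ge0_integral_law_normal X s (fun x => expR (th * x)))//; last first.
  by apply: measurableT_comp => //; exact: measurable_funM.
exact: integral_expR_normal_pdf.
Qed.

Lemma isotropic_gaussian_mgf n (s : R) (g : T -> n.-tuple R) (v : 'I_n -> R) :
  s != 0 -> isotropic_gaussian P s g ->
  (\int[P]_t (expR (\sum_i v i * tnth (g t) i))%:E =
   (expR (s ^+ 2 / 2 * \sum_i v i ^+ 2))%:E)%E.
Proof.
move=> s0 [indep law].
have mg i : measurable_fun setT (fun t => tnth (g t) i) by exact: indep.1.
have E i : (\int[P]_t (expR (v i * tnth (g t) i))%:E =
    (expR (v i ^+ 2 * s ^+ 2 / 2))%:E)%E.
  by apply: normal_mgf => // B mB; exact: law.
transitivity (\int[P]_t (\prod_i expR (v i * tnth (g t) i))%:E)%E.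
  by apply: eq_integral => t _; rewrite expR_sum.
rewrite (@integral_prod_indep _ _ _ P _ _ _ (fun i t => tnth (g t) i)
  (fun i x => expR (v i * x)))//; last 2 first.
- by move=> i; apply: measurableT_comp => //; exact: measurable_funM.
- by move=> i; rewrite E ltry.
under eq_bigr do rewrite E.
rewrite prodEFin -expR_sum; congr (expR _)%:E.
by rewrite mulr_sumr; apply: eq_bigr => i _; field.
Qed.

Lemma complex_gaussian_mgf n (a : T -> 'cV[R[i]]_n) (v : 'I_n * bool -> R) :
  complex_gaussian P a ->
  (\int[P]_t (expR (dotp v (rl (a t))))%:E = (expR (dotp v v / 4))%:E)%E.
Proof.
move=> [indep gRe gIm].
have s0 : Num.sqrt 2^-1 != 0 :> R by rewrite gt_eqF// sqrtr_gt0 invr_gt0.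
have s2 : Num.sqrt 2^-1 ^+ 2 = 2^-1 :> R by rewrite sqr_sqrtr ?invr_ge0.
have ERe := isotropic_gaussian_mgf (fun i => v (i, false)) s0 gRe.
have EIm := isotropic_gaussian_mgf (fun i => v (i, true)) s0 gIm.
(* The negation reconciles two conventions: [true] marks the real parts in [complex_gaussian] and
   the imaginary parts in [rl]. *)
pose f (b : bool) (x : n.-tuple R) := expR (\sum_i v (i, ~~ b) * tnth x i).
transitivity (\int[P]_t
    (\prod_b f b (if b then re_vec (a t) else im_vec (a t)))%:E)%E.
  apply: eq_integral => t _; rewrite big_bool /f/= -expRD /dotp sum_coord.
  have eRe i : tnth (re_vec (a t)) i = rl (a t) (i, false) by rewrite tnth_mktuple.
  have eIm i : tnth (im_vec (a t)) i = rl (a t) (i, true) by rewrite tnth_mktuple.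
  have sRe : \sum_i v (i, false) * tnth (re_vec (a t)) i =
      \sum_i v (i, false) * rl (a t) (i, false) by apply: eq_bigr => i _; rewrite eRe.
  have sIm : \sum_i v (i, true) * tnth (im_vec (a t)) i =
      \sum_i v (i, true) * rl (a t) (i, true) by apply: eq_bigr => i _; rewrite eIm.
  by rewrite sRe sIm.
rewrite integral_prod_indep//.
- rewrite big_bool /f/= ERe EIm -EFinM -expRD /dotp sum_coord s2; congr (expR _)%:E.
  by rewrite -mulrDr addrC mulrC -invfM -natrM mulrC.
- move=> b; apply: measurableT_comp => //.
  apply: measurable_sum => i; apply: measurable_funM => //; exact: measurable_tnth.
- by move=> b x; exact: expR_ge0.
- by move=> [] /=; rewrite ?ERe ?EIm ltry.
Qed.

End GaussianMgf.

(** * Calculus of finite means *)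

Section HasMean.
Context d (T : measurableType d) (R : realType) (P : probability T R).

Implicit Types (f g : T -> R) (c e k : R).

(** Integrability is bundled with the value so that combinations with negative coefficients, as in
    polarization, can be integrated term by term. *)
Definition has_mean (f : T -> R) (c : R) : Prop :=
  P.-integrable setT (fun t => (f t)%:E) /\ (\int[P]_t (f t)%:E = c%:E)%E.

Lemma has_meanD f g c e : has_mean f c -> has_mean g e ->
  has_mean (fun t => f t + g t) (c + e).
Proof.
move=> [fi fc] [gi gc]; split.
  by under eq_fun do rewrite EFinD; exact: integrableD.
by under eq_integral do rewrite EFinD; rewrite integralD// fc gc.
Qed.

Lemma has_meanZ f c k : has_mean f c -> has_mean (fun t => k * f t) (k * c).
Proof.
move=> [fi fc]; split.
  by under eq_fun do rewrite EFinM; exact: integrableZl.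
by under eq_integral do rewrite EFinM; rewrite integralZl// fc.
Qed.

Lemma has_mean_cst k : has_mean (fun=> k) k.
Proof.
split; first exact: finite_measure_integrable_cst.
by rewrite integral_cst//= probability_setT mule1.
Qed.

Lemma has_mean_ge0 f c : measurable_fun setT f -> (forall t, 0 <= f t) ->
  (\int[P]_t (f t)%:E = c%:E)%E -> has_mean f c.
Proof.
move=> mf f0 fc; split => //; apply/integrableP; split; first exact/measurable_EFinP.
under eq_integral do rewrite gee0_abs ?lee_fin//.
by rewrite fc ltry.
Qed.

Lemma has_mean_meas f c : has_mean f c -> measurable_fun setT f.
Proof. by move=> [/integrableP[/measurable_EFinP]]. Qed.

Lemma le_integral_mean f g c : measurable_fun setT f -> (forall t, 0 <= f t) ->
  (forall t, f t <= g t) -> has_mean g c -> (\int[P]_t (f t)%:E <= c%:E)%E.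
Proof.
move=> mf f0 fg gm; rewrite -gm.2; apply: ge0_le_integral => //.
- by move=> t _; rewrite lee_fin.
- exact/measurable_EFinP.
- by apply/measurable_EFinP; exact: has_mean_meas gm.
- by move=> t _; rewrite lee_fin.
Qed.

Lemma le_mean f g c : measurable_fun setT f -> (forall t, 0 <= f t) ->
  (forall t, f t <= g t) -> has_mean g c -> exists2 e, has_mean f e & e <= c.
Proof.
move=> mf f0 fg gm.
have If := le_integral_mean mf f0 fg gm.
have I0 : (0 <= \int[P]_t (f t)%:E)%E by apply: integral_ge0 => t _; rewrite lee_fin.
have Ifin : (\int[P]_t (f t)%:E)%E \is a fin_num.
  by rewrite ge0_fin_numE// (le_lt_trans If)// ltry.
exists (fine (\int[P]_t (f t)%:E)); first by apply: has_mean_ge0 => //; rewrite fineK.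
by rewrite -lee_fin fineK.
Qed.

End HasMean.

(** * Elementary inequalities for the exponential *)

Section ScalarBounds.
Context (R : realType).
Implicit Types x y t : R.

Lemma expR_sinh_ub y : 0 <= y -> expR y - expR (- y) <= 2 * y * expR y.
Proof.
move=> y0; have -> : expR (- y) = expR y * expR (- (2 * y)).
  by rewrite -expRD; congr expR; ring.
by have := expR_ge1Dx (- (2 * y)); have := expR_gt0 y; nra.
Qed.

Lemma expR_sinh_lb y : 2 * y * expR (- y) <= expR y - expR (- y).
Proof.
have -> : expR y = expR (- y) * expR (2 * y).
  by rewrite -expRD; congr expR; ring.
by have := expR_ge1Dx (2 * y); have := expR_gt0 (- y); nra.
Qed.

Lemma expR_abs_le x : expR `|x| <= expR x + expR (- x).
Proof.
have [x0|x0] := leP 0 x; first by rewrite ger0_norm// lerDl expR_ge0.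
by rewrite ltr0_norm// lerDr expR_ge0.
Qed.

Lemma exprn_le_expR x n : 0 <= x -> x ^+ n.+1 <= n.+1%:R ^+ n.+1 * expR x.
Proof.
move=> x0.
have -> : expR x = expR (x / n.+1%:R) ^+ n.+1.
  by rewrite -expRM_natl mulrC divfK// pnatr_eq0.
have n0 : 0 < n.+1%:R :> R by rewrite ltr0n.
rewrite -exprMn lerXn2r ?nnegrE ?mulr_ge0 ?expR_ge0 ?ler0n//.
rewrite -ler_pdivrMl// mulrC.
by apply: le_trans (expR_ge1Dx _); rewrite lerDr ler01.
Qed.

(** Follows from [exp (- y) <= 1 / (1 + y)]. There are no odd powers on the right: for [y] the
    absolute value of a form, the even powers are polynomials in the Gaussian coordinates, of
    computable mean. *)
Lemma expRN_le y : 0 <= y -> expR (- y) <= 1 - y ^+ 2 / 2 + y ^+ 4 / 2.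
Proof.
move=> y0; rewrite expRN.
have y1 : 0 < 1 + y by lra.
apply: (@le_trans _ _ (1 + y)^-1).
  by rewrite lef_pV2 ?posrE ?expR_gt0// expR_ge1Dx.
rewrite -[leLHS]mul1r ler_pdivrMr//.
have -> : (1 - y ^+ 2 / 2 + y ^+ 4 / 2) * (1 + y) =
    1 + y * (1 - y / 2 - y ^+ 2 / 2 + y ^+ 3 / 2 + y ^+ 4 / 2) by field.
rewrite lerDl mulr_ge0//.
have [yl|yg] := leP y 1.
  have y2 : y ^+ 2 <= y by rewrite expr2 ler_piMr.
  have : 0 <= y ^+ 3 by rewrite exprn_ge0.
  have : 0 <= y ^+ 4 by rewrite exprn_ge0.
  by lra.
have y3 : y <= y ^+ 3 by rewrite exprS ler_peMr// exprn_ege1// ltW.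
have y4 : y ^+ 2 <= y ^+ 4.
  by rewrite (_ : 4 = 2 + 2)%N// exprD ler_peMr ?sqr_ge0// exprn_ege1// ltW.
lra.
Qed.

End ScalarBounds.

(** * Fourth and eighth moments from the moment generating function *)

Section GaussianMoments.
Context d (T : measurableType d) (R : realType) (P : probability T R).
Variables (X : T -> R) (s : R).
Hypotheses (s0 : 0 <= s) (mX : measurable_fun setT X).
Hypothesis mgf : forall th, (\int[P]_t (expR (th * X t))%:E = (expR (th ^+ 2 * s))%:E)%E.

Let mexp th : measurable_fun setT (fun t => expR (th * X t)).
Proof. by apply: measurableT_comp => //; exact: measurable_funM. Qed.

Let mean_exp th : has_mean P (fun t => expR (th * X t)) (expR (th ^+ 2 * s)).
Proof. by apply: has_mean_ge0 => // t; exact: expR_ge0. Qed.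

Lemma mean_expabs th : has_mean P (fun t => expR (th * X t) + expR (- (th * X t)))
  (2 * expR (th ^+ 2 * s)).
Proof.
have := has_meanD (mean_exp th) (mean_exp (- th)).
rewrite sqrrN -mulr2n mulr_natl.
rewrite (_ : (fun t => _) = fun t => expR (th * X t) + expR (- (th * X t)))//.
by apply/funext => t; rewrite mulNr.
Qed.

(* [psi n x] is the fourth power of a central difference of [exp] that tends to
   [x], hence a linear combination of exponentials of known mean. *)
Let psi n x : R := ((expR (x / n.+1%:R) - expR (- (x / n.+1%:R))) * n.+1%:R / 2) ^+ 4.

(** Expanding the fourth power leaves exponentials of rates [4 / N], [2 / N] and their opposites,
    and a constant, with binomial coefficients [1], [-4], [6]. Both bounds tend to [12 * s ^+ 2]. *)
Let psi_mean n : exists2 c, has_mean P (fun t => psi n (X t)) c &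
  12 * s ^+ 2 <= c <= 12 * s ^+ 2 * expR (16 * s / n.+1%:R ^+ 2).
Proof.
set N := n.+1%:R : R; have N0 : 0 < N by rewrite ltr0n.
have h4 := has_meanZ ((N / 2) ^+ 4) (mean_expabs (4 / N)).
have h2 := has_meanZ ((N / 2) ^+ 4 * - 4) (mean_expabs (2 / N)).
have h0 := has_mean_cst P ((N / 2) ^+ 4 * 6).
have := has_meanD (has_meanD h4 h2) h0.
set A := expR (4 * s / N ^+ 2).
have -> : expR ((2 / N) ^+ 2 * s) = A.
  by congr expR; field; rewrite gt_eqF.
have A4 : expR (16 * s / N ^+ 2) = A ^+ 4.
  by rewrite -expRM_natl; congr expR; field; rewrite gt_eqF.
have -> : expR ((4 / N) ^+ 2 * s) = A ^+ 4.
  by rewrite -A4; congr expR; field; rewrite gt_eqF.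
set c := (X in has_mean _ _ X) => hc.
exists c.
  move: hc; rewrite (_ : (fun t => _) = fun t => psi n (X t))//.
  apply/funext => t; rewrite /psi -/N.
  set E := expR (X t / N).
  have E0 : E != 0 by rewrite gt_eqF// expR_gt0.
  have e4 : expR (4 / N * X t) = E ^+ 4.
    by rewrite -expRM_natl; congr expR; field; rewrite gt_eqF.
  have e2 : expR (2 / N * X t) = E ^+ 2.
    by rewrite -expRM_natl; congr expR; field; rewrite gt_eqF.
  by rewrite !expRN e4 e2 -/E; field.
(* [2 A^4 - 8 A + 6] has a double zero at [A = 1]. Together with [tau <= A - 1 <= tau * A] this pins
   it between [12 tau^2] and [12 tau^2 A^4]. *)
have cE : c = (N / 2) ^+ 4 * (2 * (A - 1) ^+ 2 * (A ^+ 2 + 2 * A + 3)).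
  by rewrite /c; ring.
rewrite A4 cE.
set tau := 4 * s / N ^+ 2.
have tau0 : 0 <= tau by rewrite /tau mulr_ge0// ?invr_ge0 ?exprn_ge0 ?mulr_ge0// ltW.
have s2 : s ^+ 2 = (N / 2) ^+ 4 * tau ^+ 2.
  by rewrite /tau; field; rewrite gt_eqF.
have A1 : 1 <= A by rewrite -expR0 ler_expR.
have Al : tau <= A - 1 by have := expR_ge1Dx tau; rewrite -/A; lra.
have Au : A - 1 <= tau * A.
  move: (expR_ge1Dx (- tau)); rewrite expRN -/A => h.
  have e0 : 0 < A by lra.
  by move: h; rewrite -(ler_pM2l e0) divff ?gt_eqF//; lra.
have K0 : 0 <= (N / 2) ^+ 4 by rewrite exprn_ge0// divr_ge0// ltW.
rewrite s2; apply/andP; split.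
  rewrite mulrCA ler_wpM2l//.
  have h1 : tau ^+ 2 <= (A - 1) ^+ 2 by rewrite lerXn2r// ?nnegrE//; lra.
  have h2' : 6 <= A ^+ 2 + 2 * A + 3 by nra.
  have := sqr_ge0 tau; nra.
rewrite (_ : 12 * ((N / 2) ^+ 4 * tau ^+ 2) * A ^+ 4 =
  (N / 2) ^+ 4 * (12 * (tau ^+ 2 * A ^+ 4))); last by ring.
rewrite ler_wpM2l//.
have h1 : (A - 1) ^+ 2 <= (tau * A) ^+ 2.
  by rewrite lerXn2r// ?nnegrE//; [lra | rewrite mulr_ge0//; lra].
have h2' : A ^+ 2 + 2 * A + 3 <= 6 * A ^+ 2 by nra.
have -> : 12 * (tau ^+ 2 * A ^+ 4) = 2 * (tau * A) ^+ 2 * (6 * A ^+ 2) by ring.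
by apply: ler_pM => //; [rewrite mulr_ge0// sqr_ge0|nra|rewrite ler_pM2l].
Qed.

Let psi_abs n x : psi n x = psi n `|x|.
Proof.
have [x0|x0] := leP 0 x; first by rewrite ger0_norm.
rewrite ltr0_norm// /psi mulNr opprK -[in RHS](opprB (expR (x / _))).
by rewrite !mulNr (exprNn _ 4) -signr_odd/= expr0 mul1r.
Qed.

(** The bounds [2 y exp (- y) <= exp y - exp (- y) <= 2 y exp y] at [y = |x| / (n + 1)]; they yield
    the pointwise limit as well as a dominating function. *)
Let psi_le n x : `|x| ^+ 4 * expR (- 4 * `|x| * harmonic n) <= psi n x <=
  `|x| ^+ 4 * expR (4 * `|x| * harmonic n).
Proof.
rewrite psi_abs; have : 0 <= `|x| by [].
move: `|x| => {x} x x0; rewrite /psi /harmonic.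
set N := n.+1%:R : R; have N0 : 0 < N by rewrite ltr0n.
have y0 : 0 <= x / N by rewrite divr_ge0// ltW.
have xE : x = x / N * N by rewrite divfK// gt_eqF.
have -> : x ^+ 4 * expR (- 4 * x / N) = (2 * (x / N) * expR (- (x / N)) * N / 2) ^+ 4.
  rewrite (_ : - 4 * x / N = 4%:R * (- (x / N))); last by ring.
  by rewrite expRM_natl; field; rewrite gt_eqF.
have -> : x ^+ 4 * expR (4 * x / N) = (2 * (x / N) * expR (x / N) * N / 2) ^+ 4.
  rewrite (_ : 4 * x / N = 4%:R * (x / N)); last by ring.
  by rewrite expRM_natl; field; rewrite gt_eqF.
have l := expR_sinh_lb (x / N); have u := expR_sinh_ub y0.
have l0 : 0 <= 2 * (x / N) * expR (- (x / N))
  by exact: mulr_ge0 (mulr_ge0 _ y0) (expR_ge0 _).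
have m0 : 0 <= expR (x / N) - expR (- (x / N)) by apply: le_trans l.
have u0 := le_trans m0 u.
have mono a b : 0 <= a -> a <= b -> (a * N / 2) ^+ 4 <= (b * N / 2) ^+ 4.
  move=> a0 ab; have a0' : 0 <= a * N / 2.
    by apply: mulr_ge0 => //; apply: mulr_ge0 => //; exact: ltW.
  have ab' : a * N / 2 <= b * N / 2 by rewrite ler_pM2r// ler_pM2r.
  by rewrite lerXn2r ?nnegrE// (le_trans a0').
by rewrite !mono.
Qed.

Let psi_ge0 n x : 0 <= psi n x.
Proof. by rewrite /psi (exprM _ 2 2) sqr_ge0. Qed.

Let psi_ub n x : psi n x <= expR (8 * x) + expR (- (8 * x)).
Proof.
apply: le_trans (expR_abs_le _).
have /andP[_ u] := psi_le n x; apply: (le_trans u).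
have x0 : 0 <= `|x| by [].
rewrite normrM (ger0_norm (_ : 0 <= 8))//; move: `|x| x0 => {u}y y0.
have -> : expR (8 * y) = expR y ^+ 4 * expR (4 * y * 1).
  by rewrite -expRM_natl -expRD; congr expR; ring.
rewrite ler_pM ?exprn_ge0 ?expR_ge0//.
  rewrite lerXn2r ?nnegrE ?expR_ge0//.
  by apply: le_trans (expR_ge1Dx y); rewrite lerDr.
rewrite ler_expR ler_wpM2l ?mulr_ge0// /harmonic invf_le1 ?ltr0n//.
by rewrite ler1n.
Qed.

Let psi_cvg x : psi n x @[n --> \oo] --> x ^+ 4.
Proof.
have xE : x ^+ 4 = `|x| ^+ 4 by rewrite -normrX ger0_norm// (exprM _ 2 2) sqr_ge0.
have expc k : `|x| ^+ 4 * expR (k * @harmonic R n) @[n --> \oo] --> x ^+ 4.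
  rewrite -[X in _ --> X]mulr1 xE; apply: cvgMr.
  rewrite -expR0 -(mulr0 k); apply: continuous_cvg; first exact: continuous_expR.
  by apply: cvgMr; exact: cvg_harmonic.
apply: (squeeze_cvgr _ (expc (- 4 * `|x|)) (expc (4 * `|x|))).
by apply: nearW => n; exact: psi_le.
Qed.

(** The hypothesis [mgf] is that of a centred Gaussian of variance [2 * s], whose fourth moment is
    [3 * (2 * s)^2]. It is the limit of the means of [psi n], dominated by an exponential. *)
Lemma gaussian_moment4 : has_mean P (fun t => X t ^+ 4) (12 * s ^+ 2).
Proof.
have mX4 : measurable_fun setT (fun t => X t ^+ 4) by exact: measurable_funX.
have mpsi n : measurable_fun setT (fun t => psi n (X t)).
  have [c [h _] _] := psi_mean n.
  by move/integrableP : h => [/measurable_EFinP].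
have [|||||] := @dominated_convergence _ T R P setT measurableT
  (fun n t => (psi n (X t))%:E) (fun t => (X t ^+ 4)%:E)
  (fun t => (expR (8 * X t) + expR (- (8 * X t)))%:E).
- by move=> n; exact/measurable_EFinP.
- exact/measurable_EFinP.
- by apply: aeW => t _; apply: cvg_EFin; [exact: nearW|exact: psi_cvg].
- exact: (mean_expabs 8).1.
- by apply: aeW => t n _; rewrite gee0_abs ?lee_fin.
move=> _ _ hlim; apply: has_mean_ge0 => //.
  by move=> t; rewrite (exprM _ 2 2) sqr_ge0.
move/cvg_lim : hlim => <-//; apply/cvg_lim => //.
have E n : (\int[P]_t (psi n (X t))%:E)%E \is a fin_num.
  by have [c [_ ->] _] := psi_mean n.
have sq n : 12 * s ^+ 2 <= fine (\int[P]_t (psi n (X t))%:E)%E <=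
    12 * s ^+ 2 * expR (16 * s * harmonic n * harmonic n).
  have [c [_ ->] ] := psi_mean n; rewrite /harmonic.
  by rewrite -!mulrA -invfM -expr2.
rewrite (_ : (fun n => _) = fun n => (fine (\int[P]_t (psi n (X t))%:E)%E)%:E); last first.
  by apply/funext => n; rewrite fineK.
apply: cvg_EFin; first exact: nearW.
apply: (@squeeze_cvgr _ _ _ _ (fun=> 12 * s ^+ 2)
    (fun n => 12 * s ^+ 2 * expR (16 * s * harmonic n * harmonic n))).
- by apply: nearW => n; exact: sq.
- exact: cvg_cst.
- rewrite -[X in _ --> X]mulr1; apply: cvgMr.
  rewrite -[X in _ --> X]expR0; apply: continuous_cvg; first exact: continuous_expR.
  rewrite -[X in _ --> X](mulr0 (16 * s * 0)).
  by apply: cvgM; [apply: cvgMr|]; exact: cvg_harmonic.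
Qed.

(** A crude bound suffices here: [x^8 <= 8^8 exp |x|], and [exp |x|] is at most the sum of [exp x]
    and [exp (- x)]. *)
Lemma gaussian_moment8 : exists2 c, has_mean P (fun t => X t ^+ 8) c &
  c <= 8 ^+ 8 * (2 * expR s).
Proof.
have h := has_meanZ (8 ^+ 8) (mean_expabs 1).
move: h; rewrite expr1n mul1r => h.
apply: le_mean h.
- exact: measurable_funX.
- by move=> t; rewrite (exprM _ 2 4) exprn_ge0// sqr_ge0.
- move=> t; rewrite mul1r (_ : X t ^+ 8 = `|X t| ^+ 8); last first.
    by rewrite -normrX ger0_norm// (exprM _ 2 4) exprn_ge0// sqr_ge0.
  apply: (le_trans (exprn_le_expR 7 _)) => //.
  by rewrite ler_wpM2l// expR_abs_le.
Qed.

End GaussianMoments.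

(** * Linear forms of a complex Gaussian vector *)

Section GaussianForms.
Context d (T : measurableType d) (R : realType) (P : probability T R).
Variable n : nat.
Local Notation K := ('I_n * bool)%type.

(* real coordinates of a complex Gaussian vector with covariance I_n *)
Definition cgauss (g : T -> K -> R) : Prop :=
  (forall k, measurable_fun setT (fun t => g t k)) /\
  forall v, (\int[P]_t (expR (dotp v (g t)))%:E = (expR (dotp v v / 4))%:E)%E.

Variable g : T -> K -> R.
Hypothesis gg : cgauss g.
Implicit Types u v p r : K -> R.

Lemma measurable_dotp v : measurable_fun setT (fun t => dotp v (g t)).
Proof.
by apply: measurable_sum => k; apply: measurable_funM => //; exact: gg.1.
Qed.

Lemma dotp_mgf v th :
  (\int[P]_t (expR (th * dotp v (g t)))%:E = (expR (th ^+ 2 * (dotp v v / 4)))%:E)%E.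
Proof.
have := gg.2 (th \*o v); under eq_integral do rewrite dotpZl.
by move=> ->; rewrite !dotpE; congr (expR _)%:E; ring.
Qed.

Let s_ge0 v : 0 <= dotp v v / 4.
Proof. by rewrite divr_ge0// dotp_ge0. Qed.

Lemma dotp_moment4 v : has_mean P (fun t => dotp v (g t) ^+ 4) (3 / 4 * dotp v v ^+ 2).
Proof.
have := gaussian_moment4 (s_ge0 v) (measurable_dotp v) (dotp_mgf v).
by rewrite (_ : 12 * _ = 3 / 4 * dotp v v ^+ 2)//; field.
Qed.

(** Polarization: the fourth powers of the eight vectors [a + b + c + e] with signs on [b], [c],
    [e], weighted by the product of the signs, sum to [8 * 4! = 192] times the product. The value is
    the Wick formula for the covariance [<u, v> / 2]. *)
Lemma wick4 a b c e :
  has_mean P (fun t => dotp a (g t) * dotp b (g t) * dotp c (g t) * dotp e (g t))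
    ((dotp a b * dotp c e + dotp a c * dotp b e + dotp a e * dotp b c) / 4).
Proof.
have m k v := has_meanZ (k / 192) (dotp_moment4 v).
have := has_meanD (has_meanD (has_meanD (m 1 (a \+ b \+ c \+ e)) (m (-1) (a \+ b \+ c \- e)))
    (has_meanD (m (-1) (a \+ b \- c \+ e)) (m 1 (a \+ b \- c \- e))))
  (has_meanD (has_meanD (m (-1) (a \- b \+ c \+ e)) (m 1 (a \- b \+ c \- e)))
    (has_meanD (m 1 (a \- b \- c \+ e)) (m (-1) (a \- b \- c \- e)))).
set f := (X in has_mean _ X _); set x := (X in has_mean _ _ X).
have -> : f = fun t => dotp a (g t) * dotp b (g t) * dotp c (g t) * dotp e (g t).
  by apply/funext => t; rewrite /f !dotpE; field.
have -> // : x = (dotp a b * dotp c e + dotp a c * dotp b e + dotp a e * dotp b c) / 4.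
rewrite /x !dotpE (dotpC b a) (dotpC c a) (dotpC e a) (dotpC c b) (dotpC e b) (dotpC e c).
by field.
Qed.

(** The square is linearized: [exp (x^2 / 2)] is the mean of [exp (x z)] for [z] standard normal.
    After exchanging the integrals, [exp (z^2 / 4)] times the standard density is [sqrt 2] times the
    normal density of variance 2. *)
Lemma integral_expR_sqr v : dotp v v = 1 ->
  (\int[P]_t (expR (dotp v (g t) ^+ 2 / 2))%:E = (Num.sqrt 2)%:E)%E.
Proof.
move=> v1.
have s2 : Num.sqrt 2 != 0 :> R by rewrite gt_eqF// sqrtr_gt0.
pose F (z : T * R) := (expR (dotp v (g z.1) * z.2) * normal_pdf 0 1 z.2)%:E.
have mF : measurable_fun setT F.
  apply/measurable_EFinP; apply: measurable_funM.
    apply: measurableT_comp => //; apply: measurable_funM => //.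
    exact: (measurableT_comp (measurable_dotp v)).
  exact: (measurableT_comp (measurable_normal_pdf 0 1)).
have F0 z : (0 <= F z)%E by rewrite lee_fin mulr_ge0// ?expR_ge0 ?normal_pdf_ge0.
transitivity (\int[P]_t \int[lebesgue_measure]_x F (t, x))%E.
  apply: eq_integral => t _; rewrite /F/=.
  by rewrite (integral_expR_normal_pdf (dotp v (g t)) (oner_neq0 R)) expr1n mulr1.
rewrite fubini_tonelli//.
transitivity (\int[@lebesgue_measure R]_x
    ((Num.sqrt 2)%:E * (normal_pdf 0 (Num.sqrt 2) x)%:E))%E.
  apply: eq_integral => x _; rewrite /F/=.
  under eq_integral do rewrite EFinM muleC.
  rewrite ge0_integralZl//; last 2 first.
    apply/measurable_EFinP; apply: measurableT_comp => //.
    by apply: measurable_funM => //; exact: measurable_dotp.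
    by rewrite lee_fin normal_pdf_ge0.
  under eq_integral do rewrite mulrC.
  rewrite dotp_mgf v1 -!EFinM !normal_pdfE ?oner_eq0//; congr _%:E.
  rewrite /normal_fun /normal_peak !subr0 -mulrA -expRD mulrA expr1n.
  rewrite sqr_sqrtr// mulrA; congr (_ * expR _); last by field.
  rewrite mul1r -mulrnAr (sqrtrM (pi *+ 2)) ?ler0n//.
  by rewrite invfM mulrA divff// mul1r.
rewrite ge0_integralZl//; last 2 first.
  by apply/measurable_EFinP; exact: measurable_normal_pdf.
  by move=> x _; rewrite lee_fin normal_pdf_ge0.
by rewrite integral_normal_pdf mule1.
Qed.

End GaussianForms.

(** * Moments of the quadratic measurement forms *)

Section Forms.
Context (R : realType) (n : nat).
Local Notation K := ('I_n * bool)%type.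

(* [re_form p r a] is the real part of conj(a^* p) (a^* r). *)
Definition re_form (p r a : K -> R) : R :=
  dotp p a * dotp r a + dotp (rlJ p) a * dotp (rlJ r) a.

Lemma pow4D_le (x y : R) : (x + y) ^+ 4 <= 8 * (x ^+ 4 + y ^+ 4).
Proof.
have h2 : (x + y) ^+ 2 <= 2 * (x ^+ 2 + y ^+ 2) by have := sqr_ge0 (x - y); lra.
have h4 : ((x + y) ^+ 2) ^+ 2 <= (2 * (x ^+ 2 + y ^+ 2)) ^+ 2.
  by rewrite lerXn2r// nnegrE ?sqr_ge0// mulr_ge0// addr_ge0 ?sqr_ge0.
move: h4; rewrite -exprM exprMn => h4; apply: (le_trans h4).
by have := sqr_ge0 (x ^+ 2 - y ^+ 2); lra.
Qed.

Lemma pow4M_le (x y : R) : (x * y) ^+ 4 <= (x ^+ 8 + y ^+ 8) / 2.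
Proof.
rewrite exprMn; have := sqr_ge0 (x ^+ 4 - y ^+ 4).
by rewrite (exprM x 4 2) (exprM y 4 2); lra.
Qed.

End Forms.

Section FormMoments.
Context d (T : measurableType d) (R : realType) (P : probability T R).
Variable n : nat.
Local Notation K := ('I_n * bool)%type.
Variable g : T -> K -> R.
Hypothesis gg : cgauss P g.
Implicit Types u v p r : K -> R.

(** [re_form v v] is a sum of two squares; by the inequality of arithmetic and geometric means its
    exponential is at most the average of two exponentials of a single square, each of mean
    [sqrt 2]. *)
Lemma integral_expR_form v : dotp v v = 1 ->
  (\int[P]_t (expR (re_form v v (g t) / 4))%:E <= 2%:E)%E.
Proof.
move=> v1; have Jv1 : dotp (rlJ v) (rlJ v) = 1 by rewrite dotpJJ.
have mexp u : measurable_fun setT (fun t => expR (dotp u (g t) ^+ 2 / 2)).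
  apply: measurableT_comp => //; apply: measurable_funM => //.
  by apply: measurable_funX; exact: (measurable_dotp gg).
have m u : dotp u u = 1 ->
    has_mean P (fun t => expR (dotp u (g t) ^+ 2 / 2)) (Num.sqrt 2).
  by move=> u1; apply: has_mean_ge0 => //; exact: integral_expR_sqr.
have h := has_meanD (has_meanZ (2^-1) (m v v1)) (has_meanZ (2^-1) (m _ Jv1)).
have mform : measurable_fun setT (fun t => expR (re_form v v (g t) / 4)).
  apply: measurableT_comp => //; apply: measurable_funM => //.
  by apply: measurable_funD; apply: measurable_funM; exact: (measurable_dotp gg).
apply: (@le_trans _ _ (2^-1 * Num.sqrt 2 + 2^-1 * Num.sqrt 2)%:E).
  apply: (le_integral_mean mform _ _ h) => t; first exact: expR_ge0.
  rewrite /re_form -!expr2.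
  set x := dotp v (g t) ^+ 2; set y := dotp (rlJ v) (g t) ^+ 2.
  have -> : expR (x / 2) = expR (x / 4) ^+ 2.
    by rewrite -expRM_natl; congr expR; field.
  have -> : expR (y / 2) = expR (y / 4) ^+ 2.
    by rewrite -expRM_natl; congr expR; field.
  by rewrite mulrDl expRD; have := sqr_ge0 (expR (x / 4) - expR (y / 4)); nra.
have : Num.sqrt 2 <= 2 :> R by have := sqr_sqrtr (ler0n R 2); have := sqrtr_ge0 (2 : R); nra.
by rewrite lee_fin; lra.
Qed.

(** The Wick formula for the two squares and the cross term. The negative term is the phase
    degeneracy: for [r = rlJ p] the whole expression is zero. *)
Lemma mean_form2 p r : has_mean P (fun t => re_form p r (g t) ^+ 2)
  (dotp p p * dotp r r / 2 + 3 / 2 * dotp p r ^+ 2 - dotp (rlJ p) r ^+ 2 / 2).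
Proof.
have := has_meanD (has_meanD (wick4 gg p r p r)
    (wick4 gg (rlJ p) (rlJ r) (rlJ p) (rlJ r)))
  (has_meanZ 2 (wick4 gg p r (rlJ p) (rlJ r))).
set f := (X in has_mean _ X _); set x := (X in has_mean _ _ X).
have -> : f = fun t => re_form p r (g t) ^+ 2.
  by apply/funext => t; rewrite /f /re_form; ring.
have -> // : x = dotp p p * dotp r r / 2 + 3 / 2 * dotp p r ^+ 2
    - dotp (rlJ p) r ^+ 2 / 2.
rewrite /x !dotpJJ (dotpC r p).
rewrite (dotpC r (rlJ p)) (dotpC p (rlJ p)) (dotpC r (rlJ r)) !dotpJ.
rewrite (_ : dotp p (rlJ r) = - dotp (rlJ p) r); last by rewrite dotpJl opprK.
by field.
Qed.

(** [8^8 * (2 * expR 4)] bounds the eighth moment of a linear form with [dotp v v <= 16]; the factor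
    16 collects four such moments and the constant 4 of the convexity inequalities. *)
Definition moment_bound : R := 16 * (8 ^+ 8 * (2 * expR 4)).

Lemma mean_form4 p r : dotp p p <= 16 -> dotp r r <= 16 ->
  exists2 c, has_mean P (fun t => re_form p r (g t) ^+ 4) c & c <= moment_bound.
Proof.
move=> p16 r16.
have m v : dotp v v <= 16 ->
    exists2 c, has_mean P (fun t => dotp v (g t) ^+ 8) c & c <= 8 ^+ 8 * (2 * expR 4).
  move=> v16.
  have [c hc cle] := gaussian_moment8 (measurable_dotp gg v) (dotp_mgf gg v).
  exists c => //; apply: (le_trans cle).
  by rewrite ler_wpM2l ?exprn_ge0// ler_wpM2l// ler_expR; lra.
have [c1 h1 l1] := m p p16; have [c2 h2 l2] := m r r16.
have [c3 h3 l3] : exists2 c, has_mean P (fun t => dotp (rlJ p) (g t) ^+ 8) c &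
  c <= 8 ^+ 8 * (2 * expR 4) by apply: m; rewrite dotpJJ.
have [c4 h4 l4] : exists2 c, has_mean P (fun t => dotp (rlJ r) (g t) ^+ 8) c &
  c <= 8 ^+ 8 * (2 * expR 4) by apply: m; rewrite dotpJJ.
have h := has_meanZ 4 (has_meanD (has_meanD h1 h2) (has_meanD h3 h4)).
suff [e he ele] : exists2 e, has_mean P (fun t => re_form p r (g t) ^+ 4) e &
    e <= 4 * (c1 + c2 + (c3 + c4)).
  exists e => //; apply: (le_trans ele); rewrite /moment_bound.
  by move: (8 ^+ 8 * (2 * expR 4)) l1 l2 l3 l4 => B l1 l2 l3 l4; lra.
apply: le_mean h.
- apply: measurable_funX; apply: measurable_funD; apply: measurable_funM;
  exact: (measurable_dotp gg).
- by move=> t; rewrite (exprM _ 2 2) sqr_ge0.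
- move=> t; rewrite /re_form.
  move: (dotp p (g t)) (dotp r (g t)) (dotp (rlJ p) (g t)) (dotp (rlJ r) (g t)) => a b c e.
  apply: (le_trans (pow4D_le _ _)).
  rewrite (_ : 4 * (_ + _) = 8 * ((a ^+ 8 + b ^+ 8) / 2 + (c ^+ 8 + e ^+ 8) / 2)).
    by rewrite ler_pM2l// lerD// pow4M_le.
  by field.
Qed.

(* Makes the fourth-moment term of [expRN_le] at most half of the second-moment one. *)
Definition form_scale : R := 8 * Num.sqrt moment_bound.

Lemma moment_bound_gt0 : 0 < moment_bound.
Proof. by rewrite /moment_bound !mulr_gt0// ?expR_gt0// exprn_gt0. Qed.

Lemma form_scale_gt0 : 0 < form_scale.
Proof. by rewrite mulr_gt0// sqrtr_gt0 moment_bound_gt0. Qed.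

(** The Gram hypothesis makes the second moment at least [1 / 32]. With [L = form_scale], so that
    [L^2 = 64 * moment_bound], the quadratic term of [expRN_le] gains [2 / (128 L^2)] and the
    quartic one loses at most [1 / (128 L^2)]. *)
Lemma integral_expRN_form p r : dotp p p <= 16 -> dotp r r <= 16 ->
  1 / 16 <= dotp p p * dotp r r - dotp (rlJ p) r ^+ 2 ->
  (\int[P]_t (expR (- (`|re_form p r (g t)| / form_scale)))%:E <=
   (1 - 1 / (128 * form_scale ^+ 2))%:E)%E.
Proof.
move=> p16 r16 pr.
have aux (a b k : R) : 2 * k <= a -> b <= k -> 1 - a + b <= 1 - k by lra.
have L0 := form_scale_gt0; have B0 := moment_bound_gt0.
have [c hc cle] := mean_form4 p16 r16.
have h := has_meanD (has_meanD (has_mean_cst P 1)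
    (has_meanZ (- (1 / (2 * form_scale ^+ 2))) (mean_form2 p r)))
  (has_meanZ (1 / (2 * form_scale ^+ 4)) hc).
have L2 : form_scale ^+ 2 = 64 * moment_bound.
  by rewrite /form_scale exprMn sqr_sqrtr ?(ltW B0)//; congr *%R; ring.
apply: le_trans (le_integral_mean _ _ _ h) _.
- apply: measurableT_comp => //; apply: measurableT_comp => //.
  apply: measurable_funM => //; apply: measurableT_comp => //.
  by apply: measurable_funD; apply: measurable_funM; exact: (measurable_dotp gg).
- by move=> t; exact: expR_ge0.
- move=> t; set x := re_form p r (g t).
  have y0 : 0 <= `|x| / form_scale by rewrite divr_ge0// ltW.
  apply: (le_trans (expRN_le y0)).
  rewrite !expr_div_n -normrX ger0_norm ?sqr_ge0//.
  rewrite -[in X in _ + X <= _]normrX ger0_norm; last by rewrite (exprM _ 2 2) sqr_ge0.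
  by rewrite le_eqVlt; apply/orP; left; apply/eqP; field; rewrite gt_eqF.
- rewrite lee_fin (exprM _ 2 2) L2.
  have e2 : 1 / 32 <= dotp p p * dotp r r / 2 + 3 / 2 * dotp p r ^+ 2
      - dotp (rlJ p) r ^+ 2 / 2 by have := sqr_ge0 (dotp p r); lra.
  move: e2; set m2 := (X in 1 / 32 <= X) => e2.
  have h1 : 1 / (2 * (64 * moment_bound)) * m2 >= 1 / (2 * (64 * moment_bound)) * (1 / 32).
    by rewrite ler_wpM2l// divr_ge0// !mulr_ge0// ltW.
  have h2 : 1 / (2 * (64 * moment_bound) ^+ 2) * c <=
      1 / (2 * (64 * moment_bound) ^+ 2) * moment_bound.
    by rewrite ler_wpM2l// divr_ge0// mulr_ge0// exprn_ge0// mulr_ge0// ltW.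
  have e1 : 1 / (2 * (64 * moment_bound)) * (1 / 32) = 2 * (1 / (128 * (64 * moment_bound))).
    by field; rewrite gt_eqF.
  have e3 : 1 / (2 * (64 * moment_bound) ^+ 2) * moment_bound = 1 / (128 * (64 * moment_bound)).
    by field; rewrite gt_eqF.
  move: h1 h2; rewrite e1 e3 mulNr; set a := _ * m2; set b := _ * c.
  exact: aux.
Qed.

End FormMoments.

(** * Tail bounds for sums over the samples *)

Section Chernoff.
Context d (T : measurableType d) (R : realType) (P : probability T R).
Variables (n m : nat) (a : 'I_m -> T -> 'cV[R[i]]_n).
Hypothesis ga : independent_complex_gaussians P a.
Local Notation K := ('I_n * bool)%type.

(** Independence and measurability of the samples are stated for [re_im], so every function of a
    sample has to be read off that space. *)
Definition coords (z : n.-tuple R * n.-tuple R) (k : K) : R :=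
  if k.2 then tnth z.2 k.1 else tnth z.1 k.1.

Lemma coordsE (x : 'cV[R[i]]_n) : coords (re_im x) = rl x.
Proof.
by apply/funext => -[i []]; rewrite /coords /rl /= tnth_mktuple.
Qed.

Lemma measurable_coords k : measurable_fun setT (coords^~ k).
Proof.
case: k => i [] /=; rewrite /coords/=.
- by apply: (measurableT_comp (measurable_tnth i)); exact: measurable_snd.
- by apply: (measurableT_comp (measurable_tnth i)); exact: measurable_fst.
Qed.

Lemma measurable_dotp_coords v : measurable_fun setT (fun z => dotp v (coords z)).
Proof.
by apply: measurable_sum => k; apply: measurable_funM => //; exact: measurable_coords.
Qed.

Lemma measurable_form_coords p r :
  measurable_fun setT (fun z => re_form p r (coords z)).
Proof.
by apply: measurable_funD; apply: measurable_funM; exact: measurable_dotp_coords.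
Qed.

Lemma measurable_re_im j : measurable_fun setT (fun t => re_im (a j t)).
Proof. exact: ga.1.1. Qed.

Lemma cgauss_rl j : cgauss P (fun t => rl (a j t)).
Proof.
split; last by move=> v; apply: complex_gaussian_mgf; exact: ga.2.
move=> k; have := measurableT_comp (measurable_coords k) (measurable_re_im j).
by rewrite (_ : _ \o _ = fun t => rl (a j t) k)//; apply/funext => t /=; rewrite coordsE.
Qed.

(** Markov's inequality for the exponential of the sum, which factors by independence. Threshold and
    scale are part of [psi], so that the same statement serves the upper and the lower tail. *)
Lemma chernoff (psi : (K -> R) -> R) (c : R) :
  measurable_fun setT (fun z => psi (coords z)) ->
  (forall j, \int[P]_t (expR (psi (rl (a j t))))%:E <= (expR (- c))%:E)%E ->
  measurable [set t | 0 <= \sum_j psi (rl (a j t))] /\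
  (P [set t | 0 <= \sum_j psi (rl (a j t))]%R <= (expR (- (c * m%:R)))%:E)%E.
Proof.
move=> mpsi bnd; set B := [set t | _].
have mS : measurable_fun setT (fun t => \sum_j psi (rl (a j t))).
  apply: measurable_sum => j.
  rewrite (_ : (fun t => _) = (fun z => psi (coords z)) \o (fun t => re_im (a j t))).
    exact: measurableT_comp mpsi (measurable_re_im j).
  by apply/funext => t /=; rewrite coordsE.
have mB : measurable B.
  rewrite (_ : B = (fun t => \sum_j psi (rl (a j t))) @^-1` `[0, +oo[%classic).
    by rewrite -[X in measurable X]setTI; apply: mS.
  by apply/seteqP; split => t /=; rewrite in_itv/= andbT.
split => //.
have E j : (\int[P]_t (expR (psi (coords (re_im (a j t)))))%:E <= (expR (- c))%:E)%E.
  by under eq_integral do rewrite coordsE; exact: bnd.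
apply: (@le_trans _ _ (\int[P]_t (expR (\sum_j psi (rl (a j t))))%:E)%E).
  rewrite -(setIT B) -integral_indic//; apply: ge0_le_integral => //.
  - exact/measurable_EFinP.
  - by apply/measurable_EFinP; exact: measurableT_comp.
  - move=> t _; rewrite lee_fin indicE; case: (boolP (t \in B)) => [|_].
      by rewrite inE /B /= => h; rewrite -expR0 ler_expR.
    exact: expR_ge0.
rewrite (_ : (\int[P]_t _)%E =
    (\int[P]_t (\prod_j expR (psi (coords (re_im (a j t)))))%:E)%E); last first.
  by apply: eq_integral => t _; rewrite expR_sum; under [in RHS]eq_bigr do rewrite coordsE.
rewrite (@integral_prod_indep _ _ _ P _ _ _ (fun j t => re_im (a j t))
    (fun j z => expR (psi (coords z)))) //; last 3 first.
- exact: ga.1.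
- by move=> j; apply: measurableT_comp.
- by move=> j; rewrite (le_lt_trans (E j))// ltry.
apply: (@le_trans _ _ (\prod_(j < m) (expR (- c))%:E)%E).
  suff : (0 <= \prod_j \int[P]_t (expR (psi (coords (re_im (a j t)))))%:E <=
      \prod_(j < m) (expR (- c))%:E)%E by move=> /andP[].
  elim/big_rec2 : _ => [|j x y _ /andP[y0 yx]]; first by rewrite lee01 lexx.
  have I0 : (0 <= \int[P]_t (expR (psi (coords (re_im (a j t)))))%:E)%E.
    by apply: integral_ge0 => t _; rewrite lee_fin expR_ge0.
  by rewrite mule_ge0//= lee_pmul.
rewrite prodEFin lee_fin prodr_const card_ord -expRM_natl.
by rewrite mulrN mulrC.
Qed.

(** The shift [ln 2] compensates the bound 2 on the exponential moment, leaving the factor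
    [expR (- c)] per sample. *)
Lemma form_upper_tail v (c : R) : dotp v v = 1 -> 0 <= c ->
  let B := [set t | 0 <= \sum_j (re_form v v (rl (a j t)) / 4 - (ln 2 + c))] in
  measurable B /\ (P B <= (expR (- (c * m%:R)))%:E)%E.
Proof.
move=> v1 c0; apply: (@chernoff (fun x => re_form v v x / 4 - (ln 2 + c))).
  apply: measurable_funB => //; apply: measurable_funM => //.
  exact: measurable_form_coords.
move=> j; under eq_integral do rewrite expRD mulrC EFinM.
rewrite ge0_integralZl//; last first.
- apply/measurable_EFinP; apply: measurableT_comp => //.
  apply: measurable_funM => //.
  by apply: measurable_funD; apply: measurable_funM; exact: (measurable_dotp (cgauss_rl j)).
apply: (@le_trans _ _ ((expR (- (ln 2 + c)))%:E * 2%:E)%E).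
  rewrite lee_wpmul2l ?lee_fin ?expR_ge0//.
  exact: (integral_expR_form (cgauss_rl j)).
by rewrite -EFinM lee_fin opprD expRD (expRN (ln 2)) lnK ?posrE// mulrAC mulVf ?mul1r.
Qed.

(** The exponent [1 / (128 L^2)] of [integral_expRN_form], [L = form_scale], is split in two halves:
    one is spent on the threshold [form_gap], the other remains as the rate. *)
Definition form_rate : R := 1 / (256 * form_scale R ^+ 2).

Definition form_gap : R := form_scale R * form_rate.

Lemma form_lower_tail p r :
  dotp p p <= 16 -> dotp r r <= 16 ->
  1 / 16 <= dotp p p * dotp r r - dotp (rlJ p) r ^+ 2 ->
  let B := [set t | 0 <= \sum_j (form_gap / form_scale R
                                 - `|re_form p r (rl (a j t))| / form_scale R)] in
  measurable B /\ (P B <= (expR (- (form_rate * m%:R)))%:E)%E.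
Proof.
move=> p16 r16 pr.
have L0 := form_scale_gt0 R; have B0 := moment_bound_gt0 R.
apply: (@chernoff (fun x => form_gap / form_scale R - `|re_form p r x| / form_scale R)).
  apply: measurable_funB => //; apply: measurable_funM => //.
  by apply: measurableT_comp => //; exact: measurable_form_coords.
move=> j; under eq_integral do rewrite expRD EFinM.
rewrite ge0_integralZl//; last first.
- apply/measurable_EFinP; apply: measurableT_comp => //; apply: measurableT_comp => //.
  apply: measurable_funM => //; apply: measurableT_comp => //.
  by apply: measurable_funD; apply: measurable_funM; exact: (measurable_dotp (cgauss_rl j)).
apply: (@le_trans _ _ ((expR (form_gap / form_scale R))%:E
    * (1 - 1 / (128 * form_scale R ^+ 2))%:E)%E).
  rewrite lee_wpmul2l ?lee_fin ?expR_ge0//.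
  exact: (integral_expRN_form (cgauss_rl j)).
rewrite -EFinM lee_fin.
apply: (@le_trans _ _ (expR (form_gap / form_scale R)
    * expR (- (1 / (128 * form_scale R ^+ 2))))).
  by rewrite ler_wpM2l ?expR_ge0// expR_ge1Dx.
rewrite -expRD ler_expR le_eqVlt; apply/orP; left; apply/eqP.
by rewrite /form_gap /form_rate; field; rewrite gt_eqF.
Qed.

End Chernoff.

Section UnionBound.
Context d (T : measurableType d) (R : realType) (P : probability T R).

Lemma union_bound (I : finType) (D : pred I) (B : I -> set T) (e : R) :
  (forall i, D i -> measurable (B i)) -> (forall i, D i -> P (B i) <= e%:E)%E ->
  measurable (\big[setU/set0]_(i | D i) B i) /\
  (P (\big[setU/set0]_(i | D i) B i) <= (#|D|%:R * e)%:E)%E.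
Proof.
move=> mB PB.
have [mU PU] : measurable (\big[setU/set0]_(i | D i) B i) /\
    (P (\big[setU/set0]_(i | D i) B i) <= \sum_(i | D i) P (B i))%E.
  elim/big_rec2 : _ => [|i x y Di [my xy]]; first by rewrite measure0.
  split; first by apply: measurableU => //; exact: mB.
  by apply: (le_trans (measureU2 _ (mB _ Di) my)); rewrite leeD2l.
split => //; apply: (le_trans PU).
apply: (@le_trans _ _ (\sum_(i | D i) e%:E)%E); first by apply: lee_sum.
by rewrite sumEFin lee_fin sumr_const mulr_natl.
Qed.

End UnionBound.

(** * Integer vectors of bounded l1 norm: vertices, rounding, counting *)

Section Lattice.
Context (R : realType) (K : finType) (N : nat).

(* An integer vector is encoded by its positive and negative parts. *)
Definition latv (w : {ffun K * bool -> 'I_N.+1}) (k : K) : R :=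
  (w (k, true))%:R - (w (k, false))%:R.

(** Bounds the sum of both parts. A vector may have several codes, which is harmless since only an
    upper bound on the number of codes is used. *)
Definition lat : pred {ffun K * bool -> 'I_N.+1} := fun w => (\sum_k w k <= N)%N.

(** A fractional knapsack problem has an optimal solution that is an indicator. [S] maximizes the
    sum of [c] among sets of at most [N] elements; exchanging elements shows that a threshold [tau]
    separates [c] on [S] from [c] outside. *)
Lemma top_subset_sum (c e : K -> R) :
  (forall k, 0 <= c k) -> (forall k, 0 <= e k <= 1) -> \sum_k e k <= N%:R ->
  exists2 S : {set K}, (#|S| <= N)%N & \sum_k c k * e k <= \sum_(k in S) c k.
Proof.
move=> c0 e01 eN.
pose F (S : {set K}) := \sum_(k in S) c k.
have P0 : (fun S : {set K} => (#|S| <= N)%N) finset.set0 by rewrite cards0.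
pose S := [arg max_(S > finset.set0 | (#|S| <= N)%N) F S]%O.
have [SN Smax] : (#|S| <= N)%N /\ forall S' : {set K}, (#|S'| <= N)%N -> F S' <= F S.
  by rewrite /S; case: Order.TotalTheory.arg_maxP => // S' ? h; split.
exists S => //.
have swap i j : i \in S -> j \notin S -> c j <= c i.
  move=> iS jS; have jS' : j \notin (S :\ i)%SET by rewrite !inE negb_and jS orbT.
  have := Smax (j |: S :\ i)%SET.
  have -> : #|(j |: S :\ i)%SET| = #|S| by rewrite cardsU1 jS' (cardsD1 i S) iS.
  move=> /(_ SN).
  rewrite /F big_setU1//= (bigD1 i iS)/=.
  rewrite (eq_bigl (fun k => (k \in S) && (k != i))) ?lerD2r//.
  by move=> k; rewrite !inE andbC.
(* [tau] is the multiplier of the constraint on the sum of [e]; the last clause is complementary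
   slackness, with [tau = 0] when [S] has fewer than [N] elements. *)
have [tau [tau0 hS hN tauN]] : exists tau, [/\ 0 <= tau, forall i, i \in S -> tau <= c i,
    forall j, j \notin S -> c j <= tau & tau * (N%:R - #|S|%:R) <= 0].
  have [SN'|SN'] := ltnP #|S| N.
    have z j : j \notin S -> c j <= 0.
      move=> jS; have := Smax (j |: S)%SET; rewrite cardsU1 jS add1n => /(_ SN').
      by rewrite /F big_setU1//= gerDr.
    by exists 0; split => //; rewrite ?mul0r.
  have -> : #|S| = N by apply/eqP; rewrite eqn_leq SN.
  (* The default [0] gives the maximum a value when [S] is everything, and is below [c] because [c]
     is nonnegative. *)
  exists (\big[Num.max/0]_(j | j \notin S) c j); split.
  - by apply: bigmax_ge_id.
  - by move=> i iS; apply/bigmax_leP; split => // j jS; exact: swap.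
  - by move=> j jS; apply: le_bigmax_cond.
  - by rewrite subrr mulr0.
apply: (@le_trans _ _ (\sum_k (tau * e k + (if k \in S then c k - tau else 0)))).
  apply: ler_sum => k _; have /andP[ek0 ek1] := e01 k; case: ifP => kS.
    by have := hS _ kS; nra.
  by rewrite addr0 ler_wpM2r// hN// kS.
rewrite big_split/= -big_mkcond/= sumrB sumr_const -mulr_sumr.
rewrite -mulr_natl.
suff : tau * \sum_i e i <= #|S|%:R * tau by lra.
by apply: (@le_trans _ _ (tau * N%:R)); [rewrite ler_wpM2l|lra].
Qed.

(** The maximum of a linear form over this polytope is reached at a sign vector: the signs of [c] on
    the set that [top_subset_sum] gives for [|c|] and [|e|]. *)
Lemma lattice_vertex (c e : K -> R) :
  (forall k, `|e k| <= 1) -> \sum_k `|e k| <= N%:R ->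
  exists w, [/\ lat w, dotp c e <= dotp c (latv w) & dotp (latv w) (latv w) <= N%:R].
Proof.
move=> e1 eN.
have [S SN hS] := @top_subset_sum (fun k => `|c k|) (fun k => `|e k|)
  (fun k => normr_ge0 _) (fun k => introT andP (conj (normr_ge0 _) (e1 k))) eN.
pose w : {ffun K * bool -> 'I_N.+1} := [ffun k : K * bool =>
  if (k.1 \in S) && ((0 <= c k.1) == k.2) then inord 1 else ord0].
have wE k b : (w (k, b) : nat) = if (k \in S) && ((0 <= c k) == b) then 1%N else 0%N.
  rewrite /w ffunE/=; case: ifP => //.
  move=> /andP[kS _]; rewrite inordK// ltnS (leq_trans _ SN)//.
  by apply/card_gt0P; exists k.
have zE k : latv w k = if k \in S then (if 0 <= c k then 1 else -1) else 0.
  by rewrite /latv !wE; case: (k \in S); case: (0 <= c k) => /=; rewrite ?subr0 ?sub0r.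
exists w; split.
- rewrite /lat; apply: leq_trans SN; rewrite -sum1_card.
  pose G k b := if (k \in S) && ((0 <= c k) == b) then 1%N else 0%N.
  rewrite (eq_bigr (fun k => G k.1 k.2)).
    rewrite -(pair_bigA _ G)/= /G.
    rewrite [in leqRHS]big_mkcond/=; apply: leq_sum => k _; rewrite big_bool/=.
    by case: (k \in S) => //; case: (0 <= c k).
  by move=> -[k b] _; rewrite wE.
- apply: (@le_trans _ _ (\sum_k `|c k| * `|e k|)).
    by apply: ler_sum => k _; rewrite -normrM ler_norm.
  apply: (le_trans hS); rewrite big_mkcond/=; apply: ler_sum => k _; rewrite zE.
  case: ifP => _; last by rewrite mulr0.
  by case: ifP => c0; [rewrite ger0_norm// mulr1|rewrite ltr0_norm ?mulrN1// ltNge c0].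
- apply: (@le_trans _ _ (#|S|%:R)); last by rewrite ler_nat.
  rewrite -sum1_card natr_sum big_mkcond/=; apply: ler_sum => k _; rewrite zE.
  by case: (k \in S); case: (0 <= c k); rewrite ?mulr1 ?mulr0 ?mulrNN ?mulr1.
Qed.

(** Every coordinate is rounded towards zero. Hence the rounded vector and the residual are both
    dominated by [u] coordinatewise, and so have no larger l1 norm. *)
Lemma lattice_round (u : K -> R) (delta : R) : 0 < delta ->
  \sum_k `|u k| <= delta * N%:R ->
  exists w, [/\ lat w, forall k, `|u k - delta * latv w k| <= delta,
    forall k, `|u k - delta * latv w k| <= `|u k| &
    forall k, `|delta * latv w k| <= `|u k|].
Proof.
move=> d0 uN.
(* [truncn] is zero on negative numbers, so at most one of [fl k true] and [fl k false] is
   nonzero. *)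
pose fl k (b : bool) := Num.truncn ((if b then u k else - u k) / delta).
have flP k : [/\ (fl k true)%:R - (fl k false)%:R = Num.sg (u k) * (fl k true + fl k false)%:R :> R,
    delta * (fl k true + fl k false)%:R <= `|u k| &
    `|u k| - delta * (fl k true + fl k false)%:R <= delta].
  have neg x : x <= 0 -> Num.truncn (x / delta) = 0%N.
    move=> x0; apply/truncn0Pn; rewrite -ltNge (le_lt_trans _ ltr01)//.
    by rewrite -oppr_ge0 -mulNr divr_ge0 ?oppr_ge0// ltW.
  have pos x : 0 <= x -> delta * (Num.truncn (x / delta))%:R <= x /\
      x - delta * (Num.truncn (x / delta))%:R <= delta.
    move=> x0; have /andP[l h] := truncn_itv (divr_ge0 x0 (ltW d0)).
    have xE : x = delta * (x / delta) by rewrite mulrC divfK// gt_eqF.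
    split; first by rewrite [leRHS]xE ler_pM2l.
    rewrite [X in X - _]xE -mulrBr ler_piMr ?(ltW d0)// lerBlDl.
    by rewrite -[X in _ + X]/(1%:R) -natrD addn1 ltW.
  rewrite /fl; have [u0|u0|->] := ltgtP (u k) 0.
  - rewrite neg ?(ltW u0)// add0n sub0r ltr0_sg// mulN1r ltr0_norm//.
    by have [] := pos (- u k); rewrite ?oppr_ge0 ?(ltW u0).
  - rewrite (neg (- u k)) ?oppr_le0 ?(ltW u0)// addn0 subr0 gtr0_sg// mul1r gtr0_norm//.
    by have [] := pos (u k); rewrite ?(ltW u0).
  - rewrite !neg ?oppr0// sgr0 mul0r normr0 addn0 mulr0n mulr0 !subr0; split; rewrite ?addr0//.
    exact: ltW.
have flN : (\sum_k (fl k true + fl k false) <= N)%N.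
  rewrite -(ler_nat R) natr_sum -(ler_pM2l d0) mulr_sumr; apply: le_trans uN.
  by apply: ler_sum => k _; have [] := flP k.
have flle k b : (fl k b <= N)%N.
  apply: leq_trans flN; rewrite (bigD1 k)//=; apply: leq_trans (leq_addr _ _).
  by case: b; [exact: leq_addr|exact: leq_addl].
pose w : {ffun K * bool -> 'I_N.+1} := [ffun k : K * bool => inord (fl k.1 k.2)].
have wE k b : (w (k, b) : nat) = fl k b by rewrite /w ffunE/= inordK// ltnS.
have zE k : latv w k = Num.sg (u k) * (fl k true + fl k false)%:R.
  by rewrite /latv !wE; have [] := flP k.
have nz k : `|delta * latv w k| <= `|u k|.
  have [_ h _] := flP k; rewrite zE mulrCA normrM normr_sg.
  have h0 : 0 <= delta * (fl k true + fl k false)%:R by rewrite mulr_ge0// ltW.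
  by rewrite (ger0_norm h0); case: eqP => _; rewrite ?mul0r ?mul1r.
have ne k : `|u k - delta * latv w k| =
    `|u k| - delta * `|latv w k|.
  have [_ h _] := flP k; rewrite zE.
  have h0 : 0 <= delta * (fl k true + fl k false)%:R by rewrite mulr_ge0// ltW.
  rewrite {1}(numEsg (u k)) mulrCA -mulrBr !normrM !normr_sg.
  have [u0|u0] := eqVneq (u k) 0; first by rewrite u0 normr0 !mul0r mulr0 subrr.
  by rewrite !mul1r normr_nat ger0_norm// subr_ge0.
exists w; split => //.
- rewrite /lat; rewrite (eq_bigr (fun k => fl k.1 k.2)).
    rewrite -(pair_bigA _ fl)/=; apply: leq_trans flN.
    by apply: leq_sum => k _; rewrite big_bool.
  by move=> -[k b] _; rewrite wE.
- move=> k; rewrite ne zE normrM normr_sg normr_nat.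
  have [_ _] := flP k; have [u0|u0] := eqVneq (u k) 0; last by rewrite mul1r.
  by move=> _; rewrite u0 normr0 mul0r mulr0 subr0 ltW.
- by move=> k; rewrite ne gerBl mulr_ge0// ltW.
Qed.

(** A generating function: each code in [lat] has weight [r] to the power of its sum, at least
    [r ^+ N], while the total weight of all codes factors into geometric sums, one for each of the
    [#|K| * 2] coordinates. *)
Lemma card_lattice (r : R) : 0 < r -> r < 1 ->
  #|lat|%:R * r ^+ N <= (1 - r)^-1 ^+ (#|K| * 2).
Proof.
move=> r0 r1.
have geo : \sum_(i < N.+1) r ^+ i <= (1 - r)^-1.
  have h : 0 < 1 - r by lra.
  rewrite -(ler_pM2l h) divff ?gt_eqF// -[X in X - r](expr1n _ N.+1).
  have := subrXX 1 r N.+1; rewrite !expr1n.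
  under [in X in _ = X -> _]eq_bigr do rewrite expr1n mul1r.
  by move=> <-; rewrite gerBl exprn_ge0// ltW.
apply: (@le_trans _ _ (\sum_(w : {ffun K * bool -> 'I_N.+1}) \prod_k r ^+ w k)).
  rewrite -sum1_card natr_sum mulr_suml big_mkcond/=; apply: ler_sum => w _.
  have p0 : 0 <= \prod_k r ^+ w k by apply: prodr_ge0 => k _; rewrite exprn_ge0// ltW.
  case: ifP => // lw; rewrite mul1r prodrXr.
  by rewrite ler_wiXn2l// ltW.
rewrite -(bigA_distr_bigA (fun (_ : K * bool) (i : 'I_N.+1) => r ^+ i))/=.
rewrite prodr_const card_prod card_bool.
by rewrite lerXn2r// nnegrE ?invr_ge0 ?subr_ge0 ?(ltW r1)// sumr_ge0// => i _; rewrite exprn_ge0// ltW.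
Qed.

End Lattice.

(** * Euclidean norm in real coordinates *)

Section Nrm.
Context (R : realType) (I : finType).
Implicit Types u v : I -> R.

Definition nrm u : R := Num.sqrt (dotp u u).

Lemma nrm_ge0 u : 0 <= nrm u. Proof. exact: sqrtr_ge0. Qed.

Lemma sqr_nrm u : nrm u ^+ 2 = dotp u u.
Proof. by rewrite sqr_sqrtr// dotp_ge0. Qed.

Lemma dotp_nrm u v : `|dotp u v| <= nrm u * nrm v.
Proof.
rewrite -[leLHS]sqrtr_sqr -sqrtrM ?dotp_ge0//.
by rewrite ler_wsqrtr// dotp_CS.
Qed.

Lemma nrmZ k u : nrm (k \*o u) = `|k| * nrm u.
Proof.
by rewrite /nrm !dotpE mulrA -expr2 sqrtrM ?sqr_ge0// sqrtr_sqr.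
Qed.

Lemma nrmD u v : nrm (u \+ v) <= nrm u + nrm v.
Proof.
rewrite -(@ler_pXn2r _ 2)// ?nnegrE ?addr_ge0 ?nrm_ge0//.
rewrite sqr_nrm sqrrD !sqr_nrm !dotpE (dotpC v u).
have := ler_norm (dotp u v); have := dotp_nrm u v; lra.
Qed.

Lemma nrm_tri u v : nrm u <= nrm v + nrm (u \- v).
Proof.
have {1}-> : u = v \+ (u \- v) by apply/funext => k /=; rewrite addrC subrK.
exact: nrmD.
Qed.

Lemma nrm_le u (c : R) : 0 <= c -> dotp u u <= c ^+ 2 -> nrm u <= c.
Proof.
by move=> c0 h; rewrite -(@ler_pXn2r _ 2)// ?nnegrE ?nrm_ge0// sqr_nrm.
Qed.

Lemma nrm_gt0 u : u != (fun=> 0) -> 0 < nrm u.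
Proof.
move=> u0; rewrite lt_neqAle nrm_ge0 andbT eq_sym; apply: contra_neq u0 => n0.
have : dotp u u = 0 by rewrite -sqr_nrm n0 expr0n.
move/eqP; rewrite psumr_eq0; last by move=> j _; rewrite -expr2 sqr_ge0.
move=> /allP h; apply/funext => i.
by have := h i (mem_index_enum _); rewrite /= -expr2 sqrf_eq0 => /eqP.
Qed.

End Nrm.

(** * From bounds at lattice vectors to bounds for rounding errors *)

Section UniformBound.
Context (R : realType) (d m : nat).
Local Notation K := ('I_d * bool)%type.
Variable g : 'I_m -> K -> R.
Implicit Types u v p r e : K -> R.

(** Up to sign, the real and imaginary parts of all the [a_j^* u]: a linear map whose Gram form is
    the sum of the [re_form]. *)
Definition sample (u : K -> R) (x : 'I_m * bool) : R :=
  if x.2 then dotp (rlJ u) (g x.1) else dotp u (g x.1).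

Lemma sampleD u v : sample (u \+ v) = sample u \+ sample v.
Proof. by apply/funext => -[j []]; rewrite /sample/= ?rlJD dotpDl. Qed.

Lemma sampleB u v : sample (u \- v) = sample u \- sample v.
Proof. by apply/funext => -[j []]; rewrite /sample/= ?rlJB dotpBl. Qed.

Lemma sampleZ c u : sample (c \*o u) = c \*o sample u.
Proof. by apply/funext => -[j []]; rewrite /sample/= ?rlJZ dotpZl. Qed.

Lemma sum_re_form u v : \sum_j re_form u v (g j) = dotp (sample u) (sample v).
Proof. by rewrite /dotp sum_coord -big_split. Qed.

Definition abs_form u v : R := \sum_j `|re_form u v (g j)|.

(** Cauchy-Schwarz twice: in the complex plane for each [j], then over [j] for the moduli [f w j] of
    [a_j^* w]. *)
Lemma abs_form_le u v : abs_form u v <= nrm (sample u) * nrm (sample v).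
Proof.
pose f w j := Num.sqrt (re_form w w (g j)).
have f0 w j : 0 <= re_form w w (g j).
  by rewrite /re_form addr_ge0// -expr2 sqr_ge0.
have E w : nrm (sample w) = nrm (f w).
  rewrite /nrm -sum_re_form; congr Num.sqrt; apply: eq_bigr => j _.
  by rewrite -expr2 sqr_sqrtr.
rewrite !E; apply: le_trans (dotp_nrm _ _); apply: le_trans (ler_norm _).
apply: ler_sum => j _; rewrite /f -sqrtrM//.
rewrite -[leLHS]sqrtr_sqr ler_wsqrtr// /re_form.
set a := dotp u _; set b := dotp v _; set c := dotp (rlJ u) _; set e := dotp (rlJ v) _.
by have := sqr_ge0 (a * e - b * c); nra.
Qed.

Lemma re_formBl u v w a : re_form (u \- v) w a = re_form u w a - re_form v w a.
Proof. by rewrite /re_form rlJB !dotpE; ring. Qed.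

Lemma re_formBr u v w a : re_form w (u \- v) a = re_form w u a - re_form w v a.
Proof. by rewrite /re_form rlJB !dotpE; ring. Qed.

Lemma abs_formZ (c c' : R) u v : abs_form (c \*o u) (c' \*o v) = `|c * c'| * abs_form u v.
Proof.
rewrite /abs_form mulr_sumr; apply: eq_bigr => j _; rewrite -normrM; congr `|_|.
by rewrite /re_form !rlJZ !dotpE; ring.
Qed.

Lemma abs_form_perturb u v u' v' :
  abs_form u' v' <= abs_form u v + abs_form (u \- u') v + abs_form u' (v \- v').
Proof.
rewrite /abs_form -!big_split/=; apply: ler_sum => j _.
rewrite re_formBl re_formBr.
rewrite [X in `|X| <= _](_ : _ = re_form u v (g j)
   - ((re_form u v (g j) - re_form u' v (g j)) + (re_form u' v (g j) - re_form u' v' (g j)))).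
  by apply: (le_trans (ler_normB _ _)); rewrite -addrA lerD2l ler_normD.
by ring.
Qed.

(** [c] is the adjoint of [sample] applied to [sample u]; it presents the pairing as a linear form
    in [v], to which [lattice_vertex] applies. *)
Lemma sample_dotp u : exists c, forall v, dotp (sample u) (sample v) = dotp c v.
Proof.
pose f (j : 'I_m) := (dotp u (g j) \*o g j) \- (dotp (rlJ u) (g j) \*o rlJ (g j)).
exists (fun k => \sum_j f j k) => v; rewrite -sum_re_form.
transitivity (\sum_j dotp (f j) v).
  apply: eq_bigr => j _; rewrite /f dotpBl !dotpZl /re_form (dotpC (g j)).
  have -> : dotp (rlJ (g j)) v = - dotp (rlJ v) (g j) by rewrite dotpC dotpJl opprK.
  by rewrite mulrN opprK.
rewrite /dotp exchange_big/=; apply: eq_bigr => k _.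
by rewrite mulr_suml.
Qed.

Variables (N : nat) (M : R).
Hypothesis M0 : 0 <= M.
Hypothesis upper : forall w, @lat K N w ->
  dotp (sample (latv R w)) (sample (latv R w)) <= M * dotp (latv R w) (latv R w).

(** A self-bounding argument. The square of [nrm (sample e)] is a linear form in [e]; replacing [e]
    by [delta] times a maximizing lattice vector [w] bounds it by
    [delta * nrm (sample e) * nrm (sample w)], and one factor cancels. So the residuals need no
    further net. *)
Lemma sample_residual e (delta : R) : 0 < delta ->
  (forall k, `|e k| <= delta) -> \sum_k `|e k| <= delta * N%:R ->
  nrm (sample e) <= Num.sqrt (M * N%:R) * delta.
Proof.
move=> d0 ed eN.
have [c hc] := sample_dotp e.
pose e' := delta^-1 \*o e.
have eE : e = delta \*o e'.
  by apply/funext => k /=; rewrite mulrA divff ?gt_eqF// mul1r.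
have e'1 k : `|e' k| = delta^-1 * `|e k|.
  by rewrite normrM ger0_norm// invr_ge0 ltW.
have [||w [lw cw wN]] := @lattice_vertex _ _ N c e'.
- by move=> k; rewrite e'1 ler_pdivrMl// mulr1.
- by under eq_bigr do rewrite e'1; rewrite -mulr_sumr ler_pdivrMl.
have h1 : nrm (sample e) ^+ 2 <= delta * (nrm (sample e) * nrm (sample (latv R w))).
  rewrite sqr_nrm hc {1}eE dotpZr ler_pM2l//; apply: (le_trans cw).
  by rewrite -hc; apply: le_trans (ler_norm _) (dotp_nrm _ _).
have h2 : nrm (sample (latv R w)) <= Num.sqrt (M * N%:R).
  rewrite ler_wsqrtr//; apply: (le_trans (upper lw)).
  by rewrite ler_wpM2l.
have [->|n0] := eqVneq (nrm (sample e)) 0.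
  by rewrite mulr_ge0 ?sqrtr_ge0// ltW.
have n1 : 0 < nrm (sample e) by rewrite lt_neqAle eq_sym n0 nrm_ge0.
move: h1; rewrite expr2 mulrCA ler_pM2l// => h1; apply: (le_trans h1).
by rewrite mulrC ler_pM2r.
Qed.

Lemma sample_lattice (w : {ffun K * bool -> 'I_N.+1}) (c : R) : lat w ->
  nrm (sample (c \*o latv R w)) <= Num.sqrt M * nrm (c \*o latv R w).
Proof.
move=> lw; rewrite sampleZ !nrmZ mulrCA ler_wpM2l//.
by rewrite /nrm -sqrtrM// ler_wsqrtr// upper.
Qed.

Lemma round_residual u (delta : R) : 0 < delta -> \sum_k `|u k| <= delta * N%:R ->
  exists w : {ffun K * bool -> 'I_N.+1}, let p := delta \*o latv R w in
  [/\ lat w, nrm p <= nrm u, nrm (u \- p) <= delta * Num.sqrt N%:R &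
      nrm (sample (u \- p)) <= Num.sqrt M * (delta * Num.sqrt N%:R)].
Proof.
move=> d0 uN; have [w [lw r1 r2 r3]] := lattice_round d0 uN.
exists w => p; split => //.
- rewrite /nrm ler_wsqrtr//; apply: ler_sum => k _.
  rewrite -!expr2 -(real_normK (num_real (p k))) -(real_normK (num_real (u k))).
  by rewrite lerXn2r ?nnegrE//; exact: r3.
- apply: nrm_le; first by rewrite mulr_ge0 ?sqrtr_ge0// ltW.
  rewrite exprMn sqr_sqrtr// expr2 -mulrA.
  (* The squared l2 norm is at most the sup norm times the l1 norm. *)
  apply: (@le_trans _ _ (\sum_k delta * `|u k|)).
    apply: ler_sum => k _ /=; rewrite -expr2 -(real_normK (num_real _)) expr2.
    exact: ler_pM.
  by rewrite -mulr_sumr ler_pM2l.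
- have := @sample_residual (u \- p) delta d0 r1; rewrite sqrtrM// -mulrA (mulrC (Num.sqrt N%:R) delta).
  by apply; apply: le_trans uN; apply: ler_sum => k _; exact: r2.
Qed.

End UniformBound.

(* With step [net_step], a unit vector of l1 norm at most [6 sqrt k] is rounded,
   with error at most [1 / n0], to a multiple of an integer vector of l1 norm at
   most [net_size]. *)
Definition net_size (k n0 : nat) : nat := (36 * k * n0 ^ 2)%N.

Definition net_step (R : realType) (k n0 : nat) : R :=
  (6 * n0%:R ^+ 2 * Num.sqrt k%:R)^-1.

Definition net_p (R : realType) d k n0
    (w : {ffun 'I_d * bool * bool -> 'I_(net_size k n0).+1}) : 'I_d * bool -> R :=
  net_step R k n0 \*o latv R w.

(** Discrete counterpart of the normalized second factor [2 al yhat + be u] with [al + be = 1]: [be]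
    becomes [l / n0] and [u] becomes a net point. *)
Definition net_r (R : realType) d k n0 (yhat : 'I_d * bool -> R)
    (w : {ffun 'I_d * bool * bool -> 'I_(net_size k n0).+1}) (l : nat) : 'I_d * bool -> R :=
  ((2 * (1 - l%:R / n0%:R)) \*o yhat) \+ ((l%:R / n0%:R) \*o net_p R w).

(** * Nondegeneracy of the two factors *)

Section ScalarGeometry.
Variable R : realType.

(** The right side is [|2 al yhat + be u|^2] for [D = al * be * <u, yhat>]. The first bound on [D]
    is the sign condition on [<h, y>] and leaves [be^2], enough for [be >= 1 / 2]; the second is
    Cauchy-Schwarz and leaves [(2 al - be)^2], enough otherwise. *)
Lemma sqr_half_le (al be D : R) : 0 <= al -> 0 <= be -> al + be = 1 ->
  - al ^+ 2 <= D -> - (al * be) <= D -> (1 / 2) ^+ 2 <= 4 * al ^+ 2 + 4 * D + be ^+ 2.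
Proof.
move=> al0 be0 albe D1 D2; rewrite expr_div_n expr1n.
have [bh|bh] := leP (1 / 2) be.
  have : (1 / 2) ^+ 2 <= be ^+ 2 by rewrite lerXn2r ?nnegrE.
  by rewrite expr_div_n expr1n; lra.
have : (1 / 2) ^+ 2 <= (2 * al - be) ^+ 2 by rewrite lerXn2r ?nnegrE//; lra.
by rewrite expr_div_n expr1n; lra.
Qed.

(** Here [i] is the rounding error [1 / n0]; [p], [r], [J] are the norms of the rounded factors and
    the degenerate pairing, which is nearly zero. *)
Lemma gram_lower (i p r J : R) : 0 <= i -> i <= 1 / 100 -> 1 - i <= p ->
  1 / 2 - 4 * i <= r -> `|J| <= 4 * i -> 1 / 16 <= (p * r) ^+ 2 - J ^+ 2.
Proof.
move=> i0 i1 pi ri Ji.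
have J2 : J ^+ 2 <= (4 / 100) ^+ 2.
  by rewrite -(real_normK (num_real J)) lerXn2r ?nnegrE//; lra.
have pr : 99 / 100 * (46 / 100) <= p * r by rewrite ler_pM//; lra.
have pr2 : (45 / 100) ^+ 2 <= (p * r) ^+ 2 by rewrite lerXn2r ?nnegrE//; lra.
lra.
Qed.

End ScalarGeometry.

(** * Uniform lower bound on the good event *)

Section UniformLowerBound.
Context (R : realType) (d m k n0 : nat) (Kc kappa : R).
Local Notation K := ('I_d * bool)%type.
Variables (g : 'I_m -> K -> R) (y yhat : K -> R).
Hypotheses (k0 : (0 < k)%N) (n100 : (100 <= n0)%N) (Kc0 : 0 <= Kc)
  (n0Kc : 14 * Kc <= kappa * n0%:R).
Let N := net_size k n0.
Let delta := net_step R k n0.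
Hypotheses (yE : y = nrm y \*o yhat) (yhat1 : nrm yhat <= 1).
Hypothesis upper : forall w, @lat K N w ->
  dotp (sample g (latv R w)) (sample g (latv R w)) <= (Kc * m%:R) * dotp (latv R w) (latv R w).
Hypothesis uppery : dotp (sample g yhat) (sample g yhat) <= Kc * m%:R.
Hypothesis lower : forall (w : {ffun K * bool -> 'I_N.+1}) (l : nat), lat w -> (l <= n0)%N ->
  dotp (net_p R w) (net_p R w) <= 16 ->
  dotp (net_r yhat w l) (net_r yhat w l) <= 16 ->
  1 / 16 <= dotp (net_p R w) (net_p R w) * dotp (net_r yhat w l) (net_r yhat w l)
      - dotp (rlJ (net_p R w)) (net_r yhat w l) ^+ 2 ->
  kappa * m%:R <= abs_form g (net_p R w) (net_r yhat w l).

Let n0_gt0 : 0 < n0%:R :> R. Proof. by rewrite ltr0n (leq_trans _ n100). Qed.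
Let n0_100 : 100 <= n0%:R :> R. Proof. by rewrite (ler_nat R 100). Qed.
Let P := Num.sqrt (Kc * m%:R).
Let P0 : 0 <= P. Proof. exact: sqrtr_ge0. Qed.
Let P2 : P * P = Kc * m%:R.
Proof. by rewrite -expr2 sqr_sqrtr// mulr_ge0. Qed.
Let k_gt0 : 0 < Num.sqrt k%:R :> R. Proof. by rewrite sqrtr_gt0 ltr0n. Qed.
Let delta0 : 0 < delta. Proof. by rewrite invr_gt0 !mulr_gt0// exprn_gt0. Qed.
Let sqrtN : Num.sqrt N%:R = 6 * n0%:R * Num.sqrt k%:R :> R.
Proof.
rewrite /N /net_size natrM natrX natrM mulrAC sqrtrM ?mulr_ge0 ?exprn_ge0//.
rewrite (_ : 36%:R * _ = (6 * n0%:R) ^+ 2); last by ring.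
by rewrite sqrtr_sqr ger0_norm// mulr_ge0.
Qed.
Let deltaN : delta * Num.sqrt N%:R = n0%:R^-1.
Proof. by rewrite sqrtN /delta /net_step; field; rewrite !gt_eqF. Qed.

(* [al] and [be] are the relative sizes of [y] and of the increment. *)
Lemma uniform_normalized (u : K -> R) (al be : R) :
  nrm u = 1 -> 0 <= al -> 0 <= be -> al + be = 1 ->
  al ^+ 2 * dotp yhat yhat = al ^+ 2 -> al * dotp (rlJ u) yhat = 0 ->
  - al ^+ 2 <= al * be * dotp u yhat -> \sum_i `|u i| <= 6 * Num.sqrt k%:R ->
  kappa / 2 * m%:R <= abs_form g u (((2 * al) \*o yhat) \+ (be \*o u)).
Proof.
move=> u1 al0 be0 albe aly aJ auy ul1.
have uN : \sum_i `|u i| <= delta * N%:R.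
  apply: (le_trans ul1); rewrite -[N%:R]sqr_sqrtr// expr2 mulrA deltaN sqrtN.
  by rewrite le_eqVlt; apply/orP; left; apply/eqP; field; rewrite gt_eqF.
have [w [lw pu upn sup]] := round_residual (mulr_ge0 Kc0 (ler0n R m)) upper delta0 uN.
move: pu upn sup; rewrite -/(net_p R w); set p := net_p R w; rewrite deltaN u1 => p1 upn sup.
(* The weight [be] is rounded down to a multiple of [1 / n0], so that it takes [n0 + 1] values. *)
pose l := Num.truncn (be * n0%:R).
have /andP[l1 l2] : l%:R <= be * n0%:R < l.+1%:R by apply: truncn_itv; rewrite mulr_ge0.
have ln : (l <= n0)%N.
  by rewrite -(ler_nat R) (le_trans l1)// ler_piMl//; lra.
pose be' : R := l%:R / n0%:R.
have be'0 : 0 <= be' by rewrite divr_ge0.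
have bl : be' <= be by rewrite ler_pdivrMr.
have bu : be - be' <= n0%:R^-1.
  rewrite lerBlDr -(ler_pM2r n0_gt0) mulrDl mulVf ?gt_eqF// /be' divfK ?gt_eqF//.
  by move: l2; rewrite -natr1; lra.
set r := (X in abs_form g u X).
pose r' := net_r yhat w l.
have alE : al = 1 - be by lra.
have rr' : r \- r' = ((- 2 * (be - be')) \*o yhat) \+ (((be - be') \*o u) \+ (be' \*o (u \- p))).
  by apply/funext => i; rewrite /r /r' /net_r -/p -/be' alE /=; ring.
have i0 : 0 < n0%:R^-1 :> R by rewrite invr_gt0.
have i100 : n0%:R^-1 <= 1 / 100 :> R by rewrite div1r lef_pV2 ?posrE.
have dbe : `|be - be'| <= n0%:R^-1 by rewrite ger0_norm ?subr_ge0.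
have be'1 : be' <= 1 by lra.
have nrr' : nrm (r \- r') <= 4 * n0%:R^-1.
  rewrite rr'; apply: (le_trans (nrmD _ _)); rewrite nrmZ normrM normrN normr_nat.
  have h1 := nrmD ((be - be') \*o u) (be' \*o (u \- p)).
  have h2 : `|be - be'| * nrm yhat <= n0%:R^-1 * 1 by rewrite ler_pM// nrm_ge0.
  have h3 : nrm ((be - be') \*o u) <= n0%:R^-1 by rewrite nrmZ u1 mulr1.
  have h4 : nrm (be' \*o (u \- p)) <= 1 * n0%:R^-1.
    by rewrite nrmZ (ger0_norm be'0) ler_pM// nrm_ge0.
  lra.
have sy : nrm (sample g yhat) <= P by rewrite /nrm ler_wsqrtr.
have sp : nrm (sample g p) <= P.
  apply: (le_trans (sample_lattice (mulr_ge0 Kc0 (ler0n R m)) upper delta lw)).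
  by rewrite -/p -/P -[leRHS]mulr1 ler_wpM2l.
have su : nrm (sample g u) <= 2 * P.
  have h1 := nrm_tri (sample g u) (sample g p); rewrite -sampleB in h1.
  have h2 : P * n0%:R^-1 <= P * 1 by rewrite ler_wpM2l//; lra.
  by move: sup; rewrite -/P; lra.
have srr' : nrm (sample g (r \- r')) <= 5 * P * n0%:R^-1.
  rewrite rr' !sampleD !sampleZ; apply: (le_trans (nrmD _ _)).
  rewrite nrmZ normrM normrN normr_nat.
  have h1 := nrmD ((be - be') \*o sample g u) (be' \*o sample g (u \- p)).
  have h2 : `|be - be'| * nrm (sample g yhat) <= n0%:R^-1 * P.
    by rewrite ler_pM// nrm_ge0.
  have h3 : nrm ((be - be') \*o sample g u) <= n0%:R^-1 * (2 * P).
    by rewrite nrmZ ler_pM// nrm_ge0.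
  have h4 : nrm (be' \*o sample g (u \- p)) <= 1 * (P * n0%:R^-1).
    by rewrite nrmZ (ger0_norm be'0) ler_pM// nrm_ge0.
  lra.
have sr : nrm (sample g r) <= 2 * P.
  rewrite /r sampleD !sampleZ; apply: (le_trans (nrmD _ _)).
  rewrite !nrmZ (ger0_norm be0) ger0_norm ?mulr_ge0//.
  have h1 : al * nrm (sample g yhat) <= al * P by rewrite ler_wpM2l.
  have h2 : be * nrm (sample g u) <= be * (2 * P) by rewrite ler_wpM2l.
  have -> : 2 * P = 2 * (al + be) * P by rewrite albe mulr1.
  lra.
have pert := abs_form_perturb g u r p r'.
have e1 : abs_form g (u \- p) r <= P * n0%:R^-1 * (2 * P).
  by apply: (le_trans (abs_form_le _ _ _)); rewrite ler_pM// nrm_ge0.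
have e2 : abs_form g p (r \- r') <= P * (5 * P * n0%:R^-1).
  by apply: (le_trans (abs_form_le _ _ _)); rewrite ler_pM// nrm_ge0.
have uu : dotp u u = 1 by rewrite -sqr_nrm u1 expr1n.
(* This keeps [h] away from [- 2 y], where the second factor would vanish. *)
have r_half : 1 / 2 <= nrm r.
  rewrite -(@ler_pXn2r _ 2)// ?nnegrE ?nrm_ge0// sqr_nrm /r !dotpE uu (dotpC yhat u).
  have -> : 2 * al * (2 * al * dotp yhat yhat + be * dotp u yhat)
      + be * (2 * al * dotp u yhat + be * 1)
    = 4 * (al ^+ 2 * dotp yhat yhat) + 4 * (al * be * dotp u yhat) + be ^+ 2 by ring.
  rewrite aly; apply: sqr_half_le => //.
  rewrite -mulrN1 ler_wpM2l ?mulr_ge0//.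
  have := dotp_nrm u yhat; rewrite u1 mul1r => h.
  by rewrite lerNl (le_trans _ yhat1)// (le_trans _ h)// -normrN ler_norm.
have low : kappa * m%:R <= abs_form g p r'.
  have pge : 1 - n0%:R^-1 <= nrm p by have := nrm_tri u p; lra.
  have r'ge : 1 / 2 - 4 * n0%:R^-1 <= nrm r' by have := nrm_tri r r'; lra.
  have r'le : nrm r' <= 4.
    apply: (le_trans (nrmD _ _)); rewrite -/p -/be' (nrmZ (2 * (1 - be'))) (nrmZ be') (ger0_norm be'0).
    rewrite ger0_norm; last by lra.
    have h1 : 2 * (1 - be') * nrm yhat <= 2 * (1 - be') * 1.
      by rewrite ler_wpM2l//; lra.
    have h2 : be' * nrm p <= be' * 1 by rewrite ler_wpM2l.
    by lra.
  apply: lower => //.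
  - rewrite -sqr_nrm; apply: (@le_trans _ _ (1 ^+ 2)); last by rewrite expr1n; lra.
    by rewrite lerXn2r ?nnegrE ?nrm_ge0.
  - rewrite -sqr_nrm; apply: (@le_trans _ _ (4 ^+ 2)); last by lra.
    by rewrite lerXn2r ?nnegrE ?nrm_ge0.
  - rewrite -/p -/r' -!sqr_nrm -exprMn.
    (* Without rounding the pairing would vanish, by [aJ] and because [rlJ] is antisymmetric; only
       the errors of rounding [be] and [u] remain. *)
    have Jp : `|dotp (rlJ p) r'| <= 4 * n0%:R^-1.
      have -> : dotp (rlJ p) r' = 2 * ((be - be') * dotp (rlJ p) yhat
          - al * dotp (rlJ (u \- p)) yhat).
        rewrite /r' /net_r -/p -/be' rlJB dotpBl dotpDr 2!dotpZr dotpJ mulr0 addr0 (mulrBr al) aJ alE.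
        by ring.
      rewrite normrM ger0_norm//.
      have h1 : `|dotp (rlJ p) yhat| <= 1.
        apply: (le_trans (dotp_nrm _ _)); rewrite -[leRHS]mulr1 ler_pM ?nrm_ge0//.
        by rewrite /nrm dotpJJ.
      have h2 : `|dotp (rlJ (u \- p)) yhat| <= n0%:R^-1.
        apply: (le_trans (dotp_nrm _ _)); rewrite -[leRHS]mulr1 ler_pM ?nrm_ge0//.
        by rewrite /nrm dotpJJ.
      have h3 : `|(be - be') * dotp (rlJ p) yhat| <= n0%:R^-1 * 1.
        by rewrite normrM ler_pM.
      have h4 : `|al * dotp (rlJ (u \- p)) yhat| <= 1 * n0%:R^-1.
        by rewrite normrM ler_pM// ger0_norm//; lra.
      have := ler_normB ((be - be') * dotp (rlJ p) yhat) (al * dotp (rlJ (u \- p)) yhat).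
      by lra.
    exact: (gram_lower (ltW i0) i100 pge r'ge Jp).
(* The two perturbations [e1] and [e2] add up to [2 + 5 = 7] times [P^2 / n0]; the factor 14 in
   [n0Kc] makes this at most half of the gap. *)
have e3 : 7 * (P * P) * n0%:R^-1 <= kappa / 2 * m%:R.
  rewrite P2 ler_pdivrMr//.
  have : 14 * Kc * m%:R <= kappa * n0%:R * m%:R by rewrite ler_wpM2r.
  lra.
lra.
Qed.

(** By homogeneity: [h] is divided by [t], its norm, and [2 y + h] by [s = nrm y + t], which turns
    the relative sizes of [y] and [h] into weights [al] and [be] of sum 1. *)
Lemma uniform_lower (h : K -> R) :
  dotp (rlJ h) y = 0 -> - dotp y y <= dotp h y ->
  \sum_i `|h i| <= 6 * Num.sqrt k%:R * nrm h ->
  kappa / 2 * m%:R * (nrm h * (nrm y + nrm h)) <=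
  abs_form g h ((2 \*o y) \+ h).
Proof.
move=> hJ hy h1.
have [h0|h0] := eqVneq (nrm h) 0.
  by rewrite h0 mul0r mulr0 sumr_ge0.
have hp : 0 < nrm h by rewrite lt_neqAle eq_sym h0 nrm_ge0.
have y0 := nrm_ge0 y.
set t := nrm h; set s := nrm y + t.
have s0 : 0 < s by rewrite ltr_wpDl.
pose u := t^-1 \*o h; pose al := nrm y / s; pose be := t / s.
have hE : h = t \*o u by apply/funext => i /=; rewrite mulrA divff ?mul1r.
have yyE : dotp y y = nrm y ^+ 2 * dotp yhat yhat.
  by rewrite {1 2}yE !dotpE; ring.
have yy2 : nrm y ^+ 2 * dotp yhat yhat = nrm y ^+ 2 by rewrite -yyE -sqr_nrm.
have hyhat v : nrm y * dotp v yhat = dotp v y by rewrite [in RHS]yE dotpZr.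
have n1 : nrm u = 1 by rewrite nrmZ ger0_norm ?invr_ge0 ?nrm_ge0// mulVf.
have al0 : 0 <= al by rewrite divr_ge0// ltW.
have be0 : 0 <= be by rewrite divr_ge0// ltW.
have albe : al + be = 1 by rewrite -mulrDl divff// gt_eqF.
have aly : al ^+ 2 * dotp yhat yhat = al ^+ 2.
  by rewrite /al expr_div_n mulrAC yy2.
have aJ : al * dotp (rlJ u) yhat = 0.
  rewrite /al /u rlJZ dotpZl.
  have -> : nrm y / s * (t^-1 * dotp (rlJ h) yhat) =
    nrm y * dotp (rlJ h) yhat / (s * t) by field; rewrite !gt_eqF.
  by rewrite hyhat hJ mul0r.
have auy : - al ^+ 2 <= al * be * dotp u yhat.
  rewrite /al /be /u dotpZl.
  have -> : nrm y / s * (t / s) * (t^-1 * dotp h yhat) =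
    nrm y * dotp h yhat / s ^+ 2 by field; rewrite !gt_eqF.
  rewrite hyhat expr_div_n -mulNr ler_pM2r ?invr_gt0 ?exprn_gt0//.
  by rewrite sqr_nrm.
have ul1 : \sum_i `|u i| <= 6 * Num.sqrt k%:R.
  rewrite (eq_bigr (fun i => t^-1 * `|h i|)); last first.
    by move=> i _; rewrite /u normrM ger0_norm// invr_ge0 nrm_ge0.
  by rewrite -mulr_sumr ler_pdivrMl// mulrC.
have := uniform_normalized n1 al0 be0 albe aly aJ auy ul1.
set r := (X in abs_form g u X) => hr.
have -> : (2 \*o y) \+ h = s \*o r.
  apply/funext => i; rewrite /r /u /= {1}yE /= /al /be.
  by field; rewrite !gt_eqF.
rewrite hE abs_formZ ger0_norm ?mulr_ge0 ?(ltW s0) ?nrm_ge0//.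
by rewrite mulrC ler_pM2l// mulr_gt0.
Qed.

End UniformLowerBound.

(** * Size of the net *)

Lemma ln_edk_ge1 (R : realType) (d k : nat) : (1 <= k <= d)%N ->
  1 <= ln (expR 1 * d%:R / k%:R) :> R.
Proof.
move=> /andP[k1 kd].
have k0 : 0 < k%:R :> R by rewrite ltr0n.
have d0 : 0 < d%:R :> R by rewrite ltr0n (leq_trans k1).
rewrite -ler_expR lnK ?posrE ?divr_gt0 ?mulr_gt0 ?expR_gt0//.
by rewrite -mulrA ler_peMr ?expR_ge0// ler_pdivlMr// mul1r ler_nat.
Qed.

(** [card_lattice] at [r = k / (2 d)]: [r^-1 = 2 d / k] is at most [e d / k], and the [4 d]
    geometric factors, each at most [exp (2 r)], contribute [exp (4 k)]. *)
Lemma card_lattice_le (R : realType) (d k N : nat) : (1 <= k <= d)%N ->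
  #|@lat ('I_d * bool)%type N|%:R <=
  expR ((N%:R + 4 * k%:R) * ln (expR 1 * d%:R / k%:R)) :> R.
Proof.
move=> /andP[k1 kd].
have k0 : 0 < k%:R :> R by rewrite ltr0n.
have d0 : 0 < d%:R :> R by rewrite ltr0n (leq_trans k1).
have kd' : k%:R <= d%:R :> R by rewrite ler_nat.
set La := ln _.
have e2 : 2 <= expR 1 :> R by have := expR_ge1Dx (1 : R); lra.
have LaE : expR La = expR 1 * d%:R / k%:R by rewrite lnK// posrE divr_gt0// mulr_gt0// expR_gt0.
have La1 : 1 <= La by apply: ln_edk_ge1; rewrite k1.
pose r : R := k%:R / (2 * d%:R).
have r0 : 0 < r by rewrite divr_gt0// mulr_gt0.
have r1 : r <= 1 / 2 by rewrite /r ler_pdivrMr ?mulr_gt0//; lra.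
have h := @card_lattice R ('I_d * bool)%type N r r0 (le_lt_trans r1 _).
have {h} := h ltac:(lra); rewrite -ler_pdivlMr ?exprn_gt0// => h.
apply: (le_trans h); rewrite mulrDl expRD mulrC ler_pM//.
- by rewrite invr_ge0 exprn_ge0// ltW.
- by rewrite exprn_ge0// invr_ge0; lra.
- rewrite expRM_natl -exprVn lerXn2r ?nnegrE ?expR_ge0 ?invr_ge0 ?(ltW r0)//.
  rewrite LaE /r invf_div ler_pM2r ?invr_gt0// ler_pM2r//.
- rewrite card_prod card_ord card_bool.
  have i1 : (1 - r)^-1 <= expR (2 * r).
    have h0 : 0 < 1 - r by lra.
    rewrite -[leLHS]mul1r ler_pdivrMr//.
    apply: (@le_trans _ _ ((1 + 2 * r) * (1 - r))); first by nra.
    by rewrite ler_pM2r// expR_ge1Dx.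
  apply: (@le_trans _ _ (expR (2 * r) ^+ (d * 2 * 2))).
    by rewrite lerXn2r ?nnegrE ?expR_ge0// invr_ge0; lra.
  rewrite -expRM_natl ler_expR !natrM /r.
  have -> : d%:R * 2 * 2 * (2 * (k%:R / (2 * d%:R))) = 4 * k%:R :> R.
    by field; rewrite gt_eqF.
  by rewrite ler_peMr// mulr_ge0// ltW.
Qed.

(** * The good event and its probability *)

Section UniformEvent.
Context (disp : measure_display) (T : measurableType disp) (R : realType).
Variables (P : probability T R) (d m : nat) (a : 'I_m -> T -> 'cV[R[i]]_d).
Hypothesis ga : independent_complex_gaussians P a.
Local Notation K := ('I_d * bool)%type.
Let g t j : K -> R := rl (a j t).

(** The threshold of [form_upper_tail] at [c = 1], multiplied by the 4 that divides the form
    there. *)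
Definition upper_const : R := 4 * (ln 2 + 1).

Lemma upper_const_ge0 : 0 <= upper_const.
Proof. by rewrite mulr_ge0// addr_ge0// ln_ge0// ler1n. Qed.

(** The tail bound is for unit vectors; a zero vector has no direction and needs no bad event. *)
Definition upper_bad (v : K -> R) : set T :=
  if nrm v == 0 then set0 else
  [set t | 0 <= \sum_j (re_form ((nrm v)^-1 \*o v) ((nrm v)^-1 \*o v) (g t j) / 4
                          - (ln 2 + 1))].

Lemma upper_badP v : [/\ measurable (upper_bad v),
   (P (upper_bad v) <= (expR (- m%:R))%:E)%E &
   forall t, ~ upper_bad v t ->
     dotp (sample (g t) v) (sample (g t) v) <= (upper_const * m%:R) * dotp v v].
Proof.
rewrite /upper_bad; have [v0|v0] := eqVneq (nrm v) 0.
  split => //; first by rewrite measure0 lee_fin expR_ge0.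
  move=> t _; have vz : v = fun=> 0.
    by apply/eqP/negP => /negP /nrm_gt0; rewrite v0 ltxx.
  have sz : sample (g t) v = fun=> 0.
    apply/funext => -[j b]; rewrite /sample vz /=.
    have J0 : rlJ (fun=> 0 : R) = (fun=> 0) :> (K -> R).
      by apply/funext => -[i []]; rewrite /rlJ/= ?oppr0.
    by rewrite J0 /dotp; case: b; rewrite big1// => i _; rewrite mul0r.
  have -> : dotp (sample (g t) v) (sample (g t) v) = 0.
    by rewrite sz /dotp big1// => i _; rewrite mul0r.
  by apply: mulr_ge0 (dotp_ge0 _); apply: mulr_ge0 => //; exact: upper_const_ge0.
have vp : 0 < nrm v by rewrite lt_neqAle eq_sym v0 nrm_ge0.
set u := _ \*o v.
have u1 : dotp u u = 1.
  by rewrite -sqr_nrm /u nrmZ ger0_norm ?invr_ge0 ?nrm_ge0// mulVf// expr1n.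
have [mB PB] := form_upper_tail ga u1 (@ler01 R).
rewrite mul1r in PB; split => // t /= /negP; rewrite -ltNge sumrB sumr_const card_ord.
rewrite -mulr_suml subr_lt0 ltr_pdivrMr// => h.
have vE : v = nrm v \*o u by apply/funext => i /=; rewrite mulrA divff// mul1r.
have -> : dotp (sample (g t) v) (sample (g t) v) =
    nrm v ^+ 2 * \sum_j re_form u u (g t j).
  by rewrite {1 2}vE sampleZ dotpZl dotpZr sum_re_form mulrA expr2.
rewrite -(sqr_nrm v) mulrC ler_pM2r ?exprn_gt0//.
by apply: (le_trans (ltW h)); rewrite /upper_const -mulr_natr; lra.
Qed.

Variables (k n0 : nat) (yhat : K -> R).
Local Notation W := {ffun K * bool -> 'I_(net_size k n0).+1}.

(** Net pairs with a nearly degenerate Gram quantity need not satisfy the lower bound, and are left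
    out of the union. *)
Definition lower_cond (wl : W * 'I_n0.+1) : bool :=
  let p := net_p R wl.1 in let r := net_r yhat wl.1 wl.2 in
  [&& lat wl.1, dotp p p <= 16, dotp r r <= 16 &
      1 / 16 <= dotp p p * dotp r r - dotp (rlJ p) r ^+ 2].

Definition lower_bad (wl : W * 'I_n0.+1) : set T :=
  [set t | 0 <= \sum_j (form_gap R / form_scale R
     - `|re_form (net_p R wl.1) (net_r yhat wl.1 wl.2) (g t j)| / form_scale R)].

Lemma lower_badP wl : lower_cond wl -> [/\ measurable (lower_bad wl),
   (P (lower_bad wl) <= (expR (- (form_rate R * m%:R)))%:E)%E &
   forall t, ~ lower_bad wl t -> form_gap R * m%:R <=
     abs_form (g t) (net_p R wl.1) (net_r yhat wl.1 wl.2)].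
Proof.
move=> /and4P[lw p16 r16 pr].
have [mB PB] := form_lower_tail ga p16 r16 pr; split => // t /= /negP.
rewrite -ltNge sumrB sumr_const card_ord -mulr_suml subr_lt0.
have L0 := form_scale_gt0 R.
by rewrite -mulrnAl ltr_pM2r ?invr_gt0// => /ltW; rewrite mulr_natr.
Qed.

End UniformEvent.

(** A union bound over three families: upper bounds at all lattice vectors, one upper bound at the
    direction of [y], and lower bounds at the admissible net pairs. The constant [C0] makes [m]
    exceed the logarithm of their number. *)
Lemma uniform_event (R : realType) : exists c C0 c1 : R, [/\ 0 < c, 1 <= C0, 0 < c1 &
  forall (d k m : nat), (1 <= k <= d)%N ->
  forall (disp : measure_display) (T : measurableType disp)
    (P : probability T R) (a : 'I_m -> T -> 'cV[R[i]]_d),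
  independent_complex_gaussians P a ->
  forall y : 'I_d * bool -> R,
  C0 * k%:R * ln (expR 1 * d%:R / k%:R) <= m%:R ->
  exists E : set T, [/\ measurable E,
    ((1 - expR (- (c * m%:R)))%:E <= P E)%E &
  forall t, E t -> forall h : 'I_d * bool -> R,
    dotp (rlJ h) y = 0 -> - dotp y y <= dotp h y ->
    \sum_i `|h i| <= 6 * Num.sqrt k%:R * nrm h ->
    c1 * m%:R * (nrm h * (nrm y + nrm h)) <=
    abs_form (fun j => rl (a j t)) h ((2 \*o y) \+ h)]].
Proof.
set c2 := form_rate R.
have L0 := form_scale_gt0 R.
have L1 : 1 <= form_scale R ^+ 2.
  rewrite /form_scale exprMn sqr_sqrtr ?(ltW (moment_bound_gt0 R))// /moment_bound.
  have e4 : 1 <= expR 4 :> R by rewrite -expR0 ler_expR.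
  have : 1 <= 8 ^+ 8 :> R by rewrite exprn_ege1// ler1n.
  move: (8 ^+ 8) => z z1; have := ler_wpM2l (ltW (lt_le_trans ltr01 z1)) e4; lra.
have D0 : 0 < 256 * form_scale R ^+ 2 by lra.
have c20 : 0 < c2 by rewrite /c2 /form_rate div1r invr_gt0.
have c21 : c2 <= 1 by rewrite /c2 /form_rate ler_pdivrMr// mul1r; lra.
have kap0 : 0 < form_gap R by rewrite mulr_gt0.
(* The first summand makes the rounding errors at most half of the gap, the second provides the
   margin [1 / 100] of [gram_lower]. *)
pose n0 := ((Num.truncn (14 * upper_const R / form_gap R)).+1 + 100)%N.
have n100 : (100 <= n0)%N by rewrite leq_addl.
have n0K : 14 * upper_const R <= form_gap R * n0%:R.
  rewrite -ler_pdivrMl// mulrC /n0 natrD.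
  have := truncnS_gt (14 * upper_const R / form_gap R); lra.
pose A : R := 36 * n0%:R ^+ 2 + 4.
(* [A] is the exponent of [card_lattice_le] per unit of [k log (e d / k)]. Half of the exponent
   [c2 * m] pays for the number of events, the other half is the final rate. *)
pose C0 := 2 / c2 * (ln (n0%:R + 3) + A).
have n01 : 1 <= n0%:R :> R by rewrite ler1n (leq_trans _ n100).
have ln0 : 0 <= ln (n0%:R + 3 : R) by rewrite ln_ge0//; lra.
have A4 : 4 <= A by rewrite /A lerDr mulr_ge0// exprn_ge0//; lra.
have C01 : 1 <= C0.
  have h : 2 <= 2 / c2 by rewrite ler_pdivlMr//; lra.
  by rewrite /C0; nra.
exists (c2 / 2), C0, (form_gap R / 2); split => //; [exact: divr_gt0|exact: divr_gt0|].
move=> d k m kd disp T P a ga y hm.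
have /andP[k1 kd'] := kd.
(* For [y = 0] the inverse is 0 and so is [yhat]; hence its norm is only claimed to be at most 1. *)
pose yhat := (nrm y)^-1 \*o y.
have yE : y = nrm y \*o yhat.
  have [y0|y0] := eqVneq (nrm y) 0.
    have yz : y = fun=> 0 by apply/eqP/negP => /negP /nrm_gt0; rewrite y0 ltxx.
    by apply/funext => i; rewrite /yhat yz /= !mulr0.
  by apply/funext => i; rewrite /yhat /= mulrA divff// mul1r.
have yhat1 : nrm yhat <= 1.
  rewrite nrmZ ger0_norm ?invr_ge0 ?nrm_ge0//.
  have [->|y0] := eqVneq (nrm y) 0; first by rewrite mulr0.
  by rewrite mulVf.
set N := net_size k n0.
pose W := {ffun ('I_d * bool) * bool -> 'I_N.+1}.
pose em := expR (- (c2 * m%:R)) : R.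
have em1 : expR (- m%:R) <= em.
  by rewrite ler_expR lerN2 ler_piMl.
have [||mU1 PU1] := @union_bound _ T R P W (@lat _ N) (fun w => upper_bad a (latv R w)) em.
- by move=> w _; case: (upper_badP ga (latv R w)).
- move=> w _; case: (upper_badP ga (latv R w)) => _ h _.
  by apply: (le_trans h); rewrite lee_fin.
have [mUy PUy Uy] := upper_badP ga yhat.
have [||mU2 PU2] := @union_bound _ T R P _ (@lower_cond R d k n0 yhat)
  (fun wl => lower_bad a yhat wl) em.
- by move=> w lw; case: (lower_badP ga lw).
- by move=> w lw; case: (lower_badP ga lw).
move: mU1 PU1 mU2 PU2.
set U1 := \big[setU/set0]_(w | _) _; set U2 := \big[setU/set0]_(w | _) _ => mU1 PU1 mU2 PU2.
exists (~` (U1 `|` upper_bad a yhat `|` U2)); split.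
- by apply: measurableC; apply: measurableU => //; exact: measurableU.
- rewrite probability_setC; last by apply: measurableU => //; exact: measurableU.
  have La1 := ln_edk_ge1 R kd; set La := ln _ in La1 hm.
  have kLa1 : 1 <= k%:R * La.
    by rewrite -[leLHS]mulr1 ler_pM// ler1n.
  have cardL := card_lattice_le R N kd.
  rewrite (_ : (N%:R + 4 * k%:R) * _ = A * (k%:R * La)) in cardL; last first.
    by rewrite /N /net_size natrM natrX natrM /A -/La; ring.
  have cardC : (#|@lower_cond R d k n0 yhat| <= #|@lat ('I_d * bool)%type N| * n0.+1)%N.
    rewrite -[X in (_ * X)%N]card_ord -cardX; apply: subset_leq_card.
    by apply/fintype.subsetP => -[w l] /and4P[lw _ _ _]; rewrite inE/= andbT.
  have PU : (P (U1 `|` upper_bad a yhat `|` U2) <= (expR (- (c2 / 2 * m%:R)))%:E)%E.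
    apply: (le_trans (measureU2 _ (measurableU _ _ mU1 mUy) mU2)).
    apply: (le_trans (leeD (measureU2 _ mU1 mUy) (lexx _))).
    apply: (le_trans (leeD (leeD PU1 PUy) PU2)).
    rewrite -!EFinD lee_fin.
    set L := #|@lat ('I_d * bool)%type N|%:R in cardL PU1 *.
    have cC : #|@lower_cond R d k n0 yhat|%:R <= L * (n0%:R + 1) :> R.
      by rewrite natr1 -natrM ler_nat.
    set X := expR (A * (k%:R * La)) in cardL.
    have X1 : 1 <= X.
      by rewrite -[leLHS]expR0 ler_expR; apply: mulr_ge0; lra.
    have em0 : 0 <= em by exact: expR_ge0.
    (* One unit for the lattice vectors, one for [yhat], and [n0 + 1] for the pairs. *)
    apply: (@le_trans _ _ ((n0%:R + 3) * X * em)).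
      have h1 : L * em <= X * em by rewrite ler_wpM2r.
      have h2 : #|@lower_cond R d k n0 yhat|%:R * em <= X * (n0%:R + 1) * em.
        rewrite ler_wpM2r//; apply: (le_trans cC); rewrite ler_wpM2r//; lra.
      have h3 : 1 * em <= X * em by rewrite ler_wpM2r.
      lra.
    have n3 : n0%:R + 3 <= expR (ln (n0%:R + 3) * (k%:R * La)).
      rewrite -[leLHS](@lnK R) ?posrE; last by lra.
      by rewrite ler_expR ler_peMr.
    apply: (@le_trans _ _ (expR (ln (n0%:R + 3) * (k%:R * La)) * X * em)).
      by rewrite ler_wpM2r// ler_wpM2r//; lra.
    rewrite /X /em -!expRD ler_expR -mulrDl.
    have : c2 / 2 * (C0 * k%:R * La) <= c2 / 2 * m%:R.
      by rewrite ler_wpM2l//; lra.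
    rewrite /C0 (_ : c2 / 2 * _ = (ln (n0%:R + 3) + A) * (k%:R * La)).
      by lra.
    by field; rewrite gt_eqF.
  by rewrite EFinB; apply: leeB.
- move=> t /= Et h hJ hy h1.
  apply: (@uniform_lower R d m k n0 (upper_const R) (form_gap R) _ y yhat) => //.
  + exact: upper_const_ge0.
  + move=> w lw; have [_ _] := upper_badP ga (latv R w); apply => bad.
    apply: Et; left; left.
    by rewrite /U1 (bigD1 w)//=; left.
  + apply: (@le_trans _ _ (upper_const R * m%:R * dotp yhat yhat)).
      by apply: Uy => bad; apply: Et; left; right.
    rewrite -[leRHS]mulr1 ler_wpM2l//.
      by apply: mulr_ge0 => //; exact: upper_const_ge0.
    by rewrite -sqr_nrm expr_le1// nrm_ge0.
  + move=> w l lw ln p16 r16 pr.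
    have ll : (l < n0.+1)%N by rewrite ltnS.
    have cond : lower_cond yhat (w, Ordinal ll) by apply/and4P.
    have [_ _] := lower_badP ga cond; apply => bad.
    apply: Et; right.
    by rewrite /U2 (bigD1 (w, Ordinal ll))//=; left.
Qed.

(** * Norms of complex matrices and the measurement operator *)

Section ComplexMatrices.
Context (R : realType).
Local Notation C := R[i].
Local Notation normc := (@ComplexField.Normc.normc R).

Lemma normc_sqr (z : C) : normc z ^+ 2 = complex.Re z ^+ 2 + complex.Im z ^+ 2.
Proof. by case: z => x y /=; rewrite sqr_sqrtr// addr_ge0 ?sqr_ge0. Qed.

Lemma normc_ge0 (z : C) : 0 <= normc z.
Proof. by case: z => x y /=; exact: sqrtr_ge0. Qed.

Lemma normcC (c : R) : normc c%:C = `|c|.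
Proof. by rewrite /= expr0n/= addr0 sqrtr_sqr. Qed.

Lemma normc_conj (z : C) : normc (z^*)%R = normc z.
Proof. by case: z => x y; rewrite /= sqrrN. Qed.

Definition rlm p q (M : 'M[C]_(p, q)) (k : ('I_p * 'I_q) * bool) : R :=
  if k.2 then complex.Im (M k.1.1 k.1.2) else complex.Re (M k.1.1 k.1.2).

Lemma dotp_rlm p q (M N : 'M[C]_(p, q)) : dotp (rlm M) (rlm N) =
  \sum_i \sum_j (complex.Re (M i j) * complex.Re (N i j) + complex.Im (M i j) * complex.Im (N i j)).
Proof. by rewrite /dotp sum_coord -big_split/= pair_bigA. Qed.

Lemma norm2E p q (M : 'M[C]_(p, q)) : norm2 M = nrm (rlm M).
Proof.
rewrite /norm2 /nrm dotp_rlm; congr Num.sqrt.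
by apply: eq_bigr => i _; apply: eq_bigr => j _; rewrite normc_sqr !expr2.
Qed.

Lemma rlmD p q (M N : 'M[C]_(p, q)) : rlm (M + N) = rlm M \+ rlm N.
Proof.
apply/funext => -[[i j] b]; rewrite /rlm/= !mxE.
by case: (M i j) => ? ?; case: (N i j) => ? ?; case: b.
Qed.

Lemma rlmZ p q (c : R) (M : 'M[C]_(p, q)) : rlm (c%:C *: M) = c \*o rlm M.
Proof.
apply/funext => -[[i j] b]; rewrite /rlm/= !mxE.
by case: (M i j) => x y; case: b => /=; rewrite mul0r ?addr0 ?subr0.
Qed.

Lemma norm2_ge0 p q (M : 'M[C]_(p, q)) : 0 <= norm2 M.
Proof. exact: sqrtr_ge0. Qed.

Lemma norm2D p q (M N : 'M[C]_(p, q)) : norm2 (M + N) <= norm2 M + norm2 N.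
Proof. by rewrite !norm2E rlmD nrmD. Qed.

Lemma norm2Z p q (c : R) (M : 'M[C]_(p, q)) : norm2 (c%:C *: M) = `|c| * norm2 M.
Proof. by rewrite !norm2E rlmZ nrmZ. Qed.

Lemma norm2_eq0 p q (M : 'M[C]_(p, q)) : norm2 M = 0 -> M = 0.
Proof.
rewrite norm2E => M0; have h : rlm M = fun=> 0.
  by apply/eqP/negP => /negP /nrm_gt0; rewrite M0 ltxx.
apply/matrixP => i j; rewrite mxE; apply/eqP; rewrite eq_complex/=.
have := congr1 (fun f => f ((i, j), false)) h; rewrite /rlm/= => ->.
by have := congr1 (fun f => f ((i, j), true)) h; rewrite /rlm/= => ->; rewrite !eqxx.
Qed.

Lemma norm2_col d (x : 'cV[C]_d) : norm2 x = nrm (rl x).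
Proof.
rewrite /norm2 /nrm /dotp sum_coord -big_split/=; congr Num.sqrt.
by apply: eq_bigr => i _; rewrite big_ord1 normc_sqr !expr2.
Qed.

Lemma norm1_ge0 p q (M : 'M[C]_(p, q)) : 0 <= norm1 M.
Proof. by apply: sumr_ge0 => i _; apply: sumr_ge0 => j _; exact: normc_ge0. Qed.

Lemma norm1D p q (M N : 'M[C]_(p, q)) : norm1 (M + N) <= norm1 M + norm1 N.
Proof.
rewrite /norm1 -big_split/=; apply: ler_sum => i _.
rewrite -big_split/=; apply: ler_sum => j _; rewrite mxE.
exact: le_normcD.
Qed.

Lemma norm1Z p q (c : R) (M : 'M[C]_(p, q)) : norm1 (c%:C *: M) = `|c| * norm1 M.
Proof.
rewrite /norm1 mulr_sumr; apply: eq_bigr => i _.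
rewrite mulr_sumr; apply: eq_bigr => j _.
by rewrite mxE ComplexField.Normc.normcM normcC.
Qed.

(** Cauchy-Schwarz over the [d^2] entries; this is the source of the term [mu d] in the condition on
    [lambda]. *)
Lemma norm1_le_norm2 d (M : 'M[C]_d) : norm1 M <= d%:R * norm2 M.
Proof.
pose f (k : 'I_d * 'I_d) := normc (M k.1 k.2).
have h := dotp_nrm (fun=> 1) f.
have E : dotp (fun=> 1) f = norm1 M.
  by rewrite /dotp /norm1 pair_bigA; apply: eq_bigr => k _; rewrite mul1r.
have E1 : nrm (fun _ : 'I_d * 'I_d => 1 : R) = d%:R.
  rewrite /nrm /dotp sumr_const card_prod card_ord mulr1 natrM -expr2.
  by rewrite sqrtr_sqr ger0_norm.
have E2 : nrm f = norm2 M.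
  by rewrite /nrm /norm2 /dotp pair_bigA; congr Num.sqrt; apply: eq_bigr => k _; rewrite expr2.
by move: h; rewrite E E1 E2 ger0_norm// norm1_ge0.
Qed.

Lemma dotp_rlm_tr d (M N : 'M[C]_d) : dotp (rlm M) (rlm N) = complex.Re (\tr (M ^t* *m N)).
Proof.
rewrite dotp_rlm exchange_big/= /mxtrace raddf_sum/=; apply: eq_bigr => i _.
rewrite mxE raddf_sum/=; apply: eq_bigr => j _; rewrite !mxE.
by case: (M j i) => a b; case: (N j i) => c e /=; rewrite mulNr opprK.
Qed.

Section Qmeas.
Variables (d m : nat) (a : 'I_m -> 'cV[C]_d).

Lemma qmeasE (X : 'M[C]_d) j k : qmeas a X j k = ((a j) ^t* *m X *m a j) 0 0.
Proof. by rewrite mxE. Qed.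

Lemma qmeasD (X Y : 'M[C]_d) : qmeas a (X + Y) = qmeas a X + qmeas a Y.
Proof. by apply/colP => j; rewrite [RHS]mxE !qmeasE mulmxDr mulmxDl mxE. Qed.

Lemma qmeasZ (c : C) (X : 'M[C]_d) : qmeas a (c *: X) = c *: qmeas a X.
Proof. by apply/colP => j; rewrite [RHS]mxE !qmeasE -scalemxAr -scalemxAl mxE. Qed.

(** The supremum in [opnorm] carries information only if its set is bounded above. *)
Lemma has_ubound_qmeas :
  has_ubound [set norm2 (qmeas a X) | X in [set X : 'M[C]_d | norm2 X = 1]].
Proof.
pose B := \sum_j (norm1 (a j)) ^+ 2.
exists (B) => _ [X /= X1 <-].
have Xij i j : normc (X i j) <= 1.
  rewrite -X1 /norm2 -[leLHS]ger0_norm ?normc_ge0// -sqrtr_sqr ler_wsqrtr//.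
  rewrite (bigD1 i)//= (bigD1 j)//= -addrA lerDl addr_ge0//.
    by apply: sumr_ge0 => ? _; exact: sqr_ge0.
  by apply: sumr_ge0 => ? _; apply: sumr_ge0 => ? _; exact: sqr_ge0.
have sumc (I : finType) (F : I -> C) : normc (\sum_i F i) <= \sum_i normc (F i).
  elim/big_rec2 : _ => [|i x y _ h]; first by rewrite ComplexField.Normc.normc0.
  by apply: (le_trans (le_normcD _ _)); rewrite lerD2l.
have entry j : normc ((qmeas a X) j 0) <= norm1 (a j) ^+ 2.
  rewrite mxE mxE; apply: (le_trans (sumc _ _)).
  rewrite /norm1 expr2 mulr_suml; under [leRHS]eq_bigr do rewrite big_ord1 mulr_sumr.
  under [leRHS]eq_bigr do under eq_bigr do rewrite big_ord1.
  rewrite exchange_big/=; apply: ler_sum => l _.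
  rewrite ComplexField.Normc.normcM mxE -mulr_suml ler_wpM2r ?normc_ge0//.
  apply: (le_trans (sumc _ _)); apply: ler_sum => i _.
  rewrite ComplexField.Normc.normcM !mxE normc_conj.
  by rewrite -[leRHS]mulr1 ler_wpM2l ?normc_ge0.
apply: (@le_trans _ _ (norm1 (qmeas a X))).
  rewrite /norm2 -[leRHS]ger0_norm ?norm1_ge0// -sqrtr_sqr ler_wsqrtr//.
  rewrite /norm1; under eq_bigr do rewrite big_ord1; under [in leRHS]eq_bigr do rewrite big_ord1.
  rewrite expr2 mulr_suml; apply: ler_sum => j _; rewrite expr2 ler_wpM2l ?normc_ge0//.
  by rewrite (bigD1 j)//= lerDl sumr_ge0// => ? _; exact: normc_ge0.
by rewrite /norm1; under eq_bigr do rewrite big_ord1; apply: ler_sum => j _; exact: entry.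
Qed.

Lemma norm2_qmeas_le (X : 'M[C]_d) : norm2 (qmeas a X) <= opnorm (qmeas a) * norm2 X.
Proof.
have [X0|X0] := eqVneq (norm2 X) 0.
  have -> : X = 0 by exact: norm2_eq0.
  have -> : qmeas a 0 = 0 by apply/colP => j; rewrite qmeasE mulmx0 mul0mx !mxE.
  have n0 p q : norm2 (0 : 'M[C]_(p, q)) = 0.
    have -> : (0 : 'M[C]_(p, q)) = (0 : R)%:C *: 0 by rewrite scaler0.
    by rewrite norm2Z normr0 mul0r.
  by rewrite !n0 mulr0.
have Xp : 0 < norm2 X by rewrite lt_neqAle eq_sym X0 norm2_ge0.
pose Y := ((norm2 X)^-1)%:C *: X.
have Y1 : norm2 Y = 1 by rewrite norm2Z ger0_norm ?invr_ge0 ?norm2_ge0// mulVf.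
have XE : X = (norm2 X)%:C *: Y by rewrite scalerA -rmorphM divff// scale1r.
rewrite {1}XE qmeasZ norm2Z ger0_norm ?norm2_ge0// mulrC ler_pM2r//.
by apply: ub_le_sup; [exact: has_ubound_qmeas|exists Y].
Qed.

End Qmeas.

(** * Hermitian matrices with a fixed eigenbasis *)

Section Spectral.
Variables (d : nat) (U : 'M[C]_d).
Hypothesis UU : U \is unitarymx.

(* Hermitian matrix with eigenvalues [f], diagonalized by [U] *)
Definition specmx (f : 'I_d -> R) : 'M[C]_d :=
  U ^t* *m diag_mx (\row_i (f i)%:C) *m U.

Let UUt : U *m U ^t* = 1%:M. Proof. exact/unitarymxP. Qed.

Lemma specmxD f g (c : R) : specmx (fun i => f i + c * g i) = specmx f + c%:C *: specmx g.
Proof.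
rewrite /specmx scalemxAl scalemxAr -mulmxDl -mulmxDr.
have -> // : diag_mx (\row_i (f i + c * g i)%:C) =
  diag_mx (\row_i (f i)%:C) + c%:C *: diag_mx (\row_i (g i)%:C).
apply/matrixP => i j; rewrite !mxE rmorphD rmorphM.
by case: (i == j); rewrite ?mulr1n ?mulr0n ?mulr0 ?addr0.
Qed.

Lemma mxtrace_specmx f : complex.Re (\tr (specmx f)) = \sum_i f i.
Proof.
rewrite /specmx -mulmxA mxtrace_mulC -mulmxA UUt mulmx1 mxtrace_diag raddf_sum.
by apply: eq_bigr => i _; rewrite mxE.
Qed.

Lemma specmx_adj f : (specmx f) ^t* = specmx f.
Proof.
rewrite /specmx !trmx_mul !map_mxM/= trmxCK tr_diag_mx map_diag_mx mulmxA.
have -> // : map_mx (@Num.conj C) (\row_i (f i)%:C) = \row_i (f i)%:C.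
by apply/rowP => i; rewrite !mxE; apply/eqP; rewrite eq_complex/= oppr0 !eqxx.
Qed.

Lemma dotp_specmx f g : dotp (rlm (specmx f)) (rlm (specmx g)) = \sum_i f i * g i.
Proof.
rewrite dotp_rlm_tr specmx_adj -mxtrace_specmx; congr (complex.Re (\tr _)).
rewrite /specmx !mulmxA -(mulmxA _ U (U ^t*)) UUt mulmx1 -(mulmxA (U ^t*)).
have -> // : diag_mx (\row_i (f i)%:C) *m diag_mx (\row_i (g i)%:C) =
  diag_mx (\row_i (f i * g i)%:C).
apply/matrixP => i j; rewrite mul_diag_mx !mxE rmorphM.
by case: eqP => [->|_]; rewrite ?mulr1n ?mulr0n ?mulr0.
Qed.

Lemma norm2_specmx f : norm2 (specmx f) = Num.sqrt (\sum_i f i ^+ 2).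
Proof.
by rewrite norm2E /nrm dotp_specmx; congr Num.sqrt; apply: eq_bigr => i _; rewrite expr2.
Qed.

Lemma psd_specmx f : (forall i, 0 <= f i) -> psd (specmx f).
Proof.
move=> f0; split.
  by apply/is_hermitianmxP; rewrite expr0 scale1r specmx_adj.
move=> v; have hv : v ^t* *m U ^t* = (U *m v) ^t* by rewrite trmx_mul map_mxM.
rewrite /specmx !mulmxA hv.
rewrite -mulmxA mxE; apply: sumr_ge0 => i _; rewrite mul_mx_diag !mxE.
rewrite mulrAC mulr_ge0//; last by rewrite ler0c.
by rewrite mulrC; exact: mul_conjC_ge0.
Qed.

Lemma specmx_single f i : (forall j, j != i -> f j = 0) -> 0 <= f i ->
  let x := (Num.sqrt (f i))%:C *: (row i U) ^t* in specmx f = x *m x ^t*.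
Proof.
move=> fj fi x; apply/matrixP => a b.
have conjR (c : R) : (c%:C^*)%R = c%:C :> C.
  by apply/eqP; rewrite eq_complex/= oppr0 !eqxx.
rewrite [RHS]mxE big_ord1 /specmx mul_mx_diag [LHS]mxE (bigD1 i)//= big1 ?addr0.
  rewrite !mxE rmorphM/= conjCK conjR.
  have -> : (f i)%:C = (Num.sqrt (f i))%:C * (Num.sqrt (f i))%:C.
    by rewrite -rmorphM -expr2 sqr_sqrtr.
  by move: ((U i a)^*)%R ((Num.sqrt (f i))%:C) (U i b) => p q r; ring.
by move=> j ji; rewrite !mxE fj// mulr0 mul0r.
Qed.

End Spectral.

(** The spectral theorem provides complex eigenvalues; testing positivity on the conjugated rows of
    [U] shows that they are real and nonnegative. *)
Lemma psd_spectral d (X : 'M[C]_d) : psd X ->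
  exists U : 'M[C]_d, exists f : 'I_d -> R,
  [/\ U \is unitarymx, forall i, 0 <= f i & X = specmx U f].
Proof.
move=> [hX pX].
have UU := spectral_unitarymx X.
have XE := orthomx_spectralP (hermitian_normalmx hX).
pose U := spectralmx X; pose D := spectral_diag X.
have UUt : U *m U ^t* = 1%:M by exact/unitarymxP.
have XE' : X = U ^t* *m diag_mx D *m U by rewrite {1}XE invmx_unitary.
have UXU : U *m X *m U ^t* = diag_mx D.
  by rewrite XE' !mulmxA UUt mul1mx -mulmxA UUt mulmx1.
have D0 i : 0 <= D 0 i.
  have := pX ((row i U) ^t*); rewrite trmxCK -row_mul.
  have -> : (row i (U *m X) *m (row i U) ^t*) 0 0 = (U *m X *m U ^t*) i i.
    rewrite [LHS]mxE [RHS]mxE; apply: eq_bigr => j _.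
    by congr (_ * _); [rewrite mxE|rewrite !mxE].
  by rewrite UXU mxE eqxx mulr1n.
have DE : D = \row_i (complex.Re (D 0 i))%:C.
  apply/rowP => i; rewrite mxE; apply/eqP; rewrite eq_complex/= eqxx/=.
  by have := D0 i; rewrite lecE => /andP[/eqP ->].
exists U, (fun i => complex.Re (D 0 i)); split; first exact: UU.
  by move=> i; have := D0 i; rewrite lecE => /andP[].
by rewrite /specmx -DE.
Qed.

End ComplexMatrices.

(** * Rank-one matrices *)

Section Outer.
Context (R : realType).
Local Notation C := R[i].
Local Notation normc := (@ComplexField.Normc.normc R).

Lemma sqr_mono (u v : R) : 0 <= u -> u <= v -> u ^+ 2 <= v ^+ 2.
Proof. by move=> u0 uv; rewrite ler_pXn2r// nnegrE// (le_trans u0). Qed.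

(** Optimality compared with a step [t] along a direction of norm [N]: [T], [F], [X1], [rho] are the
    trace, Frobenius norm, l1 norm and residual at the minimizer, [om] the operator norm, [D] the
    dimension, and [s], [G], [G1], [Q] belong to the perturbed matrix. *)
Lemma descent_arith (lam T F mu X1 rho s G G1 Q t N2 D N om : R) :
  lam * (T - F) + mu * X1 + 2^-1 * rho ^+ 2 <= lam * (T - s - G) + mu * G1 + 2^-1 * Q ->
  lam * (T - s - G) <= lam * (T - F) - t * (lam * N2) ->
  mu * G1 <= mu * (X1 + t * (D * N)) ->
  Q <= (rho + t * (om * N)) ^+ 2 ->
  t * (lam * N2) <= t * (mu * D * N + rho * om * N + t * (om * N) ^+ 2 / 2).
Proof. by rewrite sqrrD; lra. Qed.

Lemma norm2N p q (M : 'M[C]_(p, q)) : norm2 (- M) = norm2 M.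
Proof.
have -> : - M = (-1)%:C *: M by rewrite rmorphN scaleN1r.
by rewrite norm2Z normrN1 mul1r.
Qed.

Lemma norm2_0 p q : norm2 (0 : 'M[C]_(p, q)) = 0.
Proof.
rewrite norm2E /nrm dotp_rlm big1 ?sqrtr0// => i _; rewrite big1// => j _.
by rewrite !mxE/=; ring.
Qed.

Lemma norm1_0 p q : norm1 (0 : 'M[C]_(p, q)) = 0.
Proof.
by rewrite /norm1 big1// => i _; rewrite big1// => j _; rewrite mxE ComplexField.Normc.normc0.
Qed.

Lemma outerE d (x : 'cV[C]_d) i j : (x *m x ^t*) i j = x i 0 * (x j 0)^*%R.
Proof. by rewrite mxE big_ord1 !mxE. Qed.

Lemma norm1_outer d (x : 'cV[C]_d) : norm1 (x *m x ^t*) = norm1 x ^+ 2.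
Proof.
rewrite /norm1 expr2 mulr_suml; apply: eq_bigr => i _.
rewrite mulr_sumr; apply: eq_bigr => j _.
by rewrite outerE ComplexField.Normc.normcM normc_conj !big_ord1.
Qed.

Lemma norm2_outerM d (x y : 'cV[C]_d) : norm2 (x *m y ^t*) = norm2 x * norm2 y.
Proof.
rewrite /norm2 -sqrtrM; last by apply: sumr_ge0 => i _; apply: sumr_ge0 => j _; exact: sqr_ge0.
congr Num.sqrt; rewrite mulr_suml; apply: eq_bigr => i _.
rewrite big_ord1 mulr_sumr; apply: eq_bigr => j _.
by rewrite big_ord1 [X in normc X]mxE big_ord1 !mxE ComplexField.Normc.normcM normc_conj exprMn.
Qed.

Lemma norm2_outer d (x : 'cV[C]_d) : norm2 (x *m x ^t*) = norm2 x ^+ 2.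
Proof. exact: norm2_outerM. Qed.

Lemma mxtrace_outer d (x : 'cV[C]_d) : complex.Re (\tr (x *m x ^t*)) = norm2 x ^+ 2.
Proof.
rewrite norm2_col sqr_nrm /mxtrace raddf_sum /dotp sum_coord -big_split/=.
apply: eq_bigr => i _; rewrite outerE /rl/=.
by case: (x i 0) => p q /=; rewrite mulrN opprK.
Qed.

Lemma psd_outer d (x : 'cV[C]_d) : psd (x *m x ^t*).
Proof.
have adj : (x *m x ^t*) ^t* = x *m x ^t* by rewrite trmx_mul map_mxM/= trmxCK.
split; first by apply/is_hermitianmxP; rewrite expr0 scale1r adj.
move=> v; have hv : v ^t* *m x = (x ^t* *m v) ^t* by rewrite trmx_mul map_mxM/= trmxCK.
rewrite mulmxA hv -mulmxA mxE big_ord1 !mxE mulrC.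
exact: mul_conjC_ge0.
Qed.

Lemma inner_Re d (x y : 'cV[C]_d) :
  complex.Re ((y ^t* *m x) 0 0) = dotp (rl x) (rl y).
Proof.
rewrite mxE raddf_sum /dotp sum_coord -big_split/=; apply: eq_bigr => i _.
rewrite !mxE /rl/=; case: (x i 0) => p q; case: (y i 0) => r s /=.
by rewrite mulNr opprK (mulrC r) (mulrC s).
Qed.

Lemma inner_Im d (x y : 'cV[C]_d) :
  complex.Im ((y ^t* *m x) 0 0) = - dotp (rlJ (rl x)) (rl y).
Proof.
rewrite mxE raddf_sum /dotp sum_coord opprD -!sumrN -big_split/=.
apply: eq_bigr => i _.
rewrite !mxE /rlJ /rl/=; case: (x i 0) => p q; case: (y i 0) => r s /=.
by ring.
Qed.

Lemma qmeas_outer d m (a : 'I_m -> 'cV[C]_d) (x : 'cV[C]_d) j :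
  qmeas a (x *m x ^t*) j 0 = (re_form (rl x) (rl x) (rl (a j)))%:C.
Proof.
rewrite qmeasE mulmxA -mulmxA.
have -> : x ^t* *m a j = ((a j) ^t* *m x) ^t* by rewrite trmx_mul map_mxM/= trmxCK.
rewrite [LHS]mxE big_ord1 [X in _ * X]mxE [X in _ * (X)^*%R]mxE.
rewrite /re_form -inner_Re -[dotp (rlJ _) _]opprK -inner_Im mulrNN.
move: (((a j) ^t* *m x) 0 0) => -[p q].
by apply/eqP; rewrite eq_complex/=; apply/andP; split; apply/eqP; ring.
Qed.

End Outer.

(** * Minimizers have rank one *)

Section RankOne.
Context (R : realType) (d m : nat).
Local Notation C := R[i].
Variables (a : 'I_m -> 'cV[C]_d) (b : 'cV[C]_m) (lambda mu : R).
Hypotheses (mu0 : 0 < mu).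
Let A := qmeas a.

(** On the two eigenvectors [h] is minus the gradient of [Tr - |.|_F], so the slope of this term
    along [H] is [- |H|^2]. The pair [(f i, f j) / F] lies in the unit disc, and [(1, 1)] is at
    distance [sqrt 2 - 1] from the disc: this is the constant. *)
Lemma spectral_gap (X U : 'M[C]_d) (f : 'I_d -> R) (i j : 'I_d) :
  U \is unitarymx -> X = specmx U f -> (forall l, 0 <= f l) ->
  i != j -> 0 < f i -> 0 < f j -> 0 <= lambda ->
  (forall Y, psd Y -> objective A b lambda mu X <= objective A b lambda mu Y) ->
  lambda * (Num.sqrt 2 - 1) <= mu * d%:R + opnorm A * norm2 (A X - b).
Proof.
move=> UU XE f0 ij fi fj lam0 Xmin.
have F2 : norm2 X ^+ 2 = \sum_l f l ^+ 2.
  by rewrite XE norm2_specmx// sqr_sqrtr// sumr_ge0// => l _; exact: sqr_ge0.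
have Fij : f i ^+ 2 + f j ^+ 2 <= norm2 X ^+ 2.
  rewrite F2 (bigD1 i)//= (bigD1 j)/= 1?eq_sym// lerD2l lerDl sumr_ge0// => l _.
  exact: sqr_ge0.
set F := norm2 X in F2 Fij *.
have F0 : 0 < F.
  rewrite lt_neqAle norm2_ge0 andbT eq_sym; apply/eqP => Fz.
  by move: Fij; rewrite Fz expr0n/=; have := exprn_gt0 2 fi; have := sqr_ge0 (f j); lra.
pose S l := (l == i) || (l == j).
have sumS (G : 'I_d -> R) : \sum_l (if S l then G l else 0) = G i + G j.
  rewrite -big_mkcond (bigD1 i)/=; last by rewrite /S eqxx.
  rewrite (bigD1 j)/=; last by rewrite /S eqxx orbT eq_sym.
  rewrite big1 ?addr0// => l /andP[/andP[]]; rewrite /S => /orP[/eqP->|/eqP->].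
    by rewrite eqxx.
  by move=> _; rewrite eqxx.
pose h l := if S l then - (1 - f l / F) else 0.
pose H := specmx U h.
have fF l : f l / F <= 1.
  rewrite ler_pdivrMr// mul1r -(@ler_pXn2r _ 2)// ?nnegrE ?(ltW F0)// F2.
  by rewrite (bigD1 l)//= lerDl sumr_ge0// => ? _; exact: sqr_ge0.
set p := 1 - f i / F; set q := 1 - f j / F.
have H2 : norm2 H ^+ 2 = p ^+ 2 + q ^+ 2.
  rewrite norm2_specmx// sqr_sqrtr; last by apply: sumr_ge0 => l _; exact: sqr_ge0.
  rewrite -(sumS (fun l => (1 - f l / F) ^+ 2)); apply: eq_bigr => l _.
  by rewrite /h; case: ifP => _; rewrite ?sqrrN ?expr0n.
(* The distance from [(1, 1)] to [(u, v)], with [k] the length of [(u, v)]: Cauchy-Schwarz gives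
   [u + v <= sqrt 2 * k], so it is at least [sqrt 2 - k]. *)
have H2' : norm2 H ^+ 2 >= (Num.sqrt 2 - 1) ^+ 2.
  have s2 := sqr_sqrtr (ler0n R 2); have s20 := sqrtr_ge0 (2 : R).
  rewrite H2 /p /q; set u := f i / F; set v := f j / F.
  have uv : u ^+ 2 + v ^+ 2 <= 1.
    by rewrite /u /v !expr_div_n -mulrDl ler_pdivrMr ?exprn_gt0// mul1r.
  have u0 : 0 <= u by rewrite divr_ge0// ltW.
  have v0 : 0 <= v by rewrite divr_ge0// ltW.
  pose k := Num.sqrt (u ^+ 2 + v ^+ 2).
  have k2 : k ^+ 2 = u ^+ 2 + v ^+ 2 by rewrite sqr_sqrtr// addr_ge0 ?sqr_ge0.
  have k0 : 0 <= k by exact: sqrtr_ge0.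
  have k1 : k <= 1 by rewrite -(@ler_pXn2r _ 2)// ?nnegrE// k2 expr1n.
  have uvk : u + v <= Num.sqrt 2 * k.
    have : (u + v) ^+ 2 <= (Num.sqrt 2 * k) ^+ 2.
      by rewrite exprMn s2 k2; have := sqr_ge0 (u - v); lra.
    by rewrite ler_pXn2r// nnegrE; [exact: addr_ge0|exact: mulr_ge0].
  have s21 : 1 <= Num.sqrt 2 :> R by rewrite -(@ler_pXn2r _ 2)// ?nnegrE// s2 expr1n ler1n.
  have : (Num.sqrt 2 - 1) ^+ 2 <= (Num.sqrt 2 - k) ^+ 2.
    by rewrite lerXn2r ?nnegrE//; lra.
  move: s2 k2 uvk; rewrite !sqrrB; lra.
set N := norm2 H in H2 H2' *.
have N0 : 0 <= N by exact: norm2_ge0.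
have s21 : 0 < Num.sqrt 2 - 1 :> R.
  by rewrite subr_gt0 -(@ltr_pXn2r _ 2)// ?nnegrE// sqr_sqrtr// expr1n ltr1n.
have Nge : Num.sqrt 2 - 1 <= N by rewrite -(@ler_pXn2r _ 2)// ?nnegrE// ltW.
have Np : 0 < N by apply: lt_le_trans Nge.
set om := opnorm A; set rho := norm2 (A X - b).
have rho0 : 0 <= rho by exact: norm2_ge0.
have om0 : 0 <= om.
  have := le_trans (norm2_ge0 _) (norm2_qmeas_le a X); rewrite -/A -/om -/F.
  by rewrite pmulr_lge0.
have step t : 0 < t -> t <= f i -> t <= f j ->
    lambda * N ^+ 2 <= mu * d%:R * N + rho * om * N + t * (om * N) ^+ 2 / 2.
  move=> t0 ti tj.
  pose g l := f l + t * h l.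
  have g0 l : 0 <= g l.
    rewrite /g /h; case: ifP => [Sl|_]; last by rewrite mulr0 addr0.
    have fl : t <= f l by move: Sl => /orP[/eqP->|/eqP->].
    have : 0 <= t * (f l / F) by rewrite mulr_ge0 ?(ltW t0)// divr_ge0// ltW.
    by lra.
  have YE : specmx U g = X + t%:C *: H by rewrite XE -specmxD.
  have := Xmin _ (psd_specmx U g0); rewrite /objective; rewrite [in A (specmx U g)]YE.
  have trY : complex.Re (\tr (specmx U g)) = complex.Re (\tr X) - t * (p + q).
    have -> : complex.Re (\tr X) = \sum_l f l by rewrite XE (mxtrace_specmx UU).
    rewrite (mxtrace_specmx UU) /g (big_split _ _ _ f) -mulr_sumr.
    by rewrite (sumS (fun l => - (1 - f l / F))) -opprD mulrN.
  (* Convexity of the Frobenius norm: it lies above its tangent at [X], obtained by pairing with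
     [X]. *)
  have nY : F - t * (p * (f i / F) + q * (f j / F)) <= norm2 (specmx U g).
    rewrite -(ler_pM2r F0); apply: le_trans (_ : dotp (rlm (specmx U g)) (rlm X) <= _); last first.
      by rewrite /F !norm2E; apply: le_trans (ler_norm _) (dotp_nrm _ _).
    rewrite XE dotp_specmx// /g; under eq_bigr do rewrite mulrDl -mulrA.
    rewrite big_split/= -mulr_sumr.
    have -> : \sum_l f l * f l = F ^+ 2 by rewrite F2; apply: eq_bigr => l _; rewrite expr2.
    have -> : \sum_l h l * f l = - (p * f i) - q * f j.
      rewrite -(sumS (fun l => - ((1 - f l / F) * f l))); apply: eq_bigr => l _.
      by rewrite /h; case: ifP => _; rewrite ?mulNr ?mul0r.
    by rewrite le_eqVlt; apply/orP; left; apply/eqP; field; rewrite gt_eqF.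
  have n1Y : norm1 (specmx U g) <= norm1 X + t * (d%:R * N).
    rewrite YE; apply: (le_trans (norm1D _ _)); rewrite lerD2l norm1Z gtr0_norm// ler_pM2l//.
    exact: norm1_le_norm2.
  have rY : norm2 (A (X + t%:C *: H) - b) <= rho + t * (om * N).
    have -> : A (X + t%:C *: H) - b = (A X - b) + t%:C *: A H.
      by rewrite /A qmeasD qmeasZ addrAC.
    apply: (le_trans (norm2D _ _)); rewrite lerD2l norm2Z gtr0_norm// ler_pM2l//.
    exact: norm2_qmeas_le.
  have rY2 : norm2 (A (X + t%:C *: H) - b) ^+ 2 <= (rho + t * (om * N)) ^+ 2.
    exact: sqr_mono (norm2_ge0 _) rY.
  rewrite trY => hmin.
  have hn : lambda * (complex.Re (\tr X) - t * (p + q) - norm2 (specmx U g)) <=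
     lambda * (complex.Re (\tr X) - F) - t * (lambda * N ^+ 2).
    have -> : lambda * (complex.Re (\tr X) - F) - t * (lambda * N ^+ 2) =
       lambda * (complex.Re (\tr X) - t * (p + q) - (F - t * (p * (f i / F) + q * (f j / F)))).
      by rewrite H2 /p /q; ring.
    by rewrite ler_wpM2l// lerD2l lerN2.
  have hm := ler_wpM2l (ltW mu0) n1Y.
  rewrite -(ler_pM2l t0); exact: descent_arith hmin hn hm rY2.
have lamN2 : lambda * N ^+ 2 <= mu * d%:R * N + rho * om * N.
  rewrite leNgt; apply/negP => lt.
  set e := lambda * N ^+ 2 - (mu * d%:R * N + rho * om * N).
  have e0 : 0 < e by rewrite subr_gt0.
  have D0 : 0 < (om * N) ^+ 2 + 1 by have := sqr_ge0 (om * N); lra.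
  (* In place of the limit [t -> 0], a step so small that the quadratic term stays below the excess
     [e] and the eigenvalues stay nonnegative. The [+ 1] keeps the denominator positive. *)
  pose t := Num.min (e / ((om * N) ^+ 2 + 1)) (Num.min (f i) (f j)).
  have t0 : 0 < t by rewrite !lt_min fi fj divr_gt0.
  have ti : t <= f i by rewrite !ge_min lexx/= orbT.
  have tj : t <= f j by rewrite !ge_min lexx/= !orbT.
  have te : t * ((om * N) ^+ 2 + 1) <= e.
    by rewrite -ler_pdivlMr// /t ge_min lexx.
  have := step t t0 ti tj; move: te; rewrite mulrDr mulr1 /e.
  have : 0 <= t * (om * N) ^+ 2 by rewrite mulr_ge0 ?sqr_ge0// ltW.
  lra.
apply: (@le_trans _ _ (lambda * N)); first by rewrite ler_wpM2l.
rewrite -(ler_pM2r Np); move: lamN2; rewrite expr2; lra.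
Qed.

(** Comparison with [x0 x0^*], where [Tr - |.|_F] vanishes, bounds the value at [X]. The assumption
    on [b] says that the zero matrix has a larger value, so [X] is not zero. *)
Lemma minimizer_outer (x0 : 'cV[C]_d) (wC : 'cV[C]_m) (X : 'M[C]_d) :
  b = A (x0 *m x0 ^t*) + wC ->
  mu * norm1 x0 ^+ 2 + 2^-1 * norm2 wC ^+ 2 < 2^-1 * norm2 b ^+ 2 ->
  (mu * d%:R + opnorm A * (Num.sqrt (2 * mu) * norm1 x0 + norm2 wC))
    / (Num.sqrt 2 - 1) < lambda ->
  global_minimizer [set Y | psd Y] (objective A b lambda mu) X ->
  [/\ \rank X = 1%N, exists x : 'cV[C]_d, X = x *m x ^t* &
    mu * norm1 X + 2^-1 * norm2 (A X - b) ^+ 2 <=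
    mu * norm1 x0 ^+ 2 + 2^-1 * norm2 wC ^+ 2].
Proof.
move=> bE hb hlam [pX Xmin].
have fx0 : objective A b lambda mu X <= mu * norm1 x0 ^+ 2 + 2^-1 * norm2 wC ^+ 2.
  apply: (le_trans (Xmin _ (psd_outer x0))).
  rewrite /objective mxtrace_outer norm2_outer subrr mulr0 add0r norm1_outer.
  by rewrite bE opprD addrA subrr add0r norm2N.
have Xn0 : X != 0.
  apply/eqP => X0; move: fx0; rewrite X0 /objective mxtrace0 norm2_0 norm1_0 subrr !mulr0 add0r.
  rewrite add0r (_ : A 0 = 0); last by apply/colP => j; rewrite qmeasE mulmx0 mul0mx !mxE.
  by rewrite sub0r norm2N; move: hb; lra.
have Xp : 0 < norm2 X.
  by rewrite lt_neqAle norm2_ge0 andbT eq_sym; apply: contra Xn0 => /eqP/norm2_eq0/eqP.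
have om0 : 0 <= opnorm A.
  by have := le_trans (norm2_ge0 _) (norm2_qmeas_le a X); rewrite -/A pmulr_lge0.
have [U [f [UU f0 XE]]] := psd_spectral pX.
have trF : norm2 X <= complex.Re (\tr X).
  have sf0 : 0 <= \sum_i f i by apply: sumr_ge0.
  rewrite XE norm2_specmx// mxtrace_specmx// -[leRHS]ger0_norm// -sqrtr_sqr ler_wsqrtr//.
  rewrite expr2 mulr_suml; apply: ler_sum => i _; rewrite expr2 ler_wpM2l//.
  by rewrite (bigD1 i)//= lerDl sumr_ge0.
have s21 : 0 < Num.sqrt 2 - 1 :> R.
  by rewrite subr_gt0 -(@ltr_pXn2r _ 2)// ?nnegrE// sqr_sqrtr// expr1n ltr1n.
have n10 := norm1_ge0 x0; have W0 := norm2_ge0 wC; have n1X := norm1_ge0 X.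
have sm0 := sqrtr_ge0 (2 * mu).
set K := Num.sqrt (2 * mu) * norm1 x0 + norm2 wC in hlam.
have K0 : 0 <= K by rewrite addr_ge0// mulr_ge0.
have num0 : 0 <= mu * d%:R + opnorm A * K.
  by apply: addr_ge0; apply: mulr_ge0 => //; exact: ltW.
have lam0 : 0 <= lambda.
  by apply/ltW/(le_lt_trans _ hlam); apply: divr_ge0 => //; exact: ltW.
have lamtr : 0 <= lambda * (complex.Re (\tr X) - norm2 X) by rewrite mulr_ge0// subr_ge0.
have value : mu * norm1 X + 2^-1 * norm2 (A X - b) ^+ 2 <=
    mu * norm1 x0 ^+ 2 + 2^-1 * norm2 wC ^+ 2.
  by move: fx0; rewrite /objective; lra.
(* [K^2] expands to [2 mu |x0|_1^2 + |w|^2] plus a nonnegative cross term; this is how the bracket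
   in the condition on [lambda] arises. *)
have residual : norm2 (A X - b) <= K.
  rewrite -(@ler_pXn2r _ 2)// ?nnegrE ?norm2_ge0//.
  have mX : 0 <= mu * norm1 X by rewrite mulr_ge0// ltW.
  have : 0 <= Num.sqrt (2 * mu) * norm1 x0 * norm2 wC by rewrite !mulr_ge0.
  have mu20 : 0 <= 2 * mu by rewrite mulr_ge0// ltW.
  rewrite /K sqrrD exprMn (sqr_sqrtr mu20).
  move: value; lra.
have [i fi] : exists i, 0 < f i.
  apply/not_existsP => fn; move: Xn0; rewrite XE => /eqP; apply.
  apply: norm2_eq0; rewrite norm2_specmx// big1 ?sqrtr0// => i _.
  have /negP := fn i; rewrite -leNgt => fi; apply/eqP.
  by rewrite sqrf_eq0 eq_le fi f0.
have fz j : j != i -> f j = 0.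
  move=> ji; apply/eqP; rewrite eq_le f0 andbT leNgt; apply/negP => fj.
  have := @spectral_gap X U f j i UU XE f0 ji fj fi lam0 Xmin.
  move: hlam; rewrite ltr_pdivrMr//.
  have := ler_wpM2l om0 residual; lra.
have [x Xx] : exists x : 'cV[C]_d, X = x *m x ^t*.
  by exists ((Num.sqrt (f i))%:C *: (row i U) ^t*); rewrite XE; exact: specmx_single.
split=> //; last by exists x.
apply/eqP; rewrite eqn_leq lt0n mxrank_eq0 Xn0 andbT.
by rewrite Xx; apply: (leq_trans (mxrankM_maxl _ _)); exact: rank_leq_col.
Qed.

End RankOne.

(** * From the uniform lower bound to the error estimate *)

Section Recovery.
Context (R : realType).
Local Notation C := R[i].
Local Notation normc := (@ComplexField.Normc.normc R).

Lemma sum_support_le (I : finType) (S : {set I}) (f : I -> R) (n : nat) :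
  (#|S| <= n)%N -> \sum_(i in S) f i <= Num.sqrt n%:R * nrm f.
Proof.
move=> Sn; pose s i : R := (i \in S)%:R.
have -> : \sum_(i in S) f i = dotp s f.
  rewrite /dotp big_mkcond; apply: eq_bigr => i _; rewrite /s.
  by case: ifP => _; rewrite ?mul1r ?mul0r.
apply: (le_trans (ler_norm _)); apply: (le_trans (dotp_nrm _ _)).
rewrite ler_wpM2r ?nrm_ge0// /nrm ler_wsqrtr//.
rewrite (_ : dotp s s = #|S|%:R) ?ler_nat// /dotp -sum1_card natr_sum [RHS]big_mkcond.
by apply: eq_bigr => i _; rewrite /s; case: ifP => _; rewrite ?mul1r ?mul0r.
Qed.

Lemma normcB_le (u v : C) : normc u <= normc v + normc (u - v).
Proof. by rewrite -{1}(subrK v u) addrC; exact: le_normcD. Qed.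

Lemma norm2_normc p q (M : 'M[C]_(p, q)) :
  norm2 M = nrm (fun k : 'I_p * 'I_q => normc (M k.1 k.2)).
Proof.
by rewrite /norm2 /nrm /dotp pair_bigA; congr Num.sqrt; apply: eq_bigr => k _; rewrite expr2.
Qed.

Lemma norm2_normc_col d (x : 'cV[C]_d) : norm2 x = nrm (fun i => normc (x i 0)).
Proof.
by rewrite /norm2 /nrm /dotp; congr Num.sqrt; apply: eq_bigr => i _; rewrite big_ord1 expr2.
Qed.

Lemma norm1_col d (x : 'cV[C]_d) : norm1 x = \sum_i normc (x i 0).
Proof. by apply: eq_bigr => i _; rewrite big_ord1. Qed.

Lemma norm2_le_norm1 p q (M : 'M[C]_(p, q)) : norm2 M <= norm1 M.
Proof.
rewrite /norm2 -[leRHS]ger0_norm ?norm1_ge0// -sqrtr_sqr ler_wsqrtr//.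
rewrite /norm1 !pair_bigA/= expr2 mulr_suml; apply: ler_sum => k _.
rewrite expr2 ler_wpM2l ?normc_ge0// (bigD1 k)//= lerDl sumr_ge0// => ? _.
exact: normc_ge0.
Qed.

(** [3 / 2] is a rational upper bound for [sqrt 2], the price of splitting a complex number into its
    real and imaginary parts. *)
Lemma sum_rl_le d (x : 'cV[C]_d) : \sum_i `|rl x i| <= 3 / 2 * norm1 x.
Proof.
rewrite sum_coord -big_split/= norm1_col mulr_sumr; apply: ler_sum => i _.
rewrite /rl/=; have := normc_sqr (x i 0); have := normc_ge0 (x i 0).
set n := normc _; case: (x i 0) => p q /=; move=> n0 nE.
have h : (`|p| + `|q|) ^+ 2 <= (3 / 2 * n) ^+ 2.
  rewrite exprMn nE sqrrD !real_normK ?num_real//.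
  have := sqr_ge0 (`|p| - `|q|); rewrite sqrrB !real_normK ?num_real//.
  have := sqr_ge0 p; have := sqr_ge0 q; lra.
have n0' : 0 <= 3 / 2 * n by lra.
by rewrite -(@ler_pXn2r _ 2)// ?nnegrE// addr_ge0.
Qed.

(** Off the support of [x0] the difference equals [x], whose l1 norm there is at most that of the
    difference on the support, plus [tau]. The support part is at most [sqrt k] times the l2
    norm. *)
Lemma support_cone d (k : nat) (x x0 : 'cV[C]_d) (tau : R) :
  (norm0 x0 <= k)%N -> norm1 x <= norm1 x0 + tau ->
  norm1 (x - x0) <= 2 * Num.sqrt k%:R * norm2 (x - x0) + tau.
Proof.
rewrite /norm0; set S : {set 'I_d} := [set i | x0 i 0 != 0]%SET => Sk.
rewrite !norm1_col norm2_normc_col.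
have := sum_support_le (fun i => normc ((x - x0) i 0)) Sk.
set N := nrm _.
rewrite !(bigID (mem S) predT)/=.
set hS := \sum_(i in S) _; set xC := \sum_(i | i \notin S) _.
set xS := \sum_(i in S) _; set yC := \sum_(i | i \notin S) _.
set yS := \sum_(i in S) _; set hC := \sum_(i | i \notin S) _.
have yC0 : yC = 0.
  apply: big1 => i; rewrite inE negbK => /eqP ->.
  exact: ComplexField.Normc.normc0.
have hxC : hC = xC.
  by apply: eq_bigr => i; rewrite inE negbK => /eqP x0i; rewrite !mxE x0i subr0.
have hxS : yS <= xS + hS.
  rewrite /yS /xS /hS -big_split; apply: ler_sum => i _.
  rewrite !mxE -opprB.
  have -> : normc (- (x0 i 0 - x i 0)) = normc (x0 i 0 - x i 0) by exact: normcN.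
  exact: normcB_le.
by move: (Num.sqrt _) => s; lra.
Qed.

Lemma norm2_outerB d (x x0 : 'cV[C]_d) :
  norm2 (x *m x ^t* - x0 *m x0 ^t*) <= norm2 (x - x0) * (norm2 x + norm2 x0).
Proof.
have -> : x *m x ^t* - x0 *m x0 ^t* = x *m (x - x0) ^t* + (x - x0) *m x0 ^t*.
  by rewrite linearB/= map_mxB mulmxBr mulmxBl addrA subrK.
by apply: (le_trans (norm2D _ _)); rewrite !norm2_outerM mulrDr (mulrC (norm2 x)).
Qed.

(** [x0 x0^*] lives on at most [k^2] entries, whence the factor [sqrt (k^2) = k]; off these entries
    [X] only helps. *)
Lemma norm1_sparse_outerB d (k : nat) (x0 : 'cV[C]_d) (X : 'M[C]_d) : (norm0 x0 <= k)%N ->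
  norm1 x0 ^+ 2 - norm1 X <= k%:R * norm2 (X - x0 *m x0 ^t*).
Proof.
rewrite -norm1_outer; set X0 := x0 *m x0 ^t*.
rewrite /norm0; set S : {set 'I_d} := [set i | x0 i 0 != 0]%SET => Sk.
have Sk2 : (#|finset.setX S S| <= k ^ 2)%N by rewrite cardsX leq_mul.
have := sum_support_le (fun p => normc ((X - X0) p.1 p.2)) Sk2.
rewrite -norm2_normc natrX sqrtr_sqr ger0_norm//; apply: le_trans.
rewrite /norm1 !pair_bigA/= !(bigID (mem (finset.setX S S)) predT)/=.
set u := \sum_(p | p \notin _) normc (X0 _ _).
have -> : u = 0.
  apply: big1 => -[i j]; rewrite finset.in_setX !inE negb_and !negbK /= /X0 outerE => /orP[]/eqP->.
    by rewrite mul0r ComplexField.Normc.normc0.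
  by rewrite conjC0 mulr0 ComplexField.Normc.normc0.
set v := \sum_(p | p \notin _) _.
have v0 : 0 <= v by apply: sumr_ge0 => p _; exact: normc_ge0.
suff : \sum_(p in finset.setX S S) normc (X0 p.1 p.2) <=
    \sum_(p in finset.setX S S) normc (X p.1 p.2) +
    \sum_(p in finset.setX S S) normc ((X - X0) p.1 p.2) by lra.
rewrite -big_split; apply: ler_sum => p _.
have -> : (X - X0) p.1 p.2 = - (X0 p.1 p.2 - X p.1 p.2).
  by rewrite mxE [X in _ + X]mxE opprB.
rewrite normcN; exact: normcB_le.
Qed.

Lemma outer_phase d (x x0 : 'cV[C]_d) : exists x' : 'cV[C]_d,
  [/\ x' *m x' ^t* = x *m x ^t*, dotp (rlJ (rl x')) (rl x0) = 0 &
      0 <= dotp (rl x') (rl x0)].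
Proof.
pose z := (x0 ^t* *m x) 0 0.
have [om [om1 omz]] : exists om : C, om * om^* = 1 /\ 0 <= om * z.
  have [z0|z0] := eqVneq z 0.
    by exists 1; rewrite z0 mulr0 conjC1 mulr1.
  (* The phase that turns the inner product [z] into its modulus. *)
  exists (z^*%R / `|z|); split; last first.
    by rewrite mulrAC (mulrC _ z) -normCK expr2 mulfK ?normr_eq0.
  rewrite rmorphM/= conjCK fmorphV/= conj_normC mulrACA -invfM (mulrC _ z) -normCK expr2.
  by rewrite divff// mulf_neq0 ?normr_eq0.
exists (om *: x).
have zE : (x0 ^t* *m (om *: x)) 0 0 = om * z by rewrite -scalemxAr mxE.
split.
- by rewrite linearZ/= map_mxZ -scalemxAl -scalemxAr scalerA om1 scale1r.
- apply/eqP; rewrite -oppr_eq0 -inner_Im zE.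
  by move: omz; rewrite lecE => /andP[/eqP->].
- by rewrite -inner_Re zE; move: omz; rewrite lecE => /andP[].
Qed.

Lemma qmeasB d m (a : 'I_m -> 'cV[C]_d) (X Y : 'M[C]_d) :
  qmeas a (X - Y) = qmeas a X - qmeas a Y.
Proof.
by apply/colP => j; rewrite [RHS]mxE [X in _ = _ + X]mxE !qmeasE mulmxBr mulmxBl mxE [X in _ + X = _]mxE.
Qed.

Lemma qmeas_outerB d m (a : 'I_m -> 'cV[C]_d) (x x0 : 'cV[C]_d) j :
  let h := rl x \- rl x0 in
  (qmeas a (x *m x ^t* - x0 *m x0 ^t*)) j 0 =
  (re_form h ((2 \*o rl x0) \+ h) (rl (a j)))%:C.
Proof.
move=> h; rewrite qmeasB.
have hx := qmeas_outer a x j; have hx0 := qmeas_outer a x0 j.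
rewrite mxE [X in _ + X]mxE (congr2 (fun u v : C => u - v) hx hx0).
rewrite -[LHS](rmorphB (real_complex R)).
congr (_%:C); rewrite /re_form /h !rlJE !dotpE; ring.
Qed.

(** Cauchy-Schwarz over the [m] measurements, the source of [1 / sqrt m] in the error bound. *)
Lemma abs_form_norm2 d m (a : 'I_m -> 'cV[C]_d) (x x0 : 'cV[C]_d) :
  abs_form (fun j => rl (a j)) (rl x \- rl x0)
    ((2 \*o rl x0) \+ (rl x \- rl x0)) <=
  Num.sqrt m%:R * norm2 (qmeas a (x *m x ^t* - x0 *m x0 ^t*)).
Proof.
set h := rl x \- rl x0; rewrite norm2_normc_col.
rewrite (_ : (fun i => _) = fun j => `|re_form h ((2 \*o rl x0) \+ h) (rl (a j))|); last first.
  by apply/funext => j; rewrite qmeas_outerB normcC.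
rewrite /abs_form (eq_bigl (fun j => j \in [set: 'I_m]%SET)); last first.
  by move=> j; rewrite finset.in_setT.
by apply: (@sum_support_le _ [set: 'I_m]%SET); rewrite cardsT card_ord.
Qed.

Lemma rlB d (x x0 : 'cV[C]_d) : rl (x - x0) = rl x \- rl x0.
Proof.
apply/funext => -[i []]; rewrite /rl/= !mxE; by case: (x i 0) => ? ?; case: (x0 i 0).
Qed.

Lemma bound_collect (u v x y z a b : R) : 0 <= u -> 0 <= v -> 0 <= x -> 0 <= y ->
  0 <= a -> 0 <= b -> a + b <= z -> v * a + u * b <= (1 + u + v) * (x + y + z).
Proof.
move=> u0 v0 x0 y0 a0 b0 abz.
have h1 : v * a <= v * (x + y + z) by rewrite ler_wpM2l//; lra.
have h2 : u * b <= u * (x + y + z) by rewrite ler_wpM2l//; lra.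
lra.
Qed.

(* Here [p ^ 2 = mu], [q ^ 2 = k], [r ^ 2 = m]; [F], [Y], [rho] are the norms of the
   error, of its measurements and of the residual. *)
Lemma recovery_arith (p q r c F Y rho W n n0 e N N0 : R) :
  0 < p -> 0 < q -> 0 < r -> 0 < c ->
  0 <= Y -> 0 <= rho -> 0 <= W -> 0 <= n -> 0 <= n0 -> 0 <= e -> 0 <= N0 ->
  N <= N0 + e -> N <= n -> N0 <= n0 -> F <= e * (N + N0) ->
  n0 ^+ 2 - n ^+ 2 <= q ^+ 2 * F ->
  p ^+ 2 * n ^+ 2 + 2^-1 * rho ^+ 2 <= p ^+ 2 * n0 ^+ 2 + 2^-1 * W ^+ 2 ->
  W <= rho + Y -> Y <= rho + W ->
  (n <= n0 + W / p -> W / p <= 2 * q * e -> c * r ^+ 2 * (e * (N0 + e)) <= r * Y) ->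
  F <= (1 + 4 / c + 8 / c ^+ 2) * (W / (p * q) * (n0 + W / p)
    + W ^+ 2 / (2 * p ^+ 2 * q ^+ 2)
    + p ^+ 2 * q ^+ 2 * (W / (p ^+ 2 * q ^+ 2) + r^-1) ^+ 2).
Proof.
move=> p0 q0 r0 c0 Y0 rho0 W0 n_0 n00 e0 N00 NN Nn N0n0 FH sparse basic Wrho Yrho V.
have pn : n <= n0 + W / p.
  rewrite -(ler_pM2l p0) mulrDr mulrCA divff ?gt_eqF// mulr1.
  have a0 : 0 <= p * n by rewrite mulr_ge0// ltW.
  have b0 : 0 <= p * n0 by rewrite mulr_ge0// ltW.
  rewrite -(@ler_pXn2r _ 2)// ?nnegrE ?addr_ge0// sqrrD !exprMn.
  have := mulr_ge0 b0 W0; have := sqr_ge0 rho; have := sqr_ge0 W; lra.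
have Wp0 : 0 <= W / p by rewrite divr_ge0// ltW.
have D0 : 0 <= 4 / c by rewrite divr_ge0// ltW.
have D20 : 0 <= 8 / c ^+ 2 by rewrite divr_ge0// sqr_ge0.
have pq0 : 0 < p * q by exact: mulr_gt0.
have pq20 : 0 < p ^+ 2 * q ^+ 2 by rewrite mulr_gt0// exprn_gt0.
have T10 : 0 <= W / (p * q) * (n0 + W / p).
  by rewrite mulr_ge0 ?addr_ge0// divr_ge0// ltW.
have T20 : 0 <= W ^+ 2 / (2 * p ^+ 2 * q ^+ 2).
  by rewrite divr_ge0 ?sqr_ge0// -mulrA mulr_ge0// ltW.
have T30 : 0 <= p ^+ 2 * q ^+ 2 * (W / (p ^+ 2 * q ^+ 2) + r^-1) ^+ 2.
  by apply: mulr_ge0; [exact: ltW|exact: sqr_ge0].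
have T3 : p ^+ 2 * q ^+ 2 / r ^+ 2 + W / r <=
    p ^+ 2 * q ^+ 2 * (W / (p ^+ 2 * q ^+ 2) + r^-1) ^+ 2.
  have -> : p ^+ 2 * q ^+ 2 * (W / (p ^+ 2 * q ^+ 2) + r^-1) ^+ 2 =
      W ^+ 2 / (p ^+ 2 * q ^+ 2) + 2 * (W / r) + p ^+ 2 * q ^+ 2 / r ^+ 2.
    by field; rewrite !gt_eqF.
  have : 0 <= W ^+ 2 / (p ^+ 2 * q ^+ 2) by rewrite divr_ge0 ?sqr_ge0// ltW.
  have : 0 <= W / r by rewrite divr_ge0// ltW.
  lra.
have b0 : 0 <= W / r by rewrite divr_ge0// ltW.
have a0 : 0 <= p ^+ 2 * q ^+ 2 / r ^+ 2 by rewrite divr_ge0 ?sqr_ge0// ltW.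
(* If the noise level [W / p] dominates [2 q e], the error is bounded directly by the first term,
   without the measurements. Otherwise the difference satisfies the cone condition and [V]
   applies. *)
have [le1|gt1] := leP (2 * q * e) (W / p).
  have FT : F <= W / (p * q) * (n0 + W / p).
    have e2 : e <= W / (p * q) / 2.
      rewrite ler_pdivlMr// invfM mulrA ler_pdivlMr//; lra.
    apply: (le_trans FH).
    apply: (@le_trans _ _ (W / (p * q) / 2 * (2 * (n0 + W / p)))); last first.
      by rewrite le_eqVlt; apply/orP; left; apply/eqP; field; rewrite !gt_eqF.
    apply: (@le_trans _ _ (e * (2 * (n0 + W / p)))).
      by apply: ler_wpM2l => //; lra.
    by apply: ler_wpM2r => //; lra.
  apply: (le_trans FT); rewrite -[leLHS]mul1r.
  apply: ler_pM => //; lra.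
have {}V : c * r * F <= 2 * Y.
  have := V pn (ltW gt1).
  rewrite (_ : c * r ^+ 2 * _ = r * (c * r * (e * (N0 + e)))); last by ring.
  rewrite ler_pM2l// => V'.
  apply: (@le_trans _ _ (2 * (c * r * (e * (N0 + e))))); last by rewrite ler_pM2l.
  have : c * r * F <= c * r * (2 * (e * (N0 + e))).
    rewrite ler_pM2l; last exact: mulr_gt0.
    apply: (le_trans FH); have := ler_wpM2l e0 NN; have := mulr_ge0 e0 e0; lra.
  by move: (e * _) => z; lra.
have YW : (Y - W) ^+ 2 <= rho ^+ 2.
  by rewrite -ler_sqrt ?sqr_ge0// !sqrtr_sqr (ger0_norm rho0) ler_norml; lra.
(* Optimality bounds [rho^2 - W^2] by [2 p^2 (n0^2 - n^2)], and sparsity bounds this by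
   [2 p^2 q^2 F]; expanding [(Y - W)^2 <= rho^2] cancels [W^2]. *)
have YF : Y ^+ 2 <= 2 * (p ^+ 2 * (q ^+ 2 * F)) + 2 * (Y * W).
  have := ler_wpM2l (sqr_ge0 p) sparse; move: YW; rewrite sqrrB; lra.
have cr0 : 0 < c * r by exact: mulr_gt0.
(* Inserting [V] makes every term of [YF] a multiple of [Y], so one factor [Y] cancels; a second use
   of [V] then returns to [F]. *)
have crY : c * r * Y <= 4 * (p ^+ 2 * q ^+ 2) + 2 * (c * r * W).
  move: Y0; rewrite le_eqVlt => /orP[/eqP<-|Yp].
    have := mulr_ge0 (ltW cr0) W0; lra.
  rewrite -(ler_pM2r Yp).
  have := ler_wpM2l (ltW cr0) YF; have := ler_wpM2l (ltW pq20) V; lra.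
have FE : F <= 8 / c ^+ 2 * (p ^+ 2 * q ^+ 2 / r ^+ 2) + 4 / c * (W / r).
  have -> : 8 / c ^+ 2 * (p ^+ 2 * q ^+ 2 / r ^+ 2) + 4 / c * (W / r) =
    (8 * (p ^+ 2 * q ^+ 2) + 4 * (c * r * W)) / (c * r) ^+ 2.
    by field; rewrite !gt_eqF.
  rewrite ler_pdivlMr ?exprn_gt0//.
  have := ler_wpM2l (ltW cr0) V; lra.
apply: (le_trans FE); exact: bound_collect D0 D20 T10 T20 a0 b0 T3.
Qed.

(** A deterministic statement: all that is asked of the vectors [a] is the lower bound for the given
    [x0]. *)
Lemma recovery d k m (a : 'I_m -> 'cV[C]_d) (x0 x : 'cV[C]_d) (wC : 'cV[C]_m) (mu c : R) :
  (0 < k)%N -> (0 < m)%N -> 0 < mu -> 0 < c -> (norm0 x0 <= k)%N ->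
  (forall h : 'I_d * bool -> R, dotp (rlJ h) (rl x0) = 0 ->
    - dotp (rl x0) (rl x0) <= dotp h (rl x0) ->
    \sum_i `|h i| <= 6 * Num.sqrt k%:R * nrm h ->
    c * m%:R * (nrm h * (nrm (rl x0) + nrm h)) <=
    abs_form (fun j => rl (a j)) h ((2 \*o rl x0) \+ h)) ->
  mu * norm1 (x *m x ^t*)
    + 2^-1 * norm2 (qmeas a (x *m x ^t*) - (qmeas a (x0 *m x0 ^t*) + wC)) ^+ 2
    <= mu * norm1 x0 ^+ 2 + 2^-1 * norm2 wC ^+ 2 ->
  norm2 (x *m x ^t* - x0 *m x0 ^t*) <=
    (1 + 4 / c + 8 / c ^+ 2) * (norm2 wC / Num.sqrt (mu * k%:R)
            * (norm1 x0 + norm2 wC / Num.sqrt mu)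
          + norm2 wC ^+ 2 / (2 * mu * k%:R)
          + mu * k%:R
            * (norm2 wC / (mu * k%:R) + (Num.sqrt m%:R)^-1) ^+ 2).
Proof.
move=> k0 m0 mu0 c0 x0k uniform.
have [x' [<- hJ hpos]] := outer_phase x x0; move: x' hJ hpos => {}x hJ hpos.
set H := x *m x ^t* - x0 *m x0 ^t*.
have -> : qmeas a (x *m x ^t*) - (qmeas a (x0 *m x0 ^t*) + wC) = qmeas a H - wC.
  have subDA (V : zmodType) (u v w : V) : u - (v + w) = u - v - w by rewrite opprD addrA.
  exact: etrans (subDA _ _ _ _) (congr1 (fun u => u - wC) (esym (qmeasB a _ _))).
have := norm1_sparse_outerB (x *m x ^t*) x0k; rewrite -/H norm1_outer.
have := norm2_outerB x x0; rewrite -/H.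
have := abs_form_norm2 a x x0; rewrite -/H.
have nh : norm2 (x - x0) = nrm (rl x \- rl x0) by rewrite norm2_col rlB.
rewrite nh; set h := rl x \- rl x0.
have hx : norm2 x <= norm2 x0 + nrm h by rewrite !norm2_col; exact: nrm_tri.
have hJ0 : dotp (rlJ h) (rl x0) = 0 by rewrite /h rlJB dotpBl hJ dotpJ subrr.
have hpos0 : - dotp (rl x0) (rl x0) <= dotp h (rl x0).
  by rewrite /h dotpBl lerBrDr addNr.
have U := uniform h hJ0 hpos0.
have cone tau := support_cone (tau := tau) x0k.
have rlh := sum_rl_le (x - x0); rewrite rlB -/h in rlh.
have Wtri : norm2 wC <= norm2 (qmeas a H - wC) + norm2 (qmeas a H).
  have {1}-> : wC = - (qmeas a H - wC) + qmeas a H by rewrite opprB subrK.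
  by apply: (le_trans (norm2D _ _)); rewrite norm2N.
have Ytri : norm2 (qmeas a H) <= norm2 (qmeas a H - wC) + norm2 wC.
  by rewrite -{1}(subrK wC (qmeas a H)); exact: norm2D.
move=> absY FH sparse basic.
have kp : 0 < k%:R :> R by rewrite ltr0n.
have mp : 0 < m%:R :> R by rewrite ltr0n.
have sp := sqr_sqrtr (ltW mu0); have sq := sqr_sqrtr (ltW kp); have sr := sqr_sqrtr (ltW mp).
have key := @recovery_arith (Num.sqrt mu) (Num.sqrt k%:R) (Num.sqrt m%:R) c
  (norm2 H) (norm2 (qmeas a H)) (norm2 (qmeas a H - wC)) (norm2 wC)
  (norm1 x) (norm1 x0) (nrm h) (norm2 x) (norm2 x0).
rewrite sp sq sr in key.
rewrite (sqrtrM _ (ltW mu0)); apply: key; rewrite ?sqrtr_gt0//;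
  try exact: norm2_ge0; try exact: norm1_ge0; try exact: norm2_le_norm1.
  exact: nrm_ge0.
move=> nx tau.
(* Origin of the constant 6: the cone bound with [tau <= 2 sqrt k |h|] gives [4 sqrt k |h|], and
   passing to real coordinates multiplies it by [3 / 2]. *)
apply: le_trans absY; rewrite norm2_col; apply: U; apply: (le_trans rlh).
have := cone _ _ nx; rewrite nh -/h; lra.
Qed.

End Recovery.

(** * Rank one and recovery combined on the good event *)

Theorem corollary1p3 (R : realType) :
  exists c C0 C1 : R, [/\ 0 < c, 0 < C0, 0 < C1 &
  forall (d k m : nat), (1 <= k <= d)%N ->
  forall (disp : measure_display) (T : measurableType disp)
    (P : probability T R) (a : 'I_m -> T -> 'cV[R[i]]_d),
  independent_complex_gaussians P a ->
  forall (x0 : 'cV[R[i]]_d) (w : 'cV[R]_m),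
  (norm0 x0 <= k)%N ->
  C0 * k%:R * ln (expR 1 * d%:R / k%:R) <= m%:R ->
  exists E : set T, [/\ measurable E,
    ((1 - expR (- (c * m%:R)))%:E <= P E)%E &
  forall t, E t ->
  let A := qmeas (fun j => a j t) in
  let wC := map_mx (real_complex R) w in
  let b := A (x0 *m x0 ^t*) + wC in
  forall mu lambda : R,
  0 < mu ->
  mu * norm1 x0 ^+ 2 + 2^-1 * norm2 wC ^+ 2 < 2^-1 * norm2 b ^+ 2 ->
  (mu * d%:R + opnorm A * (Num.sqrt (2 * mu) * norm1 x0 + norm2 wC))
    / (Num.sqrt 2 - 1) < lambda ->
  forall X : 'M[R[i]]_d,
  global_minimizer [set Y | psd Y] (objective A b lambda mu) X ->
  \rank X = 1%N /\
  exists2 x : 'cV[R[i]]_d, X = x *m x ^t* &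
    norm2 (x *m x ^t* - x0 *m x0 ^t*) <=
    C1 * (norm2 wC / Num.sqrt (mu * k%:R)
            * (norm1 x0 + norm2 wC / Num.sqrt mu)
          + norm2 wC ^+ 2 / (2 * mu * k%:R)
          + mu * k%:R
            * (norm2 wC / (mu * k%:R) + (Num.sqrt m%:R)^-1) ^+ 2)]].
Proof.
have [c [C0 [c1 [c0 C01 c10 event]]]] := uniform_event R.
exists c, C0, (1 + 4 / c1 + 8 / c1 ^+ 2); split => //.
- exact: lt_le_trans C01.
- by rewrite -addrA ltr_wpDr// addr_ge0// divr_ge0 ?exprn_ge0// ltW.
move=> d k m kd disp T P a gauss x0 w x0k mC.
have [E [mE PE UE]] := event d k m kd disp T P a gauss (rl x0) mC.
exists E; split => // t Et A wC b mu lambda mu0 hb hlam X Xmin.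
have [rX [x Xx] value] := minimizer_outer mu0 (erefl b) hb hlam Xmin.
split => //; exists x => //.
have /andP[k0 _] := kd.
(* The lower bound on [m] is positive because the logarithm is at least 1; this justifies dividing
   by [sqrt m]. *)
have m0 : (0 < m)%N.
  rewrite -(ltr_nat R); apply: lt_le_trans mC.
  have := ln_edk_ge1 R kd; set La := ln _ => La1.
  by rewrite mulr_gt0 ?mulr_gt0 ?ltr0n//; [exact: lt_le_trans C01|exact: lt_le_trans La1].
rewrite Xx in value.
by apply: (recovery k0 m0 mu0 c10 x0k _ value) => h hJ hy h1; exact: UE.
Qed.
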